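(* Let $A$ be a cocommutative graded Hopf algebra carrying an antisymmetric Fox pairing $\rho$ of degree $n\in\mathbb{Z}$. Let $B$ be a commutative ungraded Hopf algebra endowed with a trace-like element $t\in B$, and let $\bullet=\bullet_t:B\times B\to\mathbb{K}$ be the associated balanced biderivation. Let $\{-,-\}$ be the unique $n$-graded bracket in the representation algebra $A_B$ such that $$\{x_b,y_c\}=(-1)^{|x''|\,|y'|_n}\,(c''\bullet b^{(2)})\;\rho(x',y')_{s_B(b^{(3)})\,b^{(1)}}\;x''_{b^{(4)}}\;y''_{c'}\qquad (x,y\in A,\ b,c\in B).$$ If $\rho$ is Gerstenhaber of degree $n$ (as a Fox pairing), then the bracket $\{-,-\}$ in $A_B$ is Gerstenhaber of degree $n$, i.e. it is an antisymmetric $n$-graded bracket satisfying the Jacobi identity $$(-1)^{|u|_n|w|_n}\{u,\{v,w\}\}+(-1)^{|u|_n|v|_n}\{v,\{w,u\}\}+(-1)^{|v|_n|w|_n}\{w,\{u,v\}\}=0$$ for all homogeneous $u,v,w\in A_B$.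
   Context: Conventions. $\mathbb{K}$ is a fixed commutative ring; modules, algebras, coalgebras, bialgebras and Hopf algebras are over $\mathbb{K}$, and $\otimes=\otimes_{\mathbb{K}}$. ''Graded'' means $\mathbb{Z}$-graded; ''ungraded'' objects are concentrated in degree $0$. For homogeneous $x$, $|x|$ is its degree and $|x|_n=|x|+n$. The tensor product of graded algebras has multiplication $(x\otimes b)(y\otimes c)=(-1)^{|b||y|}xy\otimes bc$. A graded algebra is commutative if $xy=(-1)^{|x||y|}yx$ for homogeneous $x,y$. In a graded bialgebra $A$ the comultiplication $\Delta_A$ and counit $\varepsilon_A$ are graded algebra homomorphisms; a graded Hopf algebra has in addition a graded linear antipode $s_A$ with $s_A(x')x''=x's_A(x'')=\varepsilon_A(x)1_A$. Sweedler notation: $\Delta(x)=x'\otimes x''=x^{(1)}\otimes x^{(2)}$, with iterated comultiplications $x'\otimes x''\otimes x'''=x^{(1)}\otimes x^{(2)}\otimes x^{(3)}$, etc.; components are homogeneous and, for $x$ homogeneous, their degrees sum to $|x|$. $A$ is cocommutative if $x'\otimes x''=(-1)^{|x'||x''|}x''\otimes x'$ (then $s_A^2=\mathrm{id}$). Representation algebra. For graded bialgebras $A,B$, $A_B$ is the graded algebra generated by symbols $x_b$ ($x\in A$, $b\in B$), with $|x_b|=|x|+|b|$ for homogeneous $x,b$, subject to: bilinearity of $x_b$ in $(x,b)$; $(xy)_b=x_{b'}y_{b''}$; $(1_A)_b=\varepsilon_B(b)1$; $x_{bc}=x'_b x''_c$; $x_{(1_B)}=\varepsilon_A(x)1$;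 and $x_by_c=(-1)^{|x_b||y_c|}y_cx_b$. Brackets. An $n$-graded bracket in a graded algebra $R$ is a bilinear map $\{-,-\}:R\times R\to R$ with $\{R^p,R^q\}\subset R^{p+q+n}$ and, for homogeneous $x,y,z$, $\{x,yz\}=\{x,y\}z+(-1)^{|x|_n|y|}y\{x,z\}$ and $\{xy,z\}=x\{y,z\}+(-1)^{|y||z|_n}\{x,z\}y$. It is antisymmetric if $\{x,y\}=-(-1)^{|x|_n|y|_n}\{y,x\}$. Fox pairings. A Fox pairing of degree $n$ in $A$ is a bilinear map $\rho:A\times A\to A$ with $\rho(A^p,A^q)\subset A^{p+q+n}$, $\rho(x,yz)=\rho(x,y)z+\varepsilon_A(y)\rho(x,z)$ and $\rho(xy,z)=\rho(x,z)\varepsilon_A(y)+x\rho(y,z)$. It is antisymmetric if $(-1)^{|x|_n|y|_n}s_A^{-1}\rho(s_A(y),s_A(x))=-\rho(x,y)$ for homogeneous $x,y$. Tritensor map and Gerstenhaber Fox pairings. For a permutation $(i_1,i_2,i_3)$ of $(1,2,3)$ let $\mathsf{P}_{i_1i_2i_3}:A^{\otimes3}\to A^{\otimes3}$ be the linear map $x_1\otimes x_2\otimes x_3\mapsto(-1)^{t}x_{i_1}\otimes x_{i_2}\otimes x_{i_3}$ for homogeneous $x_i$, where $t$ is the sum of the products $|x_{i_p}||x_{i_q}|$ over all $p<q$ with $i_p>i_q$; $\mathsf{P}_{i_1i_2i_3,n}$ is defined in the same way with $|\cdot|_n$ in place of $|\cdot|$. Put $s=s_A$. For an antisymmetric Fox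 pairing $\rho$ of degree $n$ define the linear map $\digamma:A^{\otimes3}\to A^{\otimes3}$ on homogeneous $x,y,z$ by $$\digamma(x,y,z)=(-1)^{e}\;y'\,s\big(\rho(x'',y'')'\big)\,x'\;\otimes\; z'\,s\big(\rho(\rho(x'',y'')''',z'')'\big)\,\rho(x'',y'')''\;\otimes\;\rho(\rho(x'',y'')''',z'')'',$$ $$e=|y'||x|_n+|z'||x''y''|+|x'z'||\rho(x'',y'')'|+|\rho(x'',y'')''|\,|\rho(\rho(x'',y'')''',z'')'| ,$$ where $\rho(x'',y'')'\otimes\rho(x'',y'')''\otimes\rho(x'',y'')'''$ is the iterated comultiplication of $\rho(x'',y'')$. The tritensor map induced by $\rho$ is $\|-,-,-\|=\sum_{i=0}^{2}\mathsf{P}_{312}^{i}\circ\digamma\circ\mathsf{P}_{312,n}^{-i}\in\mathrm{End}(A^{\otimes3})$. The Fox pairing $\rho$ is Gerstenhaber of degree $n$ if this endomorphism is identically $0$. Balanced biderivations and trace-like elements. Let $B$ be an ungraded Hopf algebra, $I=\mathrm{Ker}\,\varepsilon_B$. A bilinear form $\bullet:B\times B\to\mathbb{K}$ is a biderivation if $(bc)\bullet d=\varepsilon_B(b)\,c\bullet d+\varepsilon_B(c)\,b\bullet d$ and $b\bullet(cd)=\varepsilon_B(c)\,b\bullet d+\varepsilon_B(d)\,b\bullet c$; it is balanced if $(b\bullet c'')s_B(c')c'''=(c\bullet b'')s_B(b''')b'$ for all $b,c$. Let $\mathfrak g$ be the module of derivations $\mu:B\to\mathbb{K}$ (linear maps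 with $\mu(bc)=\varepsilon_B(b)\mu(c)+\varepsilon_B(c)\mu(b)$) and $p:B\to I/I^2$, $p(b)=b-\varepsilon_B(b)1_B \bmod I^2$. An element $t\in B$ is trace-like if it is cosymmetric, i.e. $t'\otimes t''=t''\otimes t'$, and infinitesimally-nonsingular, i.e. the linear map $\mathfrak g\to I/I^2$, $\mu\mapsto\mu(t')p(t'')$ is an isomorphism. For such $t$ and $b\in B$ let $\overline b\in\mathfrak g$ be the preimage of $p(b)$ under this isomorphism, and put $b\bullet_tc=\overline b(c)$. When $B$ is commutative, $\bullet_t$ is a balanced biderivation in $B$. For an antisymmetric Fox pairing $\rho$ in a cocommutative graded Hopf algebra $A$ and a balanced biderivation $\bullet$ in a commutative ungraded Hopf algebra $B$, the bracket displayed in the claim exists, is unique, and is antisymmetric. *)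

(* Defs.v *)
From HB Require Import structures.
From mathcomp Require Import all_boot all_order all_algebra.
From mathcomp Require Import boolp.

Set Implicit Arguments.
Unset Strict Implicit.
Unset Printing Implicit Defensive.

Import GRing.Theory.
Local Open Scope ring_scope.
Local Open Scope quotient_scope.

(* The parity of an integer is that of its absolute value. *)
Definition ksign (K : comNzRingType) (k : int) : K := (-1) ^+ `|k|%N.

(* The inverse of a bijection f; the junk value x0 is only returned when y is
   not a value of f. *)
Definition finv (X Y : Type) (x0 : X) (f : X -> Y) (y : Y) : X :=
  if pselect (exists x, f x = y) is left e then projT1 (cid e) else x0.

Definition is_bilinear (K : comNzRingType) (U V W : lmodType K)
    (f : U -> V -> W) : Prop :=
  (forall v, linear (f^~ v)) /\ (forall u, linear (f u)).

Section Tensor.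
Variables (K : comNzRingType) (M N : lmodType K).

(* A formal sum of pure tensors is the list of its terms; scalars are absorbed
   in the factors. *)
Inductive tensor_rel : seq (M * N) -> seq (M * N) -> Prop :=
| tensor_refl s : tensor_rel s s
| tensor_sym s t : tensor_rel s t -> tensor_rel t s
| tensor_trans s t u : tensor_rel s t -> tensor_rel t u -> tensor_rel s u
| tensor_cat s s' t t' :
    tensor_rel s s' -> tensor_rel t t' -> tensor_rel (s ++ t) (s' ++ t')
| tensor_catC s t : tensor_rel (s ++ t) (t ++ s)
| tensor_zero : tensor_rel [:: (0, 0)] [::]
| tensor_Dl m m' n : tensor_rel [:: (m + m', n)] [:: (m, n); (m', n)]
| tensor_Dr m n n' : tensor_rel [:: (m, n + n')] [:: (m, n); (m, n')]
| tensor_Z a m n : tensor_rel [:: (a *: m, n)] [:: (m, a *: n)].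

Definition tensor_relb (s t : seq (M * N)) : bool := `[< tensor_rel s t >].

Lemma tensor_relb_refl : reflexive tensor_relb.
Proof. by move=> s; apply/asboolP; apply: tensor_refl. Qed.

Lemma tensor_relb_sym : symmetric tensor_relb.
Proof. by move=> s t; apply/asboolP/asboolP; apply: tensor_sym. Qed.

Lemma tensor_relb_trans : transitive tensor_relb.
Proof.
by move=> t s u /asboolP st /asboolP tu; apply/asboolP/(tensor_trans st).
Qed.

Canonical tensor_equiv :=
  EquivRel tensor_relb tensor_relb_refl tensor_relb_sym tensor_relb_trans.

Definition tensor : Type := {eq_quot tensor_equiv}.
HB.instance Definition _ := Choice.on tensor.

Definition terms (T : tensor) : seq (M * N) := repr (T : {eq_quot tensor_equiv}).
Definition tsum (s : seq (M * N)) : tensor := \pi_({eq_quot tensor_equiv}) s.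
Definition tpure (m : M) (n : N) : tensor := tsum [:: (m, n)].

Lemma tsumP s t : tsum s = tsum t <-> tensor_rel s t.
Proof. by split=> [/eqquotP/asboolP|h]; last by apply/eqquotP/asboolP. Qed.

Lemma termsK T : tsum (terms T) = T.
Proof. by rewrite /tsum /terms reprK. Qed.

Lemma terms_rel s : tensor_rel (terms (tsum s)) s.
Proof. by apply/tsumP; rewrite termsK. Qed.

Definition tzero : tensor := tsum [::].
Definition tadd (S T : tensor) : tensor := tsum (terms S ++ terms T).
Definition tscale (a : K) (T : tensor) : tensor :=
  tsum [seq (a *: u.1, u.2) | u <- terms T].

Lemma tsum_cat s t : tadd (tsum s) (tsum t) = tsum (s ++ t).
Proof. by apply/tsumP; apply: tensor_cat; apply: terms_rel. Qed.

Lemma tensor_0l n : tensor_rel [:: (0, n)] [::].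
Proof.
apply: (tensor_trans _ tensor_zero).
have := tensor_Z 0 0 n; rewrite !scale0r; apply: tensor_trans.
exact: tensor_refl.
Qed.

Lemma tensor_scale a s t : tensor_rel s t ->
  tensor_rel [seq (a *: u.1, u.2) | u <- s] [seq (a *: u.1, u.2) | u <- t].
Proof.
elim=> {s t} [s|s t _|s t u _ h1 _ h2|s s' t t' _ h1 _ h2|s t||m m' n|m n n'|b m n]
  /=.
- exact: tensor_refl.
- exact: tensor_sym.
- exact: tensor_trans h1 h2.
- by rewrite !map_cat; apply: tensor_cat.
- by rewrite !map_cat; apply: tensor_catC.
- by rewrite scaler0; apply: tensor_zero.
- by rewrite scalerDr; apply: tensor_Dl.
- exact: tensor_Dr.
- by rewrite scalerA mulrC -scalerA; apply: tensor_Z.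
Qed.

Lemma tsum_scale a s : tscale a (tsum s) = tsum [seq (a *: u.1, u.2) | u <- s].
Proof. by apply/tsumP; apply: tensor_scale; apply: terms_rel. Qed.

Lemma taddA : associative tadd.
Proof.
move=> S T U; rewrite -(termsK S) -(termsK T) -(termsK U).
by rewrite !tsum_cat catA.
Qed.

Lemma taddC : commutative tadd.
Proof. by move=> S T; apply/tsumP; apply: tensor_catC. Qed.

Lemma tadd0 : left_id tzero tadd.
Proof. by move=> T; rewrite -(termsK T) tsum_cat. Qed.

Lemma tscaleDl T a b : tscale (a + b) T = tadd (tscale a T) (tscale b T).
Proof.
rewrite -(termsK T) !tsum_scale tsum_cat; apply/tsumP.
elim: (terms T) => [|[m n] s ih] /=; first exact: tensor_refl.
rewrite scalerDl -cat1s.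
apply: (tensor_trans (tensor_cat (tensor_Dl _ _ _) ih)) => /=.
rewrite -(cat1s (a *: m, n)) -[in X in tensor_rel _ X](cat1s (a *: m, n)).
apply: tensor_cat; first exact: tensor_refl.
rewrite -cat1s -[in X in tensor_rel _ X]cat1s !catA.
by apply: tensor_cat; [apply: tensor_catC | apply: tensor_refl].
Qed.

Lemma tscale0 T : tscale 0 T = tzero.
Proof.
rewrite -(termsK T) tsum_scale; apply/tsumP.
elim: (terms T) => [|[m n] s ih] /=; first exact: tensor_refl.
by rewrite scale0r -cat1s -[[::]]cat0s; apply: tensor_cat (tensor_0l _) ih.
Qed.

Lemma tscale1 : left_id 1 tscale.
Proof.
move=> T; rewrite -{1}(termsK T) tsum_scale -[RHS]termsK; congr tsum.
by rewrite -[RHS]map_id; apply: eq_map => -[m n] /=; rewrite scale1r.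
Qed.

Lemma tscaleA a b T : tscale a (tscale b T) = tscale (a * b) T.
Proof.
rewrite -(termsK T) !tsum_scale -map_comp; congr tsum.
by apply: eq_map => -[m n] /=; rewrite scalerA.
Qed.

Lemma tscaleDr : right_distributive tscale tadd.
Proof.
move=> a S T; rewrite -(termsK S) -(termsK T).
by rewrite tsum_cat !tsum_scale tsum_cat map_cat.
Qed.

Lemma taddN : left_inverse tzero (tscale (-1)) tadd.
Proof.
by move=> T; rewrite -{2}(tscale1 T) -tscaleDl addNr tscale0.
Qed.

HB.instance Definition _ := GRing.isZmodule.Build tensor taddA taddC tadd0 taddN.
HB.instance Definition _ :=
  GRing.Zmodule_isLmodule.Build K tensor tscaleA tscale1 tscaleDr tscaleDl.

Lemma tsumE s : tsum s = \sum_(u <- s) tpure u.1 u.2.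
Proof.
elim: s => [|[m n] s ih]; first by rewrite big_nil.
by rewrite big_cons -ih -cat1s -tsum_cat.
Qed.

Lemma termsE T : T = \sum_(u <- terms T) tpure u.1 u.2.
Proof. by rewrite -tsumE termsK. Qed.

Section Lift.
Variables (W : zmodType) (f : M -> N -> W).
Hypotheses (fDl : forall n, {morph f^~ n : m m' / m + m'})
  (fDr : forall m, {morph f m : n n' / n + n'})
  (fZ : forall a m n, f (a *: m) n = f m (a *: n)).

Lemma sum_rel s t : tensor_rel s t ->
  \sum_(u <- s) f u.1 u.2 = \sum_(u <- t) f u.1 u.2.
Proof.
elim=> {s t} [s|s t _|s t u _ h1 _ h2|s s' t t' _ h1 _ h2|s t||m m' n|m n n'|a m n]
  //=.
- by rewrite h1.
- by rewrite !big_cat h1 h2.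
- by rewrite !big_cat /= addrC.
- rewrite big_seq1 big_nil /=; apply: (addIr (f 0 0)).
  by rewrite add0r -fDl addr0.
- by rewrite !big_cons !big_nil !addr0 fDl.
- by rewrite !big_cons !big_nil !addr0 fDr.
- by rewrite !big_seq1 fZ.
Qed.

Lemma sum_terms_tsum s :
  \sum_(u <- terms (tsum s)) f u.1 u.2 = \sum_(u <- s) f u.1 u.2.
Proof. exact/sum_rel/terms_rel. Qed.

Lemma sum_termsD S T : \sum_(u <- terms (S + T)) f u.1 u.2 =
  \sum_(u <- terms S) f u.1 u.2 + \sum_(u <- terms T) f u.1 u.2.
Proof. by rewrite (sum_terms_tsum (terms S ++ terms T)) big_cat. Qed.

Lemma sum_terms0 : \sum_(u <- terms 0) f u.1 u.2 = 0.
Proof. by rewrite (sum_terms_tsum [::]) big_nil. Qed.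

Lemma sum_terms_sum (I : Type) (r : seq I) (F : I -> tensor) :
  \sum_(u <- terms (\sum_(i <- r) F i)) f u.1 u.2 =
  \sum_(i <- r) \sum_(u <- terms (F i)) f u.1 u.2.
Proof.
elim: r => [|i r ih]; first by rewrite !big_nil sum_terms0.
by rewrite !big_cons sum_termsD ih.
Qed.
End Lift.

Lemma tpure_bilinear : is_bilinear tpure.
Proof.
have tZl a m n : tpure (a *: m) n = a *: tpure m n.
  by rewrite /tpure -[RHS]/(tscale _ _) tsum_scale.
split=> [n a m m'|m a n n'].
  rewrite -tZl -[RHS]/(tadd _ _) tsum_cat.
  by apply/tsumP; apply: tensor_Dl.
rewrite -tZl -[RHS]/(tadd _ _) tsum_cat.
apply/tsumP; apply: (tensor_trans (tensor_Dr _ _ _)).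
rewrite -cat1s -[in X in tensor_rel _ X]cat1s.
apply: tensor_cat; last exact: tensor_refl.
by apply: tensor_sym; apply: tensor_Z.
Qed.
End Tensor.

Notation "x ⊗ y" := (tpure x y) (at level 35, right associativity) : ring_scope.

Section QuotientModule.
Variables (K : comNzRingType) (V : lmodType K) (S : V -> Prop).
Hypothesis Slin : S 0 /\ forall a u v, S u -> S v -> S (a *: u + v).

Definition modS (u v : V) : bool := `[< S (u - v) >].

Lemma submodN u : S u -> S (- u).
Proof. by case: Slin => S0 SZ Su; have := SZ (-1) u 0 Su S0; rewrite addr0 scaleN1r. Qed.

Lemma submodD u v : S u -> S v -> S (u + v).
Proof. by case: Slin => _ SZ Su Sv; have := SZ 1 u v Su Sv; rewrite scale1r. Qed.

Lemma submodZ a u : S u -> S (a *: u).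
Proof. by case: Slin => S0 SZ Su; have := SZ a u 0 Su S0; rewrite addr0. Qed.

Lemma modS_refl : reflexive modS.
Proof. by move=> u; apply/asboolP; rewrite subrr; case: Slin. Qed.

Lemma modS_sym : symmetric modS.
Proof.
by move=> u v; apply/asboolP/asboolP => /submodN; rewrite opprB.
Qed.

Lemma modS_trans : transitive modS.
Proof.
move=> v u w /asboolP uv /asboolP vw; apply/asboolP.
by rewrite -[u](subrK v) -addrA; apply: submodD.
Qed.

Canonical modS_equiv := EquivRel modS modS_refl modS_sym modS_trans.

Definition lquot : Type := {eq_quot modS_equiv}.
HB.instance Definition _ := Choice.on lquot.

Definition lquot_pi (v : V) : lquot := \pi_({eq_quot modS_equiv}) v.
Definition lquot_repr (q : lquot) : V := repr (q : {eq_quot modS_equiv}).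

Lemma lquotP u v : lquot_pi u = lquot_pi v <-> S (u - v).
Proof. by split=> [/eqquotP/asboolP|h]; last by apply/eqquotP/asboolP. Qed.

Lemma lquotK q : lquot_pi (lquot_repr q) = q.
Proof. by rewrite /lquot_pi /lquot_repr reprK. Qed.

Definition qadd (q r : lquot) : lquot := lquot_pi (lquot_repr q + lquot_repr r).
Definition qopp (q : lquot) : lquot := lquot_pi (- lquot_repr q).
Definition qscale a (q : lquot) : lquot := lquot_pi (a *: lquot_repr q).

Lemma qaddE u v : qadd (lquot_pi u) (lquot_pi v) = lquot_pi (u + v).
Proof.
apply/lquotP; rewrite opprD addrACA.
by apply: submodD; apply/lquotP; rewrite lquotK.
Qed.

Lemma qoppE u : qopp (lquot_pi u) = lquot_pi (- u).
Proof. by apply/lquotP; rewrite -opprD; apply/submodN/lquotP; rewrite lquotK. Qed.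

Lemma qscaleE a u : qscale a (lquot_pi u) = lquot_pi (a *: u).
Proof. by apply/lquotP; rewrite -scalerBr; apply/submodZ/lquotP; rewrite lquotK. Qed.

Lemma qaddA : associative qadd.
Proof.
move=> q r s; rewrite -(lquotK q) -(lquotK r) -(lquotK s).
by rewrite !qaddE addrA.
Qed.

Lemma qaddC : commutative qadd.
Proof. by move=> q r; rewrite /qadd addrC. Qed.

Lemma qadd0 : left_id (lquot_pi 0) qadd.
Proof. by move=> q; rewrite -(lquotK q) qaddE add0r. Qed.

Lemma qaddN : left_inverse (lquot_pi 0) qopp qadd.
Proof. by move=> q; rewrite -(lquotK q) qoppE qaddE addNr. Qed.

HB.instance Definition _ := GRing.isZmodule.Build lquot qaddA qaddC qadd0 qaddN.

Lemma qscaleA a b q : qscale a (qscale b q) = qscale (a * b) q.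
Proof. by rewrite -(lquotK q) !qscaleE scalerA. Qed.

Lemma qscale1 : left_id 1 qscale.
Proof. by move=> q; rewrite -(lquotK q) qscaleE scale1r. Qed.

Lemma qscaleDr : right_distributive qscale +%R.
Proof.
move=> a q r; rewrite -(lquotK q) -(lquotK r).
by rewrite -![_ + _]/(qadd _ _) !(qaddE, qscaleE) scalerDr.
Qed.

Lemma qscaleDl q : {morph qscale^~ q : a b / a + b}.
Proof.
move=> a b; rewrite -(lquotK q) -[X in _ = X]/(qadd _ _).
by rewrite !(qaddE, qscaleE) scalerDl.
Qed.

HB.instance Definition _ :=
  GRing.Zmodule_isLmodule.Build K lquot qscaleA qscale1 qscaleDr qscaleDl.
End QuotientModule.

(* A Z-grading: V is the direct sum of the submodules homog p. *)
HB.mixin Record Lmodule_isGraded (K : comNzRingType) V of GRing.Lmodule K V := {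
  homog : int -> V -> Prop;
  homog0 : forall p, homog p 0;
  homogP : forall p a u v, homog p u -> homog p v -> homog p (a *: u + v);
  homog_span : forall v, exists (r : seq int) (f : int -> V),
    (forall p, homog p (f p)) /\ v = \sum_(p <- r) f p;
  homog_indep : forall (r : seq int) (f : int -> V), uniq r ->
    (forall p, homog p (f p)) -> \sum_(p <- r) f p = 0 ->
    forall p, p \in r -> f p = 0
}.

#[short(type="gradedLmodType")]
HB.structure Definition GradedLmodule (K : comNzRingType) :=
  { V of GRing.Lmodule K V & Lmodule_isGraded K V }.

HB.mixin Record isGradedAlgebra (K : comNzRingType) A
    of GRing.Algebra K A & GradedLmodule K A := {
  homog1 : @homog K A 0 1;
  homogM : forall p q (x y : A), homog p x -> homog q y -> homog (p + q) (x * y)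
}.

#[short(type="gradedAlgType")]
HB.structure Definition GradedAlgebra (K : comNzRingType) :=
  { A of GRing.Algebra K A & GradedLmodule K A & isGradedAlgebra K A }.

Record helt (K : comNzRingType) (V : gradedLmodType K) :=
  HElt { deg : int; el : V; elP : homog deg el }.

(* A choice of a decomposition of v as a sum of homogeneous elements. *)
Definition hdec (K : comNzRingType) (V : gradedLmodType K) (v : V) : seq (helt V) :=
  let r := cid (homog_span v) in
  let f := cid (projT2 r) in
  [seq HElt ((projT2 f).1 p) | p <- projT1 r].

Section Homogeneous.
Variables (K : comNzRingType) (U V : gradedLmodType K).

(* A decomposition of T as a sum of pure tensors of homogeneous elements. It
   is a choice, but a sum over it of terms which for fixed degrees are bilinear
   in the two factors does not depend on this choice, and only the components
   of T of the corresponding bidegrees contribute to it. *)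
Definition hterms (T : tensor U V) : seq (helt U * helt V) :=
  flatten [seq [seq (a, b) | a <- hdec u.1, b <- hdec u.2] | u <- terms T].

Definition thomog (p : int) (T : tensor U V) : Prop :=
  exists s : seq (U * V),
    (forall u, u \in s -> exists q, homog q u.1 /\ homog (p - q) u.2) /\
    T = \sum_(u <- s) u.1 ⊗ u.2.
End Homogeneous.

Section GradedTensorAlgebra.
Variables (K : comNzRingType) (A B : gradedAlgType K).

Definition tmul (S T : tensor A B) : tensor A B :=
  \sum_(u <- hterms S) \sum_(v <- hterms T)
    ksign K (deg u.2 * deg v.1) *: ((el u.1 * el v.1) ⊗ (el u.2 * el v.2)).
End GradedTensorAlgebra.

HB.mixin Record isGradedBialgebra (K : comNzRingType) A of GradedAlgebra K A := {
  comul : A -> tensor A A;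
  counit : A -> K;
  comul_linear : linear comul;
  counit_scalar : scalar counit;
  comul_homog : forall p (x : A), homog p x -> thomog p (comul x);
  counit_homog : forall p (x : A), homog p x -> p != 0 -> counit x = 0;
  coassoc : forall x : A,
    \sum_(u <- terms (comul x)) \sum_(v <- terms (comul u.1)) v.1 ⊗ v.2 ⊗ u.2 =
    \sum_(u <- terms (comul x)) \sum_(v <- terms (comul u.2)) u.1 ⊗ v.1 ⊗ v.2;
  counitl : forall x : A, \sum_(u <- terms (comul x)) counit u.1 *: u.2 = x;
  counitr : forall x : A, \sum_(u <- terms (comul x)) counit u.2 *: u.1 = x;
  comul1 : comul 1 = 1 ⊗ 1;
  comulM : forall x y : A, comul (x * y) = tmul (comul x) (comul y);
  counit1 : counit 1 = 1;
  counitM : forall x y : A, counit (x * y) = counit x * counit y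
}.

#[short(type="gradedBialgType")]
HB.structure Definition GradedBialgebra (K : comNzRingType) :=
  { A of GradedAlgebra K A & isGradedBialgebra K A }.

HB.mixin Record isGradedHopf (K : comNzRingType) A of GradedBialgebra K A := {
  antipode : A -> A;
  antipode_linear : linear antipode;
  antipode_homog : forall p (x : A), homog p x -> homog p (antipode x);
  antipodel : forall x : A,
    \sum_(u <- terms (comul x)) antipode u.1 * u.2 = counit x *: 1;
  antipoder : forall x : A,
    \sum_(u <- terms (comul x)) u.1 * antipode u.2 = counit x *: 1
}.

#[short(type="gradedHopfType")]
HB.structure Definition GradedHopf (K : comNzRingType) :=
  { A of GradedBialgebra K A & isGradedHopf K A }.

HB.instance Definition _ (K : comNzRingType) (A : gradedBialgType K) :=
  GRing.isLinear.Build K A (tensor A A) _ (@comul K A) comul_linear.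
HB.instance Definition _ (K : comNzRingType) (A : gradedBialgType K) :=
  GRing.isLinear.Build K A K _ (@counit K A) counit_scalar.
HB.instance Definition _ (K : comNzRingType) (A : gradedHopfType K) :=
  GRing.isLinear.Build K A A _ (@antipode K A) antipode_linear.

Lemma additive0 (U W : zmodType) (g : U -> W) :
  {morph g : u v / u + v} -> g 0 = 0.
Proof. by move=> gD; apply: (addIr (g 0)); rewrite -gD !add0r. Qed.

Lemma additive_sum (U W : zmodType) (g : U -> W) (I : Type) (r : seq I) F :
  {morph g : u v / u + v} -> g (\sum_(i <- r) F i) = \sum_(i <- r) g (F i).
Proof.
move=> gD; elim: r => [|i r ih]; first by rewrite !big_nil additive0.
by rewrite !big_cons gD ih.
Qed.

Lemma additive_sum_cond (U W : zmodType) (g : U -> W) (I : Type) (r : seq I)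
    (P : pred I) F : {morph g : u v / u + v} ->
  g (\sum_(i <- r | P i) F i) = \sum_(i <- r | P i) g (F i).
Proof. by move=> gD; rewrite -big_filter additive_sum // big_filter. Qed.

Section HomogeneousSums.
Variables (K : comNzRingType) (V : gradedLmodType K) (W : zmodType).
Implicit Types (x y : V) (l : seq (helt V)).

Lemma homogZ p k x : homog p x -> homog p (k *: x).
Proof. by move=> hx; rewrite -[_ *: _]addr0; apply: homogP (homog0 _). Qed.

Lemma homogD p x y : homog p x -> homog p y -> homog p (x + y).
Proof. by move=> hx hy; rewrite -[x]scale1r; apply: homogP. Qed.

Lemma homog_sum p (I : Type) (r : seq I) (P : pred I) (F : I -> V) :
  (forall i, P i -> homog p (F i)) -> homog p (\sum_(i <- r | P i) F i).
Proof. by move=> h; elim/big_ind: _ => //; [apply: homog0 | apply: homogD]. Qed.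

Lemma hdecE x : x = \sum_(a <- hdec x) el a.
Proof. by rewrite /hdec; case: cid => r /= ?; case: cid => f /= [hf e]; rewrite big_map. Qed.

Definition helt0 : helt V := HElt (homog0 0).
Definition heltZ k (a : helt V) : helt V := HElt (homogZ k (elP a)).

Variable G : int -> V -> W.
Hypothesis GD : forall p, {morph G p : x y / x + y}.

Lemma helt_sum_split (U : zmodType) (H : int -> V -> U) (r : seq int) l :
  uniq r -> all (fun a => deg a \in r) l ->
  \sum_(a <- l) H (deg a) (el a) =
  \sum_(p <- r) \sum_(a <- l | deg a == p) H p (el a).
Proof.
move=> ur; elim: l => [_|a l ih /= /andP[ar lr]].
  by rewrite big_nil big1_seq // => p _; rewrite big_nil.
rewrite big_cons ih //.
under [RHS]eq_bigr => p _ do rewrite big_cons.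
rewrite [RHS](bigD1_seq (deg a)) //= eqxx [in LHS](bigD1_seq (deg a)) //= addrA.
congr (_ + _); apply: eq_bigr => p pa.
by rewrite eq_sym (negbTE pa).
Qed.

Lemma helt_sum_eq0 l : \sum_(a <- l) el a = 0 ->
  \sum_(a <- l) G (deg a) (el a) = 0.
Proof.
move=> l0; set r := undup [seq deg a | a <- l].
have ur : uniq r by apply: undup_uniq.
have lr : all (fun a => deg a \in r) l.
  have : {subset [seq deg a | a <- l] <= r} by move=> p; rewrite mem_undup.
  elim: (l) => //= a l' ih sub; rewrite sub ?inE ?eqxx //=; apply: ih => p pl.
  by apply: sub; rewrite inE pl orbT.
rewrite (helt_sum_split _ ur lr) big_seq big1 // => p pr.
rewrite -additive_sum_cond //.
rewrite (@homog_indep _ _ r (fun p => \sum_(a <- l | deg a == p) el a)) //.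
- exact: additive0.
- by move=> q; apply: homog_sum => a /eqP <-; apply: elP.
- by rewrite -(helt_sum_split (fun _ => id) ur lr).
Qed.

Lemma hdec_sum x l : x = \sum_(a <- l) el a ->
  \sum_(a <- hdec x) G (deg a) (el a) = \sum_(a <- l) G (deg a) (el a).
Proof.
move=> xl; have GN p y : G p (- y) = - G p y.
  by apply: (addIr (G p y)); rewrite -GD !addNr additive0.
apply/eqP; rewrite -subr_eq0; apply/eqP.
rewrite -sumrN.
transitivity (\sum_(a <- hdec x ++ map (heltZ (-1)) l) G (deg a) (el a)).
  rewrite big_cat big_map /=; congr (_ + _); apply: eq_bigr => a _.
  by rewrite scaleN1r GN.
apply: helt_sum_eq0; rewrite big_cat big_map /= -hdecE [in LHS]xl -big_split big1 //=.
by move=> a _; rewrite scaleN1r subrr.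
Qed.

Lemma hdec_homog p x : homog p x ->
  \sum_(a <- hdec x) G (deg a) (el a) = G p x.
Proof.
by move=> hx; rewrite (@hdec_sum x [:: HElt hx]) big_seq1.
Qed.

Lemma hdecD x y : \sum_(a <- hdec (x + y)) G (deg a) (el a) =
  \sum_(a <- hdec x) G (deg a) (el a) + \sum_(a <- hdec y) G (deg a) (el a).
Proof. by rewrite (@hdec_sum _ (hdec x ++ hdec y)) big_cat //= -!hdecE. Qed.

Lemma hdecZ k x : \sum_(a <- hdec (k *: x)) G (deg a) (el a) =
  \sum_(a <- hdec x) G (deg a) (k *: el a).
Proof.
rewrite (@hdec_sum _ (map (heltZ k) (hdec x))) big_map //=.
by rewrite -scaler_sumr -hdecE.
Qed.
End HomogeneousSums.

Lemma hdecM (K : comNzRingType) (A : gradedAlgType K) (W : zmodType)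
    (G : int -> A -> W) (x y : A) : (forall p, {morph G p : u v / u + v}) ->
  \sum_(a <- hdec (x * y)) G (deg a) (el a) =
  \sum_(a <- hdec x) \sum_(b <- hdec y) G (deg a + deg b) (el a * el b).
Proof.
move=> GD; rewrite (@hdec_sum _ _ _ G GD _
  [seq HElt (homogM _ _ _ _ (elP a) (elP b)) | a <- hdec x, b <- hdec y]).
  by rewrite big_allpairs_dep.
rewrite big_allpairs_dep /= {1}(hdecE x) {1}(hdecE y) big_distrlr.
by [].
Qed.

Section ComulSums.
Variables (K : comNzRingType) (C : gradedBialgType K) (W : zmodType).
Variable phi : int -> C -> C -> W.
Hypotheses (phiDl : forall p c, {morph (phi p)^~ c : u v / u + v})
  (phiDr : forall p c, {morph phi p c : u v / u + v})
  (phiZ : forall p k u v, phi p (k *: u) v = phi p u (k *: v)).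

Lemma comul_sum_hdec b :
  \sum_(u <- terms (comul b)) \sum_(d <- hdec u.1) \sum_(e <- hdec u.2)
    phi (deg d + deg e) (el d) (el e) =
  \sum_(c <- hdec b) \sum_(u <- terms (comul (el c))) phi (deg c) u.1 u.2.
Proof.
pose psi (u1 u2 : C) := \sum_(d <- hdec u1) \sum_(e <- hdec u2)
  phi (deg d + deg e) (el d) (el e).
have inD u2 p : {morph (fun z => \sum_(e <- hdec u2) phi (p + deg e) z (el e))
    : u v / u + v}.
  by move=> u v; rewrite -big_split; apply: eq_bigr => e _; rewrite phiDl.
have psiDl u2 : {morph psi^~ u2 : u v / u + v}.
  by move=> u v; apply: (hdecD (fun p => inD u2 p)).
have psiDr u1 : {morph psi u1 : u v / u + v}.
  move=> u v; rewrite /psi -big_split; apply: eq_bigr => d _ /=.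
  by apply: (@hdecD _ _ _ (fun q z => phi (deg d + q) (el d) z)) => q; apply: phiDr.
have psiZ k u1 u2 : psi (k *: u1) u2 = psi u1 (k *: u2).
  rewrite /psi (hdecZ (fun p => inD u2 p)); apply: eq_bigr => d _ /=.
  rewrite (@hdecZ _ _ _ (fun q z => phi (deg d + q) (el d) z)) /=; last first.
    by move=> q; apply: phiDr.
  by apply: eq_bigr => e _; rewrite phiZ.
rewrite -[LHS]/(\sum_(u <- terms (comul b)) psi u.1 u.2).
rewrite {1}(hdecE b) linear_sum sum_terms_sum //; apply: eq_bigr => c _ /=.
have [s [hs ->]] := comul_homog _ _ (elP c).
rewrite -tsumE !sum_terms_tsum //; rewrite big_seq [RHS]big_seq.
apply: eq_bigr => u /hs[q [h1 h2]].
rewrite /psi (hdec_homog (fun p => inD u.2 p) h1).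
rewrite (@hdec_homog _ _ _ (fun r z => phi (q + r) u.1 z) _ _ _ h2) /=; last first.
  by move=> r; apply: phiDr.
by rewrite addrC subrK.
Qed.
End ComulSums.

Section RepresentationAlgebra.
Variables (K : comNzRingType) (A B : gradedBialgType K).

(* The terms of the free K-algebra on the symbols x_b. *)
Inductive rterm : Type :=
| RGen of A & B
| RZero
| ROne
| RAdd of rterm & rterm
| RScale of K & rterm
| RMul of rterm & rterm.

HB.instance Definition _ := gen_eqMixin rterm.
HB.instance Definition _ := gen_choiceMixin rterm.

Definition RSum (s : seq rterm) : rterm := foldr RAdd RZero s.

(* The congruence generated by the axioms of K-algebras and by the defining
   relations of the representation algebra. *)
Inductive rep_rel : rterm -> rterm -> Prop :=
| rep_refl s : rep_rel s s
| rep_sym s t : rep_rel s t -> rep_rel t s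
| rep_trans s t u : rep_rel s t -> rep_rel t u -> rep_rel s u
| rep_add s s' t t' :
    rep_rel s s' -> rep_rel t t' -> rep_rel (RAdd s t) (RAdd s' t')
| rep_scale k s s' : rep_rel s s' -> rep_rel (RScale k s) (RScale k s')
| rep_mul s s' t t' :
    rep_rel s s' -> rep_rel t t' -> rep_rel (RMul s t) (RMul s' t')
| rep_addA s t u : rep_rel (RAdd s (RAdd t u)) (RAdd (RAdd s t) u)
| rep_addC s t : rep_rel (RAdd s t) (RAdd t s)
| rep_add0 s : rep_rel (RAdd RZero s) s
| rep_addN s : rep_rel (RAdd (RScale (-1) s) s) RZero
| rep_scaleA k l s : rep_rel (RScale k (RScale l s)) (RScale (k * l) s)
| rep_scale1 s : rep_rel (RScale 1 s) s
| rep_scaleDr k s t :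
    rep_rel (RScale k (RAdd s t)) (RAdd (RScale k s) (RScale k t))
| rep_scaleDl k l s :
    rep_rel (RScale (k + l) s) (RAdd (RScale k s) (RScale l s))
| rep_mulA s t u : rep_rel (RMul s (RMul t u)) (RMul (RMul s t) u)
| rep_mul1 s : rep_rel (RMul ROne s) s
| rep_mulr1 s : rep_rel (RMul s ROne) s
| rep_mulDl s t u : rep_rel (RMul (RAdd s t) u) (RAdd (RMul s u) (RMul t u))
| rep_mulDr s t u : rep_rel (RMul s (RAdd t u)) (RAdd (RMul s t) (RMul s u))
| rep_scaleAl k s t : rep_rel (RScale k (RMul s t)) (RMul (RScale k s) t)
| rep_scaleAr k s t : rep_rel (RScale k (RMul s t)) (RMul s (RScale k t))
| rep_genDl x y b : rep_rel (RGen (x + y) b) (RAdd (RGen x b) (RGen y b))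
| rep_genZl k x b : rep_rel (RGen (k *: x) b) (RScale k (RGen x b))
| rep_genDr x b c : rep_rel (RGen x (b + c)) (RAdd (RGen x b) (RGen x c))
| rep_genZr k x b : rep_rel (RGen x (k *: b)) (RScale k (RGen x b))
| rep_genMl x y b : rep_rel (RGen (x * y) b)
    (RSum [seq RMul (RGen x u.1) (RGen y u.2) | u <- terms (comul b)])
| rep_gen1l b : rep_rel (RGen 1 b) (RScale (counit b) ROne)
| rep_genMr x b c : rep_rel (RGen x (b * c))
    (RSum [seq RMul (RGen u.1 b) (RGen u.2 c) | u <- terms (comul x)])
| rep_gen1r x : rep_rel (RGen x 1) (RScale (counit x) ROne)
| rep_genC p q r s x b y c :
    homog p x -> homog q b -> homog r y -> homog s c ->
    rep_rel (RMul (RGen x b) (RGen y c))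
      (RScale (ksign K ((p + q) * (r + s))) (RMul (RGen y c) (RGen x b))).

Definition rep_relb (s t : rterm) : bool := `[< rep_rel s t >].

Lemma rep_relb_refl : reflexive rep_relb.
Proof. by move=> s; apply/asboolP; apply: rep_refl. Qed.

Lemma rep_relb_sym : symmetric rep_relb.
Proof. by move=> s t; apply/asboolP/asboolP; apply: rep_sym. Qed.

Lemma rep_relb_trans : transitive rep_relb.
Proof.
by move=> t s u /asboolP st /asboolP tu; apply/asboolP/(rep_trans st).
Qed.

Canonical rep_equiv :=
  EquivRel rep_relb rep_relb_refl rep_relb_sym rep_relb_trans.

Definition rep_alg : Type := {eq_quot rep_equiv}.
HB.instance Definition _ := Choice.on rep_alg.

Definition rep_pi (s : rterm) : rep_alg := \pi_({eq_quot rep_equiv}) s.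
Definition rep_repr (u : rep_alg) : rterm := repr (u : {eq_quot rep_equiv}).

Lemma rep_piP s t : rep_pi s = rep_pi t <-> rep_rel s t.
Proof. by split=> [/eqquotP/asboolP|h]; last by apply/eqquotP/asboolP. Qed.

Lemma rep_reprK u : rep_pi (rep_repr u) = u.
Proof. by rewrite /rep_pi /rep_repr reprK. Qed.

Lemma rep_repr_rel s : rep_rel (rep_repr (rep_pi s)) s.
Proof. by apply/rep_piP; rewrite rep_reprK. Qed.

Definition radd (u v : rep_alg) := rep_pi (RAdd (rep_repr u) (rep_repr v)).
Definition rmul (u v : rep_alg) := rep_pi (RMul (rep_repr u) (rep_repr v)).
Definition rscale k (u : rep_alg) := rep_pi (RScale k (rep_repr u)).
Definition rgen (x : A) (b : B) : rep_alg := rep_pi (RGen x b).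

Lemma raddE s t : radd (rep_pi s) (rep_pi t) = rep_pi (RAdd s t).
Proof. by apply/rep_piP; apply: rep_add; apply: rep_repr_rel. Qed.

Lemma rmulE s t : rmul (rep_pi s) (rep_pi t) = rep_pi (RMul s t).
Proof. by apply/rep_piP; apply: rep_mul; apply: rep_repr_rel. Qed.

Lemma rscaleE k s : rscale k (rep_pi s) = rep_pi (RScale k s).
Proof. by apply/rep_piP; apply: rep_scale; apply: rep_repr_rel. Qed.

Let rE := (raddE, rmulE, rscaleE).

Lemma raddA : associative radd.
Proof.
move=> u v w; rewrite -(rep_reprK u) -(rep_reprK v) -(rep_reprK w) !rE.
by apply/rep_piP; apply: rep_addA.
Qed.

Lemma raddC : commutative radd.
Proof. by move=> u v; apply/rep_piP; apply: rep_addC. Qed.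

Lemma radd0 : left_id (rep_pi RZero) radd.
Proof. by move=> u; rewrite -(rep_reprK u) rE; apply/rep_piP; apply: rep_add0. Qed.

Lemma raddN : left_inverse (rep_pi RZero) (rscale (-1)) radd.
Proof. by move=> u; rewrite -(rep_reprK u) !rE; apply/rep_piP; apply: rep_addN. Qed.

Lemma rmulA : associative rmul.
Proof.
move=> u v w; rewrite -(rep_reprK u) -(rep_reprK v) -(rep_reprK w) !rE.
by apply/rep_piP; apply: rep_mulA.
Qed.

Lemma rmul1 : left_id (rep_pi ROne) rmul.
Proof. by move=> u; rewrite -(rep_reprK u) rE; apply/rep_piP; apply: rep_mul1. Qed.

Lemma rmulr1 : right_id (rep_pi ROne) rmul.
Proof. by move=> u; rewrite -(rep_reprK u) rE; apply/rep_piP; apply: rep_mulr1. Qed.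

Lemma rmulDl : left_distributive rmul radd.
Proof.
move=> u v w; rewrite -(rep_reprK u) -(rep_reprK v) -(rep_reprK w) !rE.
by apply/rep_piP; apply: rep_mulDl.
Qed.

Lemma rmulDr : right_distributive rmul radd.
Proof.
move=> u v w; rewrite -(rep_reprK u) -(rep_reprK v) -(rep_reprK w) !rE.
by apply/rep_piP; apply: rep_mulDr.
Qed.

(* The trivial representation x_b |-> counit x * counit b. *)
Fixpoint rep_triv (s : rterm) : K :=
  match s with
  | RGen x b => counit x * counit b
  | RZero => 0
  | ROne => 1
  | RAdd s t => rep_triv s + rep_triv t
  | RScale k s => k * rep_triv s
  | RMul s t => rep_triv s * rep_triv t
  end.

Lemma rep_triv_sum (I : Type) (r : seq I) F :
  rep_triv (RSum [seq F i | i <- r]) = \sum_(i <- r) rep_triv (F i).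
Proof.
by elim: r => [|i r ih] /=; rewrite ?big_nil ?big_cons ?ih.
Qed.

Lemma counit_comul (C : gradedBialgType K) (b : C) :
  \sum_(u <- terms (comul b)) counit u.1 * counit u.2 = counit b.
Proof.
rewrite -[in RHS](counitl b) linear_sum.
by apply: eq_bigr => u _; rewrite linearZ.
Qed.

Lemma rep_triv_rel s t : rep_rel s t -> rep_triv s = rep_triv t.
Proof.
elim=> {s t} //=.
- by move=> s t u _ -> _ ->.
- by move=> s s' t t' _ -> _ ->.
- by move=> k s s' _ ->.
- by move=> s s' t t' _ -> _ ->.
- by move=> s t u; rewrite addrA.
- by move=> s t; rewrite addrC.
- by move=> s; rewrite add0r.
- by move=> s; rewrite mulN1r addNr.
- by move=> k l s; rewrite mulrA.
- by move=> s; rewrite mul1r.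
- by move=> k s t; rewrite mulrDr.
- by move=> k l s; rewrite mulrDl.
- by move=> s t u; rewrite mulrA.
- by move=> s; rewrite mul1r.
- by move=> s; rewrite mulr1.
- by move=> s t u; rewrite mulrDl.
- by move=> s t u; rewrite mulrDr.
- by move=> k s t; rewrite mulrA.
- by move=> k s t; rewrite mulrCA.
- by move=> x y b; rewrite linearD mulrDl.
- by move=> k x b; rewrite linearZ mulrA.
- by move=> x b c; rewrite linearD mulrDr.
- by move=> k x b; rewrite linearZ mulrCA.
- move=> x y b; rewrite rep_triv_sum /= -(counit_comul b) counitM mulr_sumr.
  by apply: eq_bigr => u _; rewrite mulrACA.
- by move=> b; rewrite counit1 mul1r mulr1.
- move=> x b c; rewrite rep_triv_sum /= -(counit_comul x) counitM mulr_suml.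
  by apply: eq_bigr => u _; rewrite mulrACA.
- by move=> x; rewrite counit1.
- move=> p q r s x b y c hx hb hy hc.
  have [->|p0] := eqVneq p 0; last first.
    by rewrite (counit_homog p x hx p0) !(mul0r, mulr0).
  have [->|q0] := eqVneq q 0; last first.
    by rewrite (counit_homog q b hb q0) !(mul0r, mulr0).
  by rewrite addr0 mul0r /ksign expr0 mul1r mulrC.
Qed.

Lemma roner_neq0 : rep_pi ROne != rep_pi RZero.
Proof.
by apply/eqP => /rep_piP/rep_triv_rel/eqP; rewrite /= oner_eq0.
Qed.

HB.instance Definition _ := GRing.isZmodule.Build rep_alg raddA raddC radd0 raddN.
HB.instance Definition _ := GRing.Zmodule_isNzRing.Build rep_alg
  rmulA rmul1 rmulr1 rmulDl rmulDr roner_neq0.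

Lemma rscaleA k l u : rscale k (rscale l u) = rscale (k * l) u.
Proof. by rewrite -(rep_reprK u) !rE; apply/rep_piP; apply: rep_scaleA. Qed.

Lemma rscale1 : left_id 1 rscale.
Proof. by move=> u; rewrite -(rep_reprK u) !rE; apply/rep_piP; apply: rep_scale1. Qed.

Lemma rscaleDr : right_distributive rscale +%R.
Proof.
move=> k u v; rewrite -![_ + _]/(radd _ _).
rewrite -(rep_reprK u) -(rep_reprK v) !rE.
by apply/rep_piP; apply: rep_scaleDr.
Qed.

Lemma rscaleDl u : {morph rscale^~ u : k l / k + l}.
Proof.
move=> k l; rewrite -[X in _ = X]/(radd _ _) -(rep_reprK u) !rE.
by apply/rep_piP; apply: rep_scaleDl.
Qed.

HB.instance Definition _ := GRing.Zmodule_isLmodule.Build K rep_alg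
  rscaleA rscale1 rscaleDr rscaleDl.

Lemma rscaleAl k (u v : rep_alg) : k *: (u * v) = (k *: u) * v.
Proof.
rewrite -(rep_reprK u) -(rep_reprK v).
rewrite -![_ * _]/(rmul _ _) -![_ *: _]/(rscale _ _) !rE.
by apply/rep_piP; apply: rep_scaleAl.
Qed.

Lemma rscaleAr k (u v : rep_alg) : k *: (u * v) = u * (k *: v).
Proof.
rewrite -(rep_reprK u) -(rep_reprK v).
rewrite -![_ * _]/(rmul _ _) -![_ *: _]/(rscale _ _) !rE.
by apply/rep_piP; apply: rep_scaleAr.
Qed.

HB.instance Definition _ := GRing.Lmodule_isLalgebra.Build K rep_alg rscaleAl.
HB.instance Definition _ := GRing.Lalgebra_isAlgebra.Build K rep_alg rscaleAr.

Lemma rep_piD s t : rep_pi (RAdd s t) = rep_pi s + rep_pi t.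
Proof. by rewrite -[RHS]/(radd _ _) rE. Qed.

Lemma rep_piM s t : rep_pi (RMul s t) = rep_pi s * rep_pi t.
Proof. by rewrite -[RHS]/(rmul _ _) rE. Qed.

Lemma rep_piZ k s : rep_pi (RScale k s) = k *: rep_pi s.
Proof. by rewrite -[RHS]/(rscale _ _) rE. Qed.

Lemma rep_pi_sum (I : Type) (r : seq I) F :
  rep_pi (RSum [seq F i | i <- r]) = \sum_(i <- r) rep_pi (F i).
Proof.
elim: r => [|i r ih] /=; first by rewrite big_nil.
by rewrite big_cons rep_piD ih.
Qed.

Lemma rgen_bilinear : is_bilinear rgen.
Proof.
split=> [b k x y|x k b c]; rewrite -rep_piZ -rep_piD; apply/rep_piP.
  by apply: (rep_trans (rep_genDl _ _ _)); apply: rep_add;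
    [apply: rep_genZl | apply: rep_refl].
by apply: (rep_trans (rep_genDr _ _ _)); apply: rep_add;
  [apply: rep_genZr | apply: rep_refl].
Qed.

Lemma rgenMl x y b :
  rgen (x * y) b = \sum_(u <- terms (comul b)) rgen x u.1 * rgen y u.2.
Proof.
rewrite /rgen (proj2 (rep_piP _ _) (rep_genMl x y b)) rep_pi_sum.
by apply: eq_bigr => u _; rewrite rep_piM.
Qed.

Lemma rgen1l b : rgen 1 b = counit b *: 1.
Proof. by rewrite -rep_piZ; apply/rep_piP; apply: rep_gen1l. Qed.

Lemma rgenMr x b c :
  rgen x (b * c) = \sum_(u <- terms (comul x)) rgen u.1 b * rgen u.2 c.
Proof.
rewrite /rgen (proj2 (rep_piP _ _) (rep_genMr x b c)) rep_pi_sum.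
by apply: eq_bigr => u _; rewrite rep_piM.
Qed.

Lemma rgen1r x : rgen x 1 = counit x *: 1.
Proof. by rewrite -rep_piZ; apply/rep_piP; apply: rep_gen1r. Qed.

Lemma rgenC p q r s x b y c :
  homog p x -> homog q b -> homog r y -> homog s c ->
  rgen x b * rgen y c = ksign K ((p + q) * (r + s)) *: (rgen y c * rgen x b).
Proof.
move=> hx hb hy hc; rewrite -!rep_piM -rep_piZ.
by apply/rep_piP; apply: rep_genC.
Qed.

(* The grading with |x_b| = |x| + |b|. *)
Inductive rep_homog : int -> rep_alg -> Prop :=
| rep_homog_gen p q x b : homog p x -> homog q b -> rep_homog (p + q) (rgen x b)
| rep_homog0 p : rep_homog p 0
| rep_homog1 : rep_homog 0 1
| rep_homogP p k u v :
    rep_homog p u -> rep_homog p v -> rep_homog p (k *: u + v)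
| rep_homogM p q u v :
    rep_homog p u -> rep_homog q v -> rep_homog (p + q) (u * v).

Lemma rep_homogD p u v : rep_homog p u -> rep_homog p v -> rep_homog p (u + v).
Proof. by move=> hu hv; rewrite -[u]scale1r; apply: rep_homogP. Qed.

Lemma rep_homogZ p k u : rep_homog p u -> rep_homog p (k *: u).
Proof. by move=> hu; rewrite -[_ *: _]addr0; apply: rep_homogP (rep_homog0 _). Qed.

(* The homogeneous components of a term, listed with their degrees. *)
Fixpoint rep_dec (s : rterm) : seq (int * rep_alg) :=
  match s with
  | RGen x b => [seq (deg a + deg c, rgen (el a) (el c)) | a <- hdec x, c <- hdec b]
  | RZero => [::]
  | ROne => [:: (0, 1)]
  | RAdd s t => rep_dec s ++ rep_dec t
  | RScale k s => [seq (u.1, k *: u.2) | u <- rep_dec s]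
  | RMul s t => [seq (u.1 + v.1, u.2 * v.2) | u <- rep_dec s, v <- rep_dec t]
  end.

Definition dec_eq (l l' : seq (int * rep_alg)) : Prop :=
  forall F : int -> rep_alg -> rep_alg,
    (forall p, {morph F p : u v / u + v}) ->
    \sum_(u <- l) F u.1 u.2 = \sum_(u <- l') F u.1 u.2.

Lemma rgenDl b : {morph rgen^~ b : x y / x + y}.
Proof. by move=> x y; have [h _] := rgen_bilinear; have := h b 1 x y; rewrite !scale1r. Qed.

Lemma rgenDr x : {morph rgen x : b c / b + c}.
Proof. by move=> b c; have [_ h] := rgen_bilinear; have := h x 1 b c; rewrite !scale1r. Qed.

Lemma rgenZl k x b : rgen (k *: x) b = k *: rgen x b.
Proof. by rewrite -rep_piZ; apply/rep_piP/rep_genZl. Qed.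

Lemma rgenZr k x b : rgen x (k *: b) = k *: rgen x b.
Proof. by rewrite -rep_piZ; apply/rep_piP/rep_genZr. Qed.

Lemma rep_dec_sum (I : Type) (r : seq I) F (G : int * rep_alg -> rep_alg) :
  \sum_(u <- rep_dec (RSum [seq F i | i <- r])) G u =
  \sum_(i <- r) \sum_(u <- rep_dec (F i)) G u.
Proof.
elim: r => [|i r ih] /=; first by rewrite !big_nil.
by rewrite big_cat big_cons /= ih.
Qed.

Section DecRel.
Variable F : int -> rep_alg -> rep_alg.
Hypothesis FD : forall p, {morph F p : u v / u + v}.

Lemma rep_dec_genE x b : \sum_(u <- rep_dec (RGen x b)) F u.1 u.2 =
  \sum_(a <- hdec x) \sum_(c <- hdec b) F (deg a + deg c) (rgen (el a) (el c)).
Proof. by rewrite /= big_allpairs_dep. Qed.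

Lemma rep_dec_mulE s t : \sum_(u <- rep_dec (RMul s t)) F u.1 u.2 =
  \sum_(u <- rep_dec s) \sum_(v <- rep_dec t) F (u.1 + v.1) (u.2 * v.2).
Proof. by rewrite /= big_allpairs_dep. Qed.

Lemma rep_dec_scaleE k s : \sum_(u <- rep_dec (RScale k s)) F u.1 u.2 =
  \sum_(u <- rep_dec s) F u.1 (k *: u.2).
Proof. by rewrite /= big_map. Qed.

Lemma genDl_l b p : {morph (fun z =>
  \sum_(c <- hdec b) F (p + deg c) (rgen z (el c))) : x y / x + y}.
Proof.
by move=> x y; rewrite -big_split; apply: eq_bigr => c _; rewrite rgenDl FD.
Qed.

Lemma genD_r x p : {morph (fun c => F p (rgen x c)) : b c / b + c}.
Proof. by move=> b c; rewrite rgenDr FD. Qed.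

Lemma rep_dec_genMl x y b : \sum_(u <- rep_dec (RGen (x * y) b)) F u.1 u.2 =
  \sum_(u <- rep_dec (RSum [seq RMul (RGen x u.1) (RGen y u.2)
                            | u <- terms (comul b)])) F u.1 u.2.
Proof.
rewrite rep_dec_genE rep_dec_sum (hdecM _ _ (@genDl_l b)).
under [RHS]eq_bigr => w _ do rewrite rep_dec_mulE /= big_allpairs_dep.
rewrite [RHS]exchange_big; apply: eq_bigr => a _ /=.
under [RHS]eq_bigr => w _ do under eq_bigr => d _ do rewrite big_allpairs_dep.
under [RHS]eq_bigr => w _ do rewrite exchange_big.
rewrite [RHS]exchange_big; apply: eq_bigr => a' _ /=.
pose phi p (b1 b2 : B) :=
  F (deg a + deg a' + p) (rgen (el a) b1 * rgen (el a') b2).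
transitivity (\sum_(u <- terms (comul b)) \sum_(d <- hdec u.1)
    \sum_(e <- hdec u.2) phi (deg d + deg e) (el d) (el e)); last first.
  apply: eq_bigr => u _; apply: eq_bigr => d _; apply: eq_bigr => e _.
  by rewrite /phi addrACA.
rewrite (@comul_sum_hdec _ B _ phi).
- apply: eq_bigr => c _; rewrite rgenMl additive_sum //.
- by move=> p c u v; rewrite /phi rgenDr mulrDl FD.
- by move=> p c u v; rewrite /phi rgenDr mulrDr FD.
- by move=> p k u v; rewrite /phi !rgenZr -scalerAl -scalerAr.
Qed.

Lemma rep_dec_genMr x b c : \sum_(u <- rep_dec (RGen x (b * c))) F u.1 u.2 =
  \sum_(u <- rep_dec (RSum [seq RMul (RGen u.1 b) (RGen u.2 c)
                            | u <- terms (comul x)])) F u.1 u.2.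
Proof.
rewrite rep_dec_genE rep_dec_sum.
transitivity (\sum_(d <- hdec b) \sum_(e <- hdec c) \sum_(a <- hdec x)
    F (deg a + (deg d + deg e)) (rgen (el a) (el d * el e))).
  under eq_bigr => a _ do rewrite (@hdecM _ _ _
    (fun p z => F (deg a + p) (rgen (el a) z)) b c (fun p => @genD_r (el a) (deg a + p))).
  by rewrite exchange_big; apply: eq_bigr => d _; rewrite exchange_big.
under [RHS]eq_bigr => w _ do rewrite rep_dec_mulE /= big_allpairs_dep exchange_big.
rewrite [RHS]exchange_big; apply: eq_bigr => d _ /=.
under [RHS]eq_bigr => w _ do under eq_bigr => a _ do rewrite big_allpairs_dep exchange_big.
under [RHS]eq_bigr => w _ do rewrite exchange_big.
rewrite [RHS]exchange_big; apply: eq_bigr => e _ /=.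
pose phi p (x1 x2 : A) :=
  F (p + (deg d + deg e)) (rgen x1 (el d) * rgen x2 (el e)).
transitivity (\sum_(u <- terms (comul x)) \sum_(a <- hdec u.1)
    \sum_(a' <- hdec u.2) phi (deg a + deg a') (el a) (el a')); last first.
  apply: eq_bigr => u _; apply: eq_bigr => a _; apply: eq_bigr => a' _.
  by rewrite /phi addrACA.
rewrite (@comul_sum_hdec _ A _ phi).
- by apply: eq_bigr => a _; rewrite rgenMr additive_sum.
- by move=> p z u v; rewrite /phi rgenDl mulrDl FD.
- by move=> p z u v; rewrite /phi rgenDl mulrDr FD.
- by move=> p k u v; rewrite /phi !rgenZl -scalerAl -scalerAr.
Qed.

Lemma counit_hdec (C : gradedBialgType K) (b : C) :
  \sum_(c <- hdec b) F (deg c) (counit (el c) *: 1) = F 0 (counit b *: 1).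
Proof.
rewrite {2}(hdecE b) linear_sum scaler_suml (additive_sum _ _ (FD 0)).
apply: eq_bigr => c _ /=; have [c0|c0] := eqVneq (deg c) 0; first by rewrite c0.
by rewrite (counit_homog _ _ (elP c) c0) scale0r !additive0.
Qed.

Lemma rep_dec_gen p q x b : homog p x -> homog q b ->
  \sum_(u <- rep_dec (RGen x b)) F u.1 u.2 = F (p + q) (rgen x b).
Proof.
move=> hx hb; rewrite rep_dec_genE (hdec_homog (@genDl_l b) hx).
by rewrite (hdec_homog (fun r => @genD_r (x) (p + r)) hb).
Qed.
End DecRel.

Lemma rep_dec_rel s t : rep_rel s t -> dec_eq (rep_dec s) (rep_dec t).
Proof.
elim=> {s t}.
- by [].
- by move=> s t _ h F FD; rewrite h.
- by move=> s t u _ h1 _ h2 F FD; rewrite h1 // h2.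
- by move=> s s' t t' _ h1 _ h2 F FD; rewrite /= !big_cat /= h1 // h2.
- move=> k s s' _ h F FD; rewrite /= !big_map /=.
  by apply: (h (fun p u => F p (k *: u))) => p u v; rewrite scalerDr FD.
- move=> s s' t t' _ h1 _ h2 F FD; rewrite !rep_dec_mulE.
  rewrite (h1 (fun p w => \sum_(v <- rep_dec t) F (p + v.1) (w * v.2))); last first.
    by move=> p u v; rewrite -big_split; apply: eq_bigr => i _; rewrite mulrDl FD.
  apply: eq_bigr => u _; apply: (h2 (fun p w => F (u.1 + p) (u.2 * w))).
  by move=> p v w; rewrite mulrDr FD.
- by move=> s t u F FD; rewrite /= !big_cat /= addrA.
- by move=> s t F FD; rewrite /= !big_cat /= addrC.
- by [].
- move=> s F FD; rewrite /= big_cat big_map /= -big_split big1_seq ?big_nil //=.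
  by move=> u _; rewrite -FD scaleN1r addNr additive0.
- move=> k l s F FD; rewrite /= !big_map.
  by apply: eq_bigr => u _ /=; rewrite scalerA.
- by move=> s F FD; rewrite /= big_map; apply: eq_bigr => u _; rewrite scale1r.
- by move=> k s t F FD; rewrite /= map_cat.
- move=> k l s F FD; rewrite /= big_cat !big_map /= -big_split.
  by apply: eq_bigr => u _; rewrite /= scalerDl FD.
- move=> s t u F FD; rewrite !rep_dec_mulE big_allpairs_dep; apply: eq_bigr => i _.
  rewrite big_allpairs_dep; apply: eq_bigr => j _; apply: eq_bigr => l _.
  by rewrite addrA mulrA.
- move=> s F FD; rewrite rep_dec_mulE big_seq1.
  by apply: eq_bigr => u _; rewrite add0r mul1r.
- move=> s F FD; rewrite rep_dec_mulE.
  by apply: eq_bigr => u _; rewrite big_seq1 addr0 mulr1.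
- by move=> s t u F FD; rewrite rep_dec_mulE /= !big_cat !rep_dec_mulE.
- move=> s t u F FD; rewrite rep_dec_mulE [RHS]big_cat /= !rep_dec_mulE -big_split.
  by apply: eq_bigr => i _; rewrite /= big_cat.
- move=> k s t F FD; rewrite rep_dec_mulE /= !big_map big_allpairs_dep.
  by apply: eq_bigr => i _; apply: eq_bigr => j _; rewrite scalerAl.
- move=> k s t F FD; rewrite rep_dec_mulE /= !big_map big_allpairs_dep.
  apply: eq_bigr => i _; rewrite big_map; apply: eq_bigr => j _.
  by rewrite scalerAr.
- move=> x y b F FD; rewrite rep_dec_genE [RHS]big_cat /= !rep_dec_genE.
  exact: (hdecD (@genDl_l F FD b)).
- move=> k x b F FD; rewrite rep_dec_genE rep_dec_scaleE.
  rewrite (rep_dec_genE (fun p z => F p (k *: z))).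
  rewrite (hdecZ (@genDl_l F FD b)); apply: eq_bigr => a _.
  by apply: eq_bigr => c _; rewrite rgenZl.
- move=> x b c F FD; rewrite rep_dec_genE [RHS]big_cat /= !rep_dec_genE -big_split.
  apply: eq_bigr => a _.
  exact: (hdecD (fun p => @genD_r F FD (el a) (deg a + p))).
- move=> k x b F FD; rewrite rep_dec_genE rep_dec_scaleE.
  rewrite (rep_dec_genE (fun p z => F p (k *: z))); apply: eq_bigr => a _.
  rewrite (hdecZ (fun p => @genD_r F FD (el a) (deg a + p))).
  by apply: eq_bigr => c _; rewrite rgenZr.
- by move=> x y b F FD; apply: rep_dec_genMl.
- move=> b F FD; rewrite rep_dec_genE /= big_seq1.
  rewrite (hdec_homog (@genDl_l F FD b) (@homog1 _ A)) -counit_hdec //.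
  by apply: eq_bigr => c _; rewrite add0r rgen1l.
- by move=> x b c F FD; apply: rep_dec_genMr.
- move=> x F FD; rewrite rep_dec_genE /= big_seq1 -counit_hdec //.
  apply: eq_bigr => a _.
  rewrite (hdec_homog (fun p => @genD_r F FD (el a) (deg a + p)) (@homog1 _ B)).
  by rewrite addr0 rgen1r.
- move=> p q r s x b y c hx hb hy hc F FD.
  rewrite rep_dec_mulE rep_dec_scaleE.
  rewrite (rep_dec_gen (F := fun i z =>
     \sum_(v <- rep_dec (RGen y c)) F (i + v.1) (z * v.2)) _ hx hb); last first.
    by move=> i u v; rewrite -big_split; apply: eq_bigr => w _; rewrite mulrDl FD.
  rewrite (rep_dec_gen (F := fun i z => F (p + q + i) (rgen x b * z)) _ hy hc); last first.
    by move=> i u v; rewrite mulrDr FD.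
  pose k := ksign K ((p + q) * (r + s)).
  rewrite (rep_dec_mulE (fun i z => F i (k *: z))).
  rewrite (rep_dec_gen (F := fun i z =>
     \sum_(v <- rep_dec (RGen x b)) F (i + v.1) (k *: (z * v.2))) _ hy hc); last first.
    move=> i u v; rewrite -big_split; apply: eq_bigr => w _.
    by rewrite mulrDl scalerDr FD.
  rewrite (rep_dec_gen (F := fun i z => F (r + s + i) (k *: (rgen y c * z))) _ hx hb).
    by rewrite (rgenC hx hb hy hc) [r + s + _]addrC.
  by move=> i u v; rewrite mulrDr scalerDr FD.
Qed.

(* The component of degree p. *)
Definition rep_comp (p : int) (u : rep_alg) : rep_alg :=
  \sum_(v <- rep_dec (rep_repr u)) if v.1 == p then v.2 else 0.

Lemma rep_comp_morph (p q : int) : {morph (fun u : rep_alg =>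
  if q == p then u else 0) : u v / u + v}.
Proof. by move=> u v; case: eqP => //; rewrite addr0. Qed.

Lemma rep_compE p s :
  rep_comp p (rep_pi s) = \sum_(v <- rep_dec s) if v.1 == p then v.2 else 0.
Proof.
apply: (rep_dec_rel (rep_repr_rel s) (F := fun q u => if q == p then u else 0)).
exact: rep_comp_morph.
Qed.

Lemma rep_compD p : {morph rep_comp p : u v / u + v}.
Proof.
move=> u v; rewrite -(rep_reprK u) -(rep_reprK v) -rep_piD !rep_compE.
by rewrite /= big_cat.
Qed.

Lemma rep_dec_homog p u : rep_homog p u ->
  dec_eq (rep_dec (rep_repr u)) [:: (p, u)].
Proof.
elim=> {p u}.
- move=> p q x b hx hb F FD; rewrite (rep_dec_rel (rep_repr_rel _)) //.
  by rewrite big_seq1 (rep_dec_gen FD hx hb).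
- move=> p F FD; rewrite (rep_dec_rel (rep_repr_rel RZero)) //.
  by rewrite big_seq1 big_nil additive0.
- by move=> F FD; rewrite (rep_dec_rel (rep_repr_rel ROne)) // !big_seq1.
- move=> p k u v _ hu _ hv F FD.
  rewrite -{1}(rep_reprK u) -{1}(rep_reprK v) -rep_piZ -rep_piD.
  rewrite (rep_dec_rel (rep_repr_rel _)) //= big_cat big_map /= big_seq1 FD.
  rewrite (hu (fun q z => F q (k *: z))) ?hv ?big_seq1 // => q z z'.
  by rewrite scalerDr FD.
- move=> p q u v _ hu _ hv F FD.
  rewrite -{1}(rep_reprK u) -{1}(rep_reprK v) -rep_piM.
  rewrite (rep_dec_rel (rep_repr_rel _)) // rep_dec_mulE big_seq1.
  rewrite (hu (fun i z => \sum_(w <- rep_dec (rep_repr v)) F (i + w.1) (z * w.2))).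
    rewrite big_seq1 (hv (fun i z => F (p + i) (u * z))) ?big_seq1 // => i z z'.
    by rewrite mulrDr FD.
  move=> i z z'; rewrite -big_split; apply: eq_bigr => w _.
  by rewrite mulrDl FD.
Qed.

Lemma rep_comp_homog p q u : rep_homog p u ->
  rep_comp q u = if p == q then u else 0.
Proof.
move=> hu; rewrite /rep_comp.
rewrite (rep_dec_homog hu (F := fun i z => if i == q then z else 0)) ?big_seq1 //.
exact: rep_comp_morph.
Qed.

Lemma rep_homog_indep (r : seq int) (f : int -> rep_alg) : uniq r ->
  (forall p, rep_homog p (f p)) -> \sum_(p <- r) f p = 0 ->
  forall p, p \in r -> f p = 0.
Proof.
move=> ur hf f0 p pr; have := congr1 (rep_comp p) f0.
rewrite (additive_sum _ _ (rep_compD p)) (additive0 (rep_compD p)) => <-.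
rewrite (bigD1_seq p) //= (rep_comp_homog p (hf p)) eqxx big1 ?addr0 // => q qp.
by rewrite (rep_comp_homog p (hf q)) (negbTE qp).
Qed.

Lemma rep_dec_all s : rep_pi s = \sum_(u <- rep_dec s) u.2 /\
  (forall u, u \in rep_dec s -> rep_homog u.1 u.2).
Proof.
elim: s => [x b|||s [es hs] t [et ht]|k s [es hs]|s [es hs] t [et ht]].
- split; last first.
    suff /allP h : all (fun u => `[< rep_homog u.1 u.2 >]) (rep_dec (RGen x b)).
      by move=> u /h/asboolP.
    rewrite /=; elim: (hdec x) => //= a r ih; rewrite all_cat ih andbT all_map.
    rewrite (@eq_all _ _ predT) ?all_predT // => c /=.
    by apply/asboolP; apply: rep_homog_gen; apply: elP.
  rewrite /= big_allpairs_dep -/(rgen x b) {1}(hdecE x) {1}(hdecE b).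
  rewrite (additive_sum _ _ (rgenDl _)).
  by apply: eq_bigr => a _; rewrite (additive_sum _ _ (rgenDr _)).
- by split; rewrite ?big_nil.
- by split=> [|u]; rewrite ?big_seq1 // inE => /eqP->; apply: rep_homog1.
- split=> [|u]; first by rewrite rep_piD es et big_cat.
  by rewrite mem_cat => /orP[/hs|/ht].
- split=> [|u]; first by rewrite rep_piZ es /= big_map scaler_sumr.
  by case/mapP=> v /hs hv ->; apply: rep_homogZ.
- split; first by rewrite rep_piM es et /= big_allpairs_dep big_distrlr.
  by move=> u /allpairsP[[v w] /= [/hs hv /ht hw ->]]; apply: rep_homogM.
Qed.

Lemma rep_homog_span u : exists (r : seq int) (f : int -> rep_alg),
  (forall p, rep_homog p (f p)) /\ u = \sum_(p <- r) f p.
Proof.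
have [e h] := rep_dec_all (rep_repr u); set l := rep_dec _ in e h.
exists (undup [seq v.1 | v <- l]).
exists (fun p => \sum_(v <- l | v.1 == p) v.2); split=> [p|].
  rewrite big_seq_cond; elim/big_ind: _ => [||v /andP[/h hv /eqP <-]] //.
    exact: rep_homog0.
  exact: rep_homogD.
rewrite -[LHS]rep_reprK e (exchange_big_dep predT) //= big_seq [RHS]big_seq.
apply: eq_bigr => v vl; rewrite -big_filter (_ : filter _ _ = [:: v.1]) ?big_seq1 //.
rewrite (@eq_filter _ _ (pred1 v.1)); last by move=> p; rewrite /= eq_sym.
by rewrite filter_pred1_uniq ?undup_uniq // mem_undup map_f.
Qed.

HB.instance Definition _ := Lmodule_isGraded.Build K rep_alg
  rep_homog0 rep_homogP rep_homog_span rep_homog_indep.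
HB.instance Definition _ := isGradedAlgebra.Build K rep_alg rep_homog1 rep_homogM.
End RepresentationAlgebra.

Section Sweedler.
Variables (K : comNzRingType) (A : gradedBialgType K).

(* Sweedler's notation with homogeneous components: the entries of sw2 x are
   the terms of the comultiplication of x, those of sw3 x and sw4 x the terms of
   its iterated comultiplications. *)
Definition sw2 (x : A) : seq (helt A * helt A) := hterms (comul x).

Definition sw3 (x : A) : seq (helt A * helt A * helt A) :=
  [seq (u.1, v.1, v.2) | u <- sw2 x, v <- sw2 (el u.2)].

Definition sw4 (x : A) : seq (helt A * helt A * helt A * helt A) :=
  [seq (u.1.1, u.1.2, v.1, v.2) | u <- sw3 x, v <- sw2 (el u.2)].

Definition cocommutative : Prop := forall x : A,
  comul x = \sum_(u <- sw2 x)
    ksign K (deg u.1 * deg u.2) *: (el u.2 ⊗ el u.1).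
End Sweedler.

Arguments cocommutative {K} A.

Definition ungraded (K : comNzRingType) (V : gradedLmodType K) : Prop :=
  forall v : V, homog 0 v.

Definition graded_commutative (K : comNzRingType) (R : gradedAlgType K) : Prop :=
  forall p q (x y : R), homog p x -> homog q y ->
    x * y = ksign K (p * q) *: (y * x).

Section Brackets.
Variables (K : comNzRingType) (R : gradedAlgType K) (n : int).
Variable br : R -> R -> R.

Definition graded_bracket : Prop :=
  [/\ is_bilinear br,
      forall p q x y, homog p x -> homog q y -> homog (p + q + n) (br x y),
      forall p q r x y z, homog p x -> homog q y -> homog r z ->
        br x (y * z) = br x y * z + ksign K ((p + n) * q) *: (y * br x z)
    & forall p q r x y z, homog p x -> homog q y -> homog r z ->
        br (x * y) z = x * br y z + ksign K (q * (r + n)) *: (br x z * y)].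

Definition antisymmetric_bracket : Prop :=
  forall p q x y, homog p x -> homog q y ->
    br x y = - (ksign K ((p + n) * (q + n)) *: br y x).

Definition jacobi : Prop :=
  forall p q r u v w, homog p u -> homog q v -> homog r w ->
    ksign K ((p + n) * (r + n)) *: br u (br v w)
    + ksign K ((p + n) * (q + n)) *: br v (br w u)
    + ksign K ((q + n) * (r + n)) *: br w (br u v) = 0.

Definition gerstenhaber_bracket : Prop :=
  [/\ graded_bracket, antisymmetric_bracket & jacobi].
End Brackets.

Section FoxPairings.
Variables (K : comNzRingType) (A : gradedHopfType K) (n : int).
Variable rho : A -> A -> A.

Definition fox_pairing : Prop :=
  [/\ is_bilinear rho,
      forall p q x y, homog p x -> homog q y -> homog (p + q + n) (rho x y),
      forall x y z, rho x (y * z) = rho x y * z + counit y *: rho x z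
    & forall x y z, rho (x * y) z = counit y *: rho x z + x * rho y z].

Definition antisymmetric_fox : Prop :=
  forall p q x y, homog p x -> homog q y ->
    ksign K ((p + n) * (q + n)) *:
      finv 0 (@antipode K A) (rho (antipode y) (antipode x)) = - rho x y.

Definition tensor3 := tensor A (tensor A A).

Definition hterms3 (T : tensor3) : seq (helt A * helt A * helt A) :=
  flatten [seq [seq (a, v.1, v.2) | a <- hdec u.1, v <- hterms u.2] | u <- terms T].

(* P_{312,m}; the two inversions of 312 are (3, 1) and (3, 2). *)
Definition P312 (m : int) (T : tensor3) : tensor3 :=
  \sum_(x <- hterms3 T)
    let: (x1, x2, x3) := x in
    ksign K ((deg x3 + m) * (deg x1 + m) + (deg x3 + m) * (deg x2 + m)) *:
      (el x3 ⊗ el x1 ⊗ el x2).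

Definition digamma_homog (x y z : helt A) : tensor3 :=
  \sum_(u <- sw2 (el x)) \sum_(v <- sw2 (el y)) \sum_(w <- sw2 (el z))
  let: (x1, x2) := u in let: (y1, y2) := v in let: (z1, z2) := w in
  \sum_(r <- sw3 (rho (el x2) (el y2)))
  let: (r1, r2, r3) := r in
  \sum_(q <- sw2 (rho (el r3) (el z2)))
  let: (q1, q2) := q in
  let e := deg y1 * (deg x + n) + deg z1 * (deg x2 + deg y2)
           + (deg x1 + deg z1) * deg r1 + deg r2 * deg q1 in
  ksign K e *:
    ((el y1 * antipode (el r1) * el x1)
     ⊗ (el z1 * antipode (el q1) * el r2)
     ⊗ el q2).

Definition digamma (T : tensor3) : tensor3 :=
  \sum_(x <- hterms3 T) let: (x1, x2, x3) := x in digamma_homog x1 x2 x3.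

Definition tritensor (T : tensor3) : tensor3 :=
  \sum_(i < 3) iter i (P312 0) (digamma (iter i (finv 0 (P312 n)) T)).

Definition gerstenhaber_fox : Prop := forall T : tensor3, tritensor T = 0.
End FoxPairings.

Section TraceLike.
Variables (K : comNzRingType) (B : gradedHopfType K).

Definition aug_pred : pred B := fun b => counit b == 0.

(* I = Ker counit *)
Record aug : Type := Aug { aug_val : B; aug_valP : aug_pred aug_val }.
HB.instance Definition _ := [isSub for aug_val].
HB.instance Definition _ := [Choice of aug by <:].

Lemma aug_closed : subsemimod_closed aug_pred.
Proof.
have aE b : (b \in aug_pred) = (counit b == 0) by [].
split; first split.
- by rewrite aE linear0.
- by move=> b c; rewrite !aE => /eqP hb /eqP hc; rewrite linearD /= hb hc addr0.
- by move=> k b; rewrite !aE => /eqP hb; rewrite linearZ /= hb mulr0.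
Qed.
HB.instance Definition _ := GRing.SubChoice_isSubLmodule.Build K B aug_pred aug aug_closed.

(* I^2 as a submodule of I *)
Definition aug_sq (v : aug) : Prop :=
  exists s : seq (aug * aug), val v = \sum_(u <- s) val u.1 * val u.2.

Lemma aug_sqP : aug_sq 0 /\ forall a u v, aug_sq u -> aug_sq v -> aug_sq (a *: u + v).
Proof.
have valZ k (v : aug) : val (k *: v) = k *: val v by rewrite linearZ.
have valZD k (u v : aug) : val (k *: u + v) = k *: val u + val v by rewrite linearP.
split=> [|a u v [s hs] [t ht]]; first by exists [::]; rewrite big_nil linear0.
exists ([seq (a *: w.1, w.2) | w <- s] ++ t); rewrite big_cat big_map valZD.
rewrite hs ht scaler_sumr; congr (_ + _).
by apply: eq_bigr => w _; rewrite scalerAl -valZ.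
Qed.

Definition cotangent : Type := lquot aug_sqP.
HB.instance Definition _ := GRing.Lmodule.on cotangent.

Lemma sub_counitP (b : B) : aug_pred (b - counit b *: 1).
Proof. by rewrite /aug_pred linearB linearZ /= counit1 mulr1 subrr. Qed.

Definition cot_proj (b : B) : cotangent := lquot_pi aug_sqP (Aug (sub_counitP b)).

Definition point_derivation (mu : B -> K) : Prop :=
  scalar mu /\ forall b c, mu (b * c) = counit b * mu c + counit c * mu b.

Definition liealg : Type := {mu : B -> K | point_derivation mu}.

Lemma point_derivation0 : point_derivation (fun _ => 0).
Proof. by split=> [a b c|b c]; rewrite !mulr0 addr0. Qed.

Definition liealg0 : liealg := exist _ _ point_derivation0.

Definition cot_map (t : B) (mu : liealg) : cotangent :=
  \sum_(u <- terms (comul t)) sval mu u.1 *: cot_proj u.2.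

Definition cosymmetric (t : B) : Prop :=
  comul t = \sum_(u <- terms (comul t)) u.2 ⊗ u.1.

(* cot_map t is linear in mu: it is an isomorphism if and only if it is
   bijective. *)
Definition infinitesimally_nonsingular (t : B) : Prop := bijective (cot_map t).

Definition trace_like (t : B) : Prop :=
  cosymmetric t /\ infinitesimally_nonsingular t.

(* Meaningful when t is trace-like: cot_map t is then invertible. *)
Definition trace_pairing (t b c : B) : K :=
  sval (finv liealg0 (cot_map t) (cot_proj b)) c.
End TraceLike.

(* x', x'' are the components of u, y', y'' those of v, b^(1), ..., b^(4) those
   of d and c', c'' those of e. *)
Definition rep_bracket_formula (K : comNzRingType) (A B : gradedHopfType K)
    (n : int) (rho : A -> A -> A) (bullet : B -> B -> K)
    (br : rep_alg A B -> rep_alg A B -> rep_alg A B) : Prop :=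
  forall (x y : A) (b c : B),
  br (rgen x b) (rgen y c) =
  \sum_(u <- sw2 x) \sum_(v <- sw2 y) \sum_(d <- sw4 b) \sum_(e <- sw2 c)
  let: (x1, x2) := u in let: (y1, y2) := v in
  let: (b1, b2, b3, b4) := d in let: (c1, c2) := e in
  (ksign K (deg x2 * (deg y1 + n)) * bullet (el c2) (el b2)) *:
    (rgen (rho (el x1) (el y1)) (antipode (el b3) * el b1)
     * rgen (el x2) (el b4) * rgen (el y2) (el c1)).

(* Main.v *)
Require Import Defs.
From HB Require Import structures.
From mathcomp Require Import all_boot all_order all_algebra ssrAC.
From mathcomp Require Import boolp zify.
From Stdlib Require Import Btauto.

Set Implicit Arguments.
Unset Strict Implicit.
Unset Printing Implicit Defensive.

Import GRing.Theory.
Local Open Scope ring_scope.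

(** Why the theorem is true.

    The adjoint coaction b |-> b'' ⊗ b' s(b''') makes of B a comodule over
    itself.  The pairing defined by a trace-like element t is a symmetric
    biderivation, and it is invariant under this coaction: this is the balance
    identity (beta_balanced, beta_inv).  From it arises one more invariant form,
    the pairing of a commutator of point derivations with a third one; it is
    invariant under cyclic permutations (cubic, cubic_cycle, cubic_inv).

    Contracting an invariant form of k arguments with k elements a_i of A, each
    evaluated at the coefficient of the coaction on the i-th argument, gives an
    element of A_B: uno, duo and tri below.  By invariance a common factor v,
    distributed over all the slots by the comultiplication, comes out as the
    counit of v (duo_inv, tri_inv).  Hence a factor may be moved from one slot to
    the others at the cost of an antipode.

    The bracket of two generators is the sum of the terms
    duocore(x', y') x''_b'' y''_c'', where duocore(x, y) is the contraction of the
    pairing with ρ(x, y') and y'' (br_rgen_core).  The antisymmetry of ρ makes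
    duocore antisymmetric (duocore_anti), and with it the bracket on generators.

    By the Leibniz rule the double bracket of x_b, y_c and z_d is a sum of three
    parts.  Two of them are products of two factors duocore, and they cancel
    within the cyclic sum (part2E, part3E).  In the other one z_d meets a
    contraction of the pairing; since the pairing is a derivation in each
    argument, the adjoint coaction acts there as a commutator, and the cubic form
    appears: this part is the sum of the terms
    tricore(x', y', z') x''_b'' y''_c'' z''_d'' (part1E).

    It remains to see that the cyclic sum of tricore is zero (tricore_cycle).
    Split X off x and Z off z, and apply to the digamma map of the remaining
    components the functional a1 ⊗ a2 ⊗ a3 |-> ε(a2) tri(1, a1 s(X), Z s(a3)).
    Since A is cocommutative, the antipodes cancel the superfluous components, and
    the three summands of the tritensor map become, by moving factors from slot
    to slot, the three cyclic rotations of tricore (dig_core1, dig_core2,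
    dig_core3).  Their sum is the value of a functional on the tritensor map,
    which vanishes (core_cyclic).

    The Leibniz rule carries antisymmetry and the Jacobi identity over from the
    generators to A_B (anti_atM, jac_atM).

    Signs follow the Koszul rule, with a symbol of degree n standing between the
    two arguments of the bracket and of ρ.  A sign is ksign of a polynomial in the
    degrees, and an equality of signs is a propositional tautology in the
    parities of the degrees.  *)

(** * Signs *)

(** The value is a Boolean, and the lemmas below are phrased with xorb and andb, so
    that equalities of signs are decided by btauto. *)
Definition parity (k : int) : bool := odd `|k|%N.

Lemma parityN k : parity (- k) = parity k.
Proof. by rewrite /parity abszN. Qed.

Lemma parityM k l : parity (k * l) = andb (parity k) (parity l).
Proof. by rewrite /parity abszM oddM. Qed.

Lemma parityD k l : parity (k + l) = xorb (parity k) (parity l).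
Proof.
have aux (m p : nat) : parity (m%:Z - p%:Z) = xorb (odd m) (odd p).
  rewrite /parity; case: (leqP p m) => h.
    by rewrite subzn // oddB //; case: (odd m); case: (odd p).
  by rewrite distnC subzn 1?ltnW // oddB 1?ltnW //; case: (odd m); case: (odd p).
have posE (m : nat) : parity m = odd m by [].
case: (intP k) => [|m|m]; case: (intP l) => [|p|p];
  rewrite ?addr0 ?add0r ?oppr0 // -?opprD ?parityN ?posE -?PoszD ?posE ?oddD /=;
  rewrite ?aux //=; rewrite ?[- _ + _]addrC ?aux /=.
all: by case: (odd _); rewrite ?xorb_false_r //; case: (odd _).
Qed.

Lemma parityn (m : nat) : parity m%:Z = odd m. Proof. by []. Qed.

Section KSign.
Variable K : comNzRingType.

Lemma ksignE k : ksign K k = (-1) ^+ parity k.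
Proof. by rewrite /ksign -signr_odd. Qed.

Lemma ksign_parity k l : parity k = parity l -> ksign K k = ksign K l.
Proof. by rewrite !ksignE => ->. Qed.

Lemma ksignD k l : ksign K k * ksign K l = ksign K (k + l).
Proof. by rewrite !ksignE parityD; case: (parity k); case: (parity l);
  rewrite /= ?(expr0, expr1, mulr1, mul1r, mulN1r, opprK). Qed.

Lemma ksign0 : ksign K 0 = 1.
Proof. by []. Qed.

Lemma ksignZ (W : lmodType K) k l (w : W) :
  ksign K k *: (ksign K l *: w) = ksign K (k + l) *: w.
Proof. by rewrite scalerA ksignD. Qed.

Lemma ksignK (W : lmodType K) k (w : W) : ksign K k *: (ksign K k *: w) = w.
Proof.
by rewrite ksignZ (@ksign_parity _ 0) ?scale1r // parityD; case: (parity k).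
Qed.

End KSign.

Lemma xorb_move a b c : xorb a b = c -> a = xorb c b.
Proof. by case: a; case: b; case: c. Qed.

Ltac parity_norm := rewrite /= ?(parityD, parityM, parityN) ?parityn /=.

(* The degrees of one element may occur with several convertible inferences of
   the grading: they are made identical before being abstracted. *)
Ltac deg_norm :=
  repeat match goal with
  | |- context [@deg ?k1 ?v1 ?x] =>
      match goal with |- context [@deg ?k2 ?v2 x] =>
        tryif constr_eq v1 v2 then fail
        else change (@deg k2 v2 x) with (@deg k1 v1 x)
      end
  end.

(* The equations between degrees in the context, read as equations between
   parities, eliminate parities one after the other; what remains is a Boolean
   tautology. *)
Ltac parity_tauto :=
  repeat match goal with H : @deg _ _ _ = _ |- _ =>
    apply (congr1 parity) in H; move: H; parity_norm end;
  repeat match goal with H : parity _ = _ |- _ => move: H; parity_norm end;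
  parity_norm; deg_norm;
  repeat match goal with |- context [parity ?k] => generalize (parity k); intro end;
  intros; subst;
  repeat match goal with H : xorb _ _ = _ |- _ => apply xorb_move in H; subst end;
  btauto.

Ltac sgn := apply: ksign_parity; parity_tauto.

Lemma scaleC (K : comNzRingType) (W : lmodType K) (k l : K) (w : W) :
  k *: (l *: w) = l *: (k *: w).
Proof. by rewrite !scalerA mulrC. Qed.

(** * Linearity *)

(** E k x y z is to be read as z = k x + y.  Keeping this relation abstract gives
    one notion for maps defined on a module, on its homogeneous elements, or on
    any type of parameters on which other maps depend linearly. *)
Definition lin (K : comNzRingType) (D : Type) (E : K -> D -> D -> D -> Prop)
    (W : lmodType K) (F : D -> W) : Prop :=
  forall k x y z, E k x y z -> F z = k *: F x + F y.

Definition elin (K : comNzRingType) (V : lmodType K) (k : K) (x y z : V) : Prop :=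
  z = k *: x + y.

Definition helin (K : comNzRingType) (V : gradedLmodType K) (k : K)
    (x y z : helt V) : Prop :=
  [/\ deg x = deg z, deg y = deg z & el z = k *: el x + el y].

(** The substitutions of homogeneous elements that preserve linearity. *)
Definition hmorph (K : comNzRingType) (V : gradedLmodType K) (D : Type)
    (E : K -> D -> D -> D -> Prop) (g : D -> helt V) : Prop :=
  forall k x y z, E k x y z -> helin k (g x) (g y) (g z).

Definition lin2 (K : comNzRingType) (D D' : Type) E E' (W : lmodType K)
    (F : D -> D' -> W) : Prop :=
  (forall y, lin E (F^~ y)) /\ (forall x, lin E' (F x)).

Section LinRules.
Variables (K : comNzRingType) (D : Type) (E : K -> D -> D -> D -> Prop).

Lemma lin_add (W : lmodType K) (F G : D -> W) :
  lin E F -> lin E G -> lin E (fun x => F x + G x).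
Proof.
move=> hF hG k x y z e; rewrite (hF _ _ _ _ e) (hG _ _ _ _ e) scalerDr.
by rewrite addrACA.
Qed.

Lemma lin_opp (W : lmodType K) (F : D -> W) : lin E F -> lin E (fun x => - F x).
Proof. by move=> hF k x y z e; rewrite (hF _ _ _ _ e) opprD scalerN. Qed.

Lemma lin_sum (W : lmodType K) (I : Type) (r : seq I) (P : pred I) (F : D -> I -> W) :
  (forall i, lin E (F^~ i)) -> lin E (fun x => \sum_(i <- r | P i) F x i).
Proof.
move=> hF k x y z e; rewrite scaler_sumr -big_split; apply: eq_bigr => i _.
exact: hF.
Qed.

Lemma lin_scale (W : lmodType K) (c : D -> K) (F : D -> W) :
  (forall k x y z, E k x y z -> c x = c z /\ c y = c z) ->
  lin E F -> lin E (fun x => c x *: F x).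
Proof.
move=> hc hF k x y z e; have [-> ->] := hc _ _ _ _ e.
by rewrite (hF _ _ _ _ e) scalerDr !scalerA mulrC.
Qed.

Lemma lin_scalec (W : lmodType K) (c : K) (F : D -> W) :
  lin E F -> lin E (fun x => c *: F x).
Proof. by move=> hF; apply: lin_scale. Qed.

Lemma lin_scalel (W : lmodType K) (c : D -> K) (w : W) :
  lin E (c : D -> K^o) -> lin E (fun x => c x *: w).
Proof. by move=> hc k x y z e; rewrite (hc _ _ _ _ e) scalerDl -scalerA. Qed.

Lemma lin_mull (A : algType K) (F : D -> A) (c : A) :
  lin E F -> lin E (fun x => F x * c).
Proof. by move=> hF k x y z e; rewrite (hF _ _ _ _ e) mulrDl scalerAl. Qed.

Lemma lin_mulr (A : algType K) (F : D -> A) (c : A) :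
  lin E F -> lin E (fun x => c * F x).
Proof. by move=> hF k x y z e; rewrite (hF _ _ _ _ e) mulrDr scalerAr. Qed.

Lemma linK_mull (F : D -> K) (c : K) :
  lin E (F : D -> K^o) -> lin E ((fun x => F x * c) : D -> K^o).
Proof.
by move=> hF k x y z e; rewrite (hF _ _ _ _ e) mulrDl /GRing.scale /= mulrA.
Qed.

Lemma linK_mulr (F : D -> K) (c : K) :
  lin E (F : D -> K^o) -> lin E ((fun x => c * F x) : D -> K^o).
Proof.
by move=> hF k x y z e; rewrite (hF _ _ _ _ e) mulrDr /GRing.scale /= mulrCA.
Qed.

Lemma linK_add (F G : D -> K) : lin E (F : D -> K^o) -> lin E (G : D -> K^o) ->
  lin E ((fun x => F x + G x) : D -> K^o).
Proof. exact: lin_add. Qed.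

Lemma linK_opp (F : D -> K) : lin E (F : D -> K^o) ->
  lin E ((fun x => - F x) : D -> K^o).
Proof. exact: lin_opp. Qed.

Lemma linK_counit (A : gradedBialgType K) (F : D -> A) :
  lin E F -> lin E ((fun x => counit (F x)) : D -> K^o).
Proof. by move=> hF k x y z e; rewrite (hF _ _ _ _ e) linearP. Qed.

Lemma lin_app (V W : lmodType K) (g : V -> W) (F : D -> V) :
  linear g -> lin E F -> lin E (fun x => g (F x)).
Proof. by move=> hg hF k x y z e; rewrite (hF _ _ _ _ e) hg. Qed.

Lemma lin_appe (V W : lmodType K) (g : V -> W) (F : D -> V) :
  lin (@elin K V) g -> lin E F -> lin E (fun x => g (F x)).
Proof. by move=> hg hF k x y z e; apply: hg; apply: hF. Qed.

Lemma lin_apph (V : gradedLmodType K) (W : lmodType K) (g : helt V -> W) (F : D -> helt V) :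
  lin (@helin K V) g -> hmorph E F -> lin E (fun x => g (F x)).
Proof. by move=> hg hF k x y z e; apply: hg; apply: hF. Qed.

Lemma lin_appl (U V W : lmodType K) (g : U -> V -> W) (F : D -> U) v :
  is_bilinear g -> lin E F -> lin E (fun x => g (F x) v).
Proof. by move=> [hg _]; apply: (@lin_app _ _ (g^~ v)). Qed.

Lemma lin_appr (U V W : lmodType K) (g : U -> V -> W) (F : D -> V) u :
  is_bilinear g -> lin E F -> lin E (fun x => g u (F x)).
Proof. by move=> [_ hg]; apply: lin_app. Qed.

Lemma lin_antipode (A : gradedHopfType K) (F : D -> A) :
  lin E F -> lin E (fun x => antipode (F x)).
Proof. exact/lin_app/antipode_linear. Qed.

Lemma lin_rgenl (A B : gradedBialgType K) (F : D -> A) (b : B) :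
  lin E F -> lin E (fun x => rgen (F x) b).
Proof. exact/lin_appl/rgen_bilinear. Qed.

Lemma lin_rgenr (A B : gradedBialgType K) (F : D -> B) (a : A) :
  lin E F -> lin E (fun x => rgen a (F x)).
Proof. exact/lin_appr/rgen_bilinear. Qed.

Lemma hmorph_lin (V : gradedLmodType K) (g : D -> helt V) :
  hmorph E g -> lin E (fun x => el (g x)).
Proof. by move=> hg k x y z /hg[]. Qed.
End LinRules.

Lemma lin_id (K : comNzRingType) (V : lmodType K) : lin (@elin K V) (fun x => x).
Proof. by []. Qed.

Lemma lin_el (K : comNzRingType) (V : gradedLmodType K) :
  lin (@helin K V) (fun x => el x).
Proof. by move=> k x y z []. Qed.

Lemma hmorph_id (K : comNzRingType) (V : gradedLmodType K) :
  hmorph (@helin K V) (fun x => x).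
Proof. by []. Qed.

(** * Sums over comultiplications *)
Lemma linD (K : comNzRingType) (V W : lmodType K) (g : V -> W) :
  lin (@elin K V) g -> {morph g : x y / x + y}.
Proof. by move=> h x y; rewrite (h 1 x y) ?scale1r //= /elin scale1r. Qed.

Lemma lin0 (K : comNzRingType) (V W : lmodType K) (g : V -> W) :
  lin (@elin K V) g -> g 0 = 0.
Proof. by move=> /linD/additive0. Qed.

Lemma linZ (K : comNzRingType) (V W : lmodType K) (g : V -> W) k x :
  lin (@elin K V) g -> g (k *: x) = k *: g x.
Proof. by move=> h; rewrite (h k x 0) /elin ?addr0 // (lin0 h) addr0. Qed.

Lemma linsum (K : comNzRingType) (V W : lmodType K) (g : V -> W) (I : Type)
  (r : seq I) (P : pred I) F :
  lin (@elin K V) g -> g (\sum_(i <- r | P i) F i) = \sum_(i <- r | P i) g (F i).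
Proof. by move=> /linD/additive_sum_cond->. Qed.

Section TermSums.
Variables (K : comNzRingType) (U V W : lmodType K) (f : U -> V -> W).
Hypothesis f2 : lin2 (@elin K U) (@elin K V) f.

Let fDl v : {morph f^~ v : x y / x + y}. Proof. by apply/linD/f2.1. Qed.
Let fDr u : {morph f u : x y / x + y}. Proof. by apply/linD/f2.2. Qed.
Let fZ k u v : f (k *: u) v = f u (k *: v).
Proof. by rewrite (linZ k u (f2.1 v)) (linZ k v (f2.2 u)). Qed.

Lemma terms_pure u v : \sum_(t <- terms (u ⊗ v)) f t.1 t.2 = f u v.
Proof. by rewrite (sum_terms_tsum fDl fDr fZ) big_seq1. Qed.

(** The terms of a tensor are a choice of representatives; sums of a bilinear
    function over them do not depend on it. *)
Lemma terms_lin :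
  lin (@elin K (tensor U V)) (fun T => \sum_(t <- terms T) f t.1 t.2).
Proof.
move=> k S T _ ->; rewrite (sum_termsD fDl fDr fZ); congr (_ + _).
rewrite (_ : k *: S = tsum [seq (k *: u.1, u.2) | u <- terms S]); last first.
  by rewrite -[LHS]/(tscale _ _) -{1}(termsK S) tsum_scale.
rewrite (sum_terms_tsum fDl fDr fZ) big_map scaler_sumr.
by apply: eq_bigr => t _ /=; rewrite (linZ k t.1 (f2.1 t.2)).
Qed.
End TermSums.

(** The sum of f(b', b'') in Sweedler's notation. *)
Definition csum (K : comNzRingType) (C : gradedBialgType K) (W : lmodType K)
    (b : C) (f : C -> C -> W) : W :=
  \sum_(u <- terms (comul b)) f u.1 u.2.

Section Csum.
Variables (K : comNzRingType) (C : gradedBialgType K) (W : lmodType K).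
Notation e := (@elin K C).

Lemma csum_ext (b : C) (f g : C -> C -> W) : (forall u v, f u v = g u v) -> csum b f = csum b g.
Proof. by move=> h; apply: eq_bigr => u _; apply: h. Qed.

Lemma csum_lin (f : C -> C -> W) : lin2 e e f -> lin e (fun b => csum b f).
Proof.
move=> h; apply: (lin_appe (terms_lin h)).
exact: (lin_app (@comul_linear _ C) (@lin_id _ _)).
Qed.

Lemma csum_exch (C' : gradedBialgType K) b (c : C') (f : C -> C -> C' -> C' -> W) :
  csum b (fun b1 b2 => csum c (f b1 b2)) =
    csum c (fun c1 c2 => csum b (fun b1 b2 => f b1 b2 c1 c2)).
Proof. exact: exchange_big. Qed.

Lemma lin_csum_body (E : Type) (D : K -> E -> E -> E -> Prop) (b : C) (f : E -> C -> C -> W) :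
  (forall u v, lin D (fun x => f x u v)) -> lin D (fun x => csum b (f x)).
Proof. by move=> h; apply: lin_sum => i; apply: h. Qed.

Lemma csum_counitl (b : C) (f : C -> W) : lin e f ->
  csum b (fun b1 b2 => counit b1 *: f b2) = f b.
Proof.
move=> h; rewrite -[in RHS](counitl b) linsum //.
by apply: eq_bigr => u _; rewrite (linZ _ _ h).
Qed.

Lemma csum_counitr (b : C) (f : C -> W) : lin e f ->
  csum b (fun b1 b2 => counit b2 *: f b1) = f b.
Proof.
move=> h; rewrite -[in RHS](counitr b) linsum //.
by apply: eq_bigr => u _; rewrite (linZ _ _ h).
Qed.

Lemma csum_coassoc (b : C) (f : C -> C -> C -> W) :
  (forall v w, lin e (fun u => f u v w)) -> (forall u w, lin e (fun v => f u v w)) ->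
  (forall u v, lin e (f u v)) ->
  csum b (fun b1 b2 => csum b1 (fun c1 c2 => f c1 c2 b2)) =
  csum b (fun b1 b2 => csum b2 (fun c1 c2 => f b1 c1 c2)).
Proof.
move=> h1 h2 h3.
pose g (x : C) (T : tensor C C) : W := \sum_(v <- terms T) f x v.1 v.2.
have fx x : lin2 e e (f x) by split=> y; [apply: h2 | apply: h3].
have g2 : lin2 e (@elin K (tensor C C)) g.
  split=> [T|x]; last exact: terms_lin.
  by apply: lin_sum => v; apply: h1.
pose L (T : tensor C (tensor C C)) : W := \sum_(u <- terms T) g u.1 u.2.
have Ll : lin (@elin K _) L := terms_lin g2.
have := congr1 L (coassoc b); rewrite !(linsum _ _ _ Ll).
under eq_bigr => u _ do rewrite (linsum _ _ _ Ll).
under [X in _ = X]eq_bigr => u _ do rewrite (linsum _ _ _ Ll).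
rewrite /L => LE; rewrite /csum; transitivity (\sum_(u <- terms (comul b))
   \sum_(v <- terms (comul u.1)) \sum_(t <- terms (v.1 ⊗ v.2 ⊗ u.2)) g t.1 t.2).
  apply: eq_bigr => u _; apply: eq_bigr => v _.
  by rewrite (terms_pure g2) /g terms_pure.
rewrite LE; apply: eq_bigr => u _; apply: eq_bigr => v _.
by rewrite (terms_pure g2) /g terms_pure.
Qed.
End Csum.

Section CsumHopf.
Variables (K : comNzRingType) (C : gradedHopfType K) (W : lmodType K).
Notation e := (@elin K C).

Lemma csum_antipodel (b : C) (f : C -> W) : lin e f ->
  csum b (fun b1 b2 => f (antipode b1 * b2)) = counit b *: f 1.
Proof. by move=> h; rewrite -(linZ _ _ h) -antipodel linsum. Qed.

Lemma csum_antipoder (b : C) (f : C -> W) : lin e f ->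
  csum b (fun b1 b2 => f (b1 * antipode b2)) = counit b *: f 1.
Proof. by move=> h; rewrite -(linZ _ _ h) -antipoder linsum. Qed.
End CsumHopf.

(** * Homogeneous components *)
Section Components.
Variables (K : comNzRingType) (V : gradedLmodType K).

Definition hcomp (p : int) (x : V) : V := \sum_(a <- hdec x | deg a == p) el a.

Lemma hcomp_homog p x : homog p (hcomp p x).
Proof. by apply: homog_sum => a /eqP <-; apply: elP. Qed.

Let pick (p q : int) (z : V) : V := if q == p then z else 0.

Let pickD p q : {morph pick p q : x y / x + y}.
Proof. by move=> x y; rewrite /pick; case: eqP; rewrite ?addr0. Qed.

Let hcompE p x : hcomp p x = \sum_(a <- hdec x) pick p (deg a) (el a).
Proof. by rewrite /hcomp big_mkcond. Qed.

Lemma hcomp_lin p : lin (@elin K V) (hcomp p).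
Proof.
move=> k x y _ ->; rewrite !hcompE (hdecD (pickD p)) (hdecZ (pickD p)).
congr (_ + _); rewrite scaler_sumr; apply: eq_bigr => a _.
by rewrite /pick; case: eqP; rewrite ?scaler0.
Qed.

Lemma hcomp_el (a : helt V) : hcomp (deg a) (el a) = el a.
Proof.
by rewrite hcompE (hdec_homog (pickD (deg a)) (elP a)) /pick eqxx.
Qed.

(** A map that is linear on homogeneous elements is a family of linear maps indexed
    by the degrees: the projections to the components extend it to all elements. *)
Lemma lin_hdecE (W : lmodType K) (F : helt V -> W) : lin (@helin K V) F ->
  exists2 G : int -> V -> W,
    forall p, lin (@elin K V) (G p) & forall a, F a = G (deg a) (el a).
Proof.
move=> hF; exists (fun p x => F (HElt (hcomp_homog p x))) => [p k x y z exyz|a].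
  by apply: hF; split=> //=; apply: hcomp_lin.
rewrite -[LHS]scale1r -[LHS]addr0.
have h0 : F (HElt (homog0 (deg a))) = 0.
  have := hF (-1) (HElt (homog0 (deg a))) (HElt (homog0 (deg a))) (HElt (homog0 (deg a))).
  rewrite scaleN1r addNr; apply; split=> //=; by rewrite scaler0 addr0.
rewrite -h0; apply/esym/hF; split=> //=.
by rewrite hcomp_el scale1r addr0.
Qed.

Lemma hdec_lin (W : lmodType K) (F : helt V -> W) : lin (@helin K V) F ->
  lin (@elin K V) (fun x => \sum_(a <- hdec x) F a).
Proof.
case/lin_hdecE=> G hG FG k x y _ ->.
have GD p : {morph G p : u v / u + v} by apply/linD/hG.
under eq_bigr => a _ do rewrite FG.
rewrite (hdecD GD) (hdecZ GD) scaler_sumr; congr (_ + _); apply: eq_bigr => a _;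
 by rewrite FG // (linZ _ _ (hG _)).
Qed.

Lemma hdec_el (W : lmodType K) (F : helt V -> W) a : lin (@helin K V) F ->
  \sum_(c <- hdec (el a)) F c = F a.
Proof.
case/lin_hdecE=> G hG FG.
have GD p : {morph G p : u v / u + v} by apply/linD/hG.
under eq_bigr => c _ do rewrite FG.
by rewrite (hdec_homog GD (elP a)) FG.
Qed.

Lemma hdec_lin_el (W : lmodType K) (f : V -> W) x : lin (@elin K V) f ->
  \sum_(a <- hdec x) f (el a) = f x.
Proof. by move=> hf; rewrite {2}(hdecE x) linsum. Qed.

Lemma lin_eq (W : lmodType K) (F : helt V -> W) a b : lin (@helin K V) F ->
  deg a = deg b -> el a = el b -> F a = F b.
Proof. by case/lin_hdecE=> G _ FG da ea; rewrite !FG da ea. Qed.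

End Components.

(** * Sums over homogeneous components of a comultiplication *)

Section HTerms.
Variables (K : comNzRingType) (U V : gradedLmodType K) (W : lmodType K).
Variable F : helt U -> helt V -> W.
Hypothesis F2 : lin2 (@helin K U) (@helin K V) F.

Definition hdec2 (u : U) (v : V) : W := \sum_(a <- hdec u) \sum_(b <- hdec v) F a b.

Lemma hdec2_lin : lin2 (@elin K U) (@elin K V) hdec2.
Proof.
split=> [v|u]; last by apply: lin_sum => a; apply/hdec_lin/F2.2.
apply: (hdec_lin (F := fun a => \sum_(b <- hdec v) F a b)).
by apply: lin_sum => b; apply: F2.1.
Qed.

Lemma hdec2_el a b : hdec2 (el a) (el b) = F a b.
Proof.
rewrite /hdec2 (hdec_el (F := fun a => \sum_(b <- hdec (el b)) F a b)).
  by rewrite hdec_el //; apply: F2.2.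
by apply: lin_sum => c; apply: F2.1.
Qed.

Lemma hterms_terms T :
  \sum_(t <- hterms T) F t.1 t.2 = \sum_(t <- terms T) hdec2 t.1 t.2.
Proof.
rewrite /hterms big_flatten big_map; apply: eq_bigr => t _.
by rewrite big_allpairs_dep.
Qed.

Lemma hterms_lin :
  lin (@elin K (tensor U V)) (fun T => \sum_(t <- hterms T) F t.1 t.2).
Proof. by move=> k S T R /(terms_lin hdec2_lin); rewrite -!hterms_terms. Qed.

Lemma hterms_pure a b : \sum_(t <- hterms (el a ⊗ el b)) F t.1 t.2 = F a b.
Proof. by rewrite hterms_terms (terms_pure hdec2_lin) hdec2_el. Qed.
End HTerms.

(** The sum of F(x', x'') over homogeneous components.  The filter loses nothing,
    and provides the equation between degrees on which signs depend. *)
Definition hsum (K : comNzRingType) (A : gradedBialgType K) (W : lmodType K)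
    (x : helt A) (F : helt A -> helt A -> W) : W :=
  \sum_(u <- sw2 (el x) | deg u.1 + deg u.2 == deg x) F u.1 u.2.

Section Hsum.
Variables (K : comNzRingType) (A : gradedBialgType K) (W : lmodType K).
Notation hA := (@helin K A).
Notation eA := (@elin K A).

Lemma hsum_ext x (F G : helt A -> helt A -> W) :
  (forall a b, deg x = deg a + deg b -> F a b = G a b) -> hsum x F = hsum x G.
Proof. by move=> h; apply: eq_bigr => u /eqP e; apply: h. Qed.

(** The comultiplication is homogeneous: it has representatives all of whose terms
    pass the filter, and a bilinear sum does not depend on the representative. *)
Lemma hsum_sw2 x (F : helt A -> helt A -> W) : lin2 hA hA F ->
  \sum_(u <- sw2 (el x)) F u.1 u.2 = hsum x F.
Proof.
move=> F2; pose G (a b : helt A) : W := if deg a + deg b == deg x then F a b else 0.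
have G2 : lin2 hA hA G.
  split=> [b|a] k u v w h; move: (h) => [d1 d2 _]; rewrite /G d1 d2;
    case: eqP => _; rewrite ?scaler0 ?addr0 //; [exact: F2.1 | exact: F2.2].
rewrite /hsum [RHS]big_mkcond /= -[RHS]/(\sum_(u <- sw2 (el x)) G u.1 u.2).
have [s [hs e]] := comul_homog _ _ (elP x).
rewrite /sw2 e (linsum _ _ _ (hterms_lin F2)) (linsum _ _ _ (hterms_lin G2)).
rewrite big_seq [RHS]big_seq; apply: eq_bigr => u /hs[q [h1 h2]].
rewrite (hterms_pure F2 (HElt h1) (HElt h2)) (hterms_pure G2 (HElt h1) (HElt h2)).
by rewrite /G (_ : deg _ + deg _ == deg x) //= addrC subrK.
Qed.

Lemma hsum_csum x (F : helt A -> helt A -> W) : lin2 hA hA F ->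
  hsum x F = csum (el x) (hdec2 F).
Proof. by move=> F2; rewrite -hsum_sw2 // /sw2 hterms_terms. Qed.

Lemma hsum_csum_el x (f : A -> A -> W) : lin2 eA eA f ->
  hsum x (fun a b => f (el a) (el b)) = csum (el x) f.
Proof.
move=> f2; rewrite hsum_csum; last first.
  split=> [b|a]; first exact: (lin_appe (f2.1 (el b)) (@lin_el _ _)).
  exact: (lin_appe (f2.2 (el a)) (@lin_el _ _)).
apply: csum_ext => u v; rewrite /hdec2.
under eq_bigr => a _ do rewrite (hdec_lin_el _ (f2.2 (el a))).
by rewrite (hdec_lin_el _ (f2.1 v)).
Qed.

Lemma hsum_lin (F : helt A -> helt A -> W) : lin2 hA hA F -> lin hA (fun x => hsum x F).
Proof.
move=> F2 k x y z [_ _ e]; rewrite !hsum_csum //.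
exact: (csum_lin (hdec2_lin F2)).
Qed.

Lemma lin_hsum_body (D : Type) (E : K -> D -> D -> D -> Prop) x
    (F : D -> helt A -> helt A -> W) :
  (forall a b, lin E (fun d => F d a b)) -> lin E (fun d => hsum x (F d)).
Proof. by move=> h; apply: lin_sum => u; apply: h. Qed.

Lemma hsum_scale x k (F : helt A -> helt A -> W) :
  k *: hsum x F = hsum x (fun a b => k *: F a b).
Proof. exact: scaler_sumr. Qed.

Lemma hsum_add x (F G : helt A -> helt A -> W) :
  hsum x F + hsum x G = hsum x (fun a b => F a b + G a b).
Proof. by rewrite [RHS]big_split. Qed.

Lemma hsum_opp x (F : helt A -> helt A -> W) : - hsum x F = hsum x (fun a b => - F a b).
Proof. by rewrite [RHS]sumrN. Qed.

Lemma hsum_app x (W' : lmodType K) (g : W -> W') (F : helt A -> helt A -> W) :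
  lin (@elin K W) g -> g (hsum x F) = hsum x (fun a b => g (F a b)).
Proof. exact: linsum. Qed.

Lemma hsum_exch (A' : gradedBialgType K) x (y : helt A')
    (F : helt A -> helt A -> helt A' -> helt A' -> W) :
  hsum x (fun a b => hsum y (F a b)) = hsum y (fun c d => hsum x (fun a b => F a b c d)).
Proof. exact: exchange_big. Qed.

Lemma hsum_csum_exch (B : gradedBialgType K) x (y : B)
    (F : helt A -> helt A -> B -> B -> W) :
  hsum x (fun a b => csum y (F a b)) = csum y (fun c d => hsum x (fun a b => F a b c d)).
Proof. exact: exchange_big. Qed.

Lemma hsum_counitl x (F : helt A -> W) : lin hA F ->
  hsum x (fun a b => counit (el a) *: F b) = F x.
Proof.
move=> h; pose f (z : A) := \sum_(a <- hdec z) F a.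
have hf : lin eA f by apply: hdec_lin.
transitivity (hsum x (fun a b => counit (el a) *: f (el b))).
  by apply: hsum_ext => a b _; rewrite /f hdec_el.
rewrite (hsum_csum_el x (f := fun a b => counit a *: f b));
  first by rewrite csum_counitl // /f hdec_el.
split=> [v|u]; first by apply: lin_scalel; apply: linK_counit; apply: lin_id.
exact: lin_scalec.
Qed.

Lemma hsum_counitr x (F : helt A -> W) : lin hA F ->
  hsum x (fun a b => counit (el b) *: F a) = F x.
Proof.
move=> h; pose f (z : A) := \sum_(a <- hdec z) F a.
have hf : lin eA f by apply: hdec_lin.
transitivity (hsum x (fun a b => counit (el b) *: f (el a))).
  by apply: hsum_ext => a b _; rewrite /f hdec_el.
rewrite (hsum_csum_el x (f := fun a b => counit b *: f a));
  first by rewrite csum_counitr // /f hdec_el.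
split=> [v|u]; first exact: lin_scalec.
by apply: lin_scalel; apply: linK_counit; apply: lin_id.
Qed.

Lemma hsum_coassoc x (F : helt A -> helt A -> helt A -> W) :
  (forall b c, lin hA (fun a => F a b c)) -> (forall a c, lin hA (fun b => F a b c)) ->
  (forall a b, lin hA (F a b)) ->
  hsum x (fun a b => hsum a (fun c d => F c d b)) =
  hsum x (fun a b => hsum b (fun c d => F a c d)).
Proof.
move=> h1 h2 h3.
pose f (u v w : A) := \sum_(a <- hdec u) hdec2 (F a) v w.
have F2a a : lin2 hA hA (F a) by split.
have F2c c : lin2 hA hA (fun a b => F a b c) by split=> [b|a]; [apply: h1|apply: h2].
have f1 v w : lin eA (fun u => f u v w).
  apply: (hdec_lin (F := fun a => hdec2 (F a) v w)).
  by do 2!(apply: lin_sum => ?); apply: h1.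
have f2 u w : lin eA (fun v => f u v w).
  by apply: lin_sum => a; apply: (hdec2_lin _).1.
have f3 u v : lin eA (f u v).
  by apply: lin_sum => a; apply: (hdec2_lin _).2.
have fc u v c : hdec2 (fun a b => F a b c) u v = f u v (el c).
  by apply: eq_bigr => a _; apply: eq_bigr => b _; rewrite hdec_el.
have fa a v w : hdec2 (F a) v w = f (el a) v w.
  rewrite /f (hdec_el (F := fun a => hdec2 (F a) v w)) //.
  by do 2!(apply: lin_sum => ?); apply: h1.
transitivity (csum (el x) (fun u w => csum u (fun v t => f v t w))).
  rewrite -(hsum_csum_el x (f := fun u w => csum u (fun v t => f v t w))).
    by apply: hsum_ext => a b _; rewrite hsum_csum //; apply: csum_ext => u v; rewrite fc.
  by split=> [w|u]; [apply: csum_lin; split=> ? | apply: lin_csum_body => ? ?].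
rewrite csum_coassoc // -(hsum_csum_el x (f := fun u w => csum w (f u))).
  by apply: hsum_ext => a b _; rewrite hsum_csum //; apply: csum_ext => u v; rewrite fa.
by split=> [w|u]; [apply: lin_csum_body => ? ? | apply: csum_lin; split=> ?].
Qed.
End Hsum.

Definition hone (K : comNzRingType) (A : gradedAlgType K) : helt A := HElt (@homog1 K A).
Arguments hone {K A}.

Definition hmul (K : comNzRingType) (A : gradedAlgType K) (x y : helt A) : helt A :=
  HElt (homogM _ _ _ _ (elP x) (elP y)).

Definition hs (K : comNzRingType) (A : gradedHopfType K) (x : helt A) : helt A :=
  HElt (antipode_homog _ _ (elP x)).

Lemma hmorph_mull (K : comNzRingType) (A : gradedAlgType K) (D : Type)
    (E : K -> D -> D -> D -> Prop) (g : D -> helt A) y :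
  hmorph E g -> hmorph E (fun x => hmul (g x) y).
Proof.
move=> hg k a b c /hg[da db e]; split; rewrite /= ?da ?db //.
by rewrite e mulrDl scalerAl.
Qed.

Lemma hmorph_mulr (K : comNzRingType) (A : gradedAlgType K) (D : Type)
    (E : K -> D -> D -> D -> Prop) (g : D -> helt A) y :
  hmorph E g -> hmorph E (fun x => hmul y (g x)).
Proof.
move=> hg k a b c /hg[da db e]; split; rewrite /= ?da ?db //.
by rewrite e mulrDr scalerAr.
Qed.

Lemma hmorph_s (K : comNzRingType) (A : gradedHopfType K) (D : Type)
    (E : K -> D -> D -> D -> Prop) (g : D -> helt A) :
  hmorph E g -> hmorph E (fun x => hs (g x)).
Proof.
move=> hg k a b c /hg[da db e]; split; rewrite /= ?da ?db //.
by rewrite e linearP.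
Qed.

Lemma lin_hsum_deg (K : comNzRingType) (A : gradedBialgType K) (W : lmodType K)
    (D : Type) (E : K -> D -> D -> D -> Prop) (g : D -> helt A)
    (G : D -> helt A -> helt A -> W) :
  (forall k x y z, E k x y z -> G x = G z /\ G y = G z) ->
  (forall x, lin2 (@helin K A) (@helin K A) (G x)) -> hmorph E g ->
  lin E (fun x => hsum (g x) (G x)).
Proof.
move=> hG G2 hg k x y z e; have [-> ->] := hG _ _ _ _ e.
exact: (hsum_lin (G2 z) (hg _ _ _ _ e)).
Qed.

(* Extended below with the rules of further operations. *)
Ltac lint_ext lint := fail.

(* Succeeds when the function f depends on its argument. *)
Ltac depends f :=
  lazymatch type of f with ?D -> _ =>
    let t := constr:(fun the_arg : D => ltac:(
      let y := eval cbv beta in (f the_arg) in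
      match y with context [the_arg] => exact true | _ => exact false end)) in
    lazymatch t with (fun _ => true) => idtac | _ => fail end
  end.

(* Signs depend on homogeneous elements only through their degrees. *)
Ltac degc :=
  let h := fresh in
  intros ? ? ? ? h;
  first [ split; lazymatch goal with |- ?a = ?a => reflexivity end
        | case: h => /= -> -> _; split;
          lazymatch goal with |- ?a = ?b => first [constr_eq a b | idtac]; reflexivity end ].

(* Proves linearity by recursion on the expression; in a product, the factor in
   which the variable occurs determines the rule. *)
Ltac lint := cbv beta; lazymatch goal with
  | |- forall _, _ => intro; lint
  | |- lin2 _ _ _ => split; lint
  | |- hmorph _ _ => lint_morph
  | |- @lin _ _ _ _ (fun x => x) => exact: lin_id
  | |- @lin _ _ _ _ (@el _ _) => exact: lin_el
  | |- @lin _ _ _ _ (fun x => hsum (@?lg x) (@?lG x)) =>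
      tryif depends lg then
       (tryif depends lG then refine (@lin_hsum_deg _ _ _ _ _ lg lG _ _ _); [solve [degc] | |]
        else first [ refine (hsum_lin _) | refine (lin_apph (g := fun z => hsum z _) (F:=lg) _ _) ])
      else refine (@lin_hsum_body _ _ _ _ _ _ lG _); lint
  | |- @lin _ _ _ _ (fun x => csum (@?lg x) (@?lG x)) =>
      tryif depends lg then
        first [ refine (csum_lin _) | refine (lin_appe (g:=fun z => csum z _) (F:=lg) _ _) ]
      else refine (@lin_csum_body _ _ _ _ _ _ lG _); lint
  | |- @lin _ _ _ _ (fun x => (@?lF x) + (@?lG x)) =>
    first [ refine (lin_add (F:=lF) (G:=lG) _ _) | refine (linK_add (F:=lF) (G:=lG) _ _) ]; lint
  | |- @lin _ _ _ _ (fun x => - (@?lF x)) =>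
    first [ refine (lin_opp (F:=lF) _) | refine (linK_opp (F:=lF) _) ]; lint
  | |- @lin _ _ _ _ (fun x => \sum_(i <- _ | _) (@?lF x i)) =>
    refine (@lin_sum _ _ _ _ _ _ _ lF _); lint
  | |- @lin _ _ _ _ (fun x => (@?lc x) *: (@?lF x)) =>
      tryif depends lF then refine (lin_scale (c:=lc) (F:=lF) _ _); [solve [degc]|]
      else refine (@lin_scalel _ _ _ _ lc _ _); lint
  | |- @lin _ _ _ _ (fun x => counit (@?lF x)) => refine (linK_counit (F:=lF) _); lint
  | |- @lin _ _ _ _ (fun x => antipode (@?lF x)) => refine (lin_antipode (F:=lF) _); lint
  | |- @lin _ _ _ _ (fun x => rgen (@?lF x) (@?lG x)) =>
      tryif depends lF then refine (@lin_rgenl _ _ _ _ _ lF _ _)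
      else refine (@lin_rgenr _ _ _ _ _ lG _ _); lint
  | |- @lin _ _ _ _ (fun x => (@?lF x) * (@?lG x)) =>
      tryif depends lF then first [ refine (@lin_mull _ _ _ _ lF _ _) | refine (@linK_mull _ _
        _ lF _ _) ]
      else first [ refine (@lin_mulr _ _ _ _ lG _ _) | refine (@linK_mulr _ _ _ lG _ _) ]; lint
  | |- _ => lint_hyp
  end
with lint_morph := lazymatch goal with
  | |- @hmorph _ _ _ _ (fun x => x) => exact: hmorph_id
  | |- @hmorph _ _ _ _ (fun x => hmul (@?lg x) (@?lh x)) =>
      tryif depends lg then refine (@hmorph_mull _ _ _ _ lg _ _)
      else refine (@hmorph_mulr _ _ _ _ lh _ _); lint
  | |- @hmorph _ _ _ _ (fun x => hs (@?lg x)) => refine (hmorph_s (g:=lg) _); lint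
  | |- @hmorph _ _ _ _ (hmul _) => refine (hmorph_mulr _ _); lint
  | |- @hmorph _ _ _ _ (@hs _ _) => refine (hmorph_s _); lint
  | |- _ => lint_hyp
  end
with lint_hyp := match goal with
  | H : lin2 _ _ ?lf |- @lin _ _ _ _ (fun x => ?lf (@?lg x) (@?lh x)) =>
     tryif depends lg then
       first [ refine (H.1 _) | refine (lin_appe (F:=lg) (H.1 _) _) | refine (lin_apph (F:=lg)
         (H.1 _) _) ]
     else
       first [ refine (H.2 _) | refine (lin_appe (F:=lh) (H.2 _) _) | refine (lin_apph (F:=lh)
         (H.2 _) _) ]; lint
  | H : lin2 _ _ ?lf |- @lin _ _ _ _ (?lf ?lb) => exact: (H.2 lb)
  | H : lin _ ?lf |- @lin _ _ _ _ (fun x => ?lf (@?lg x)) =>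
     first [ exact: H | refine (lin_appe (F:=lg) H _) | refine (lin_apph (F:=lg) H _) ]; lint
  | H : is_bilinear ?lf |- @lin _ _ _ _ (fun x => ?lf (@?lg x) (@?lh x)) =>
     tryif depends lg then refine (lin_appl (F:=lg) _ H _) else refine (lin_appr (F:=lh) _ H
       _); lint
  | |- @lin _ _ _ _ (fun x => el (@?lg x)) => refine (hmorph_lin (g:=lg) _); lint
  | _ => lint_ext lint
  | _ => solve [auto]
  end.

Section HsumHopf.
Variables (K : comNzRingType) (A : gradedHopfType K) (W : lmodType K).
Notation hA := (@helin K A).

Lemma counit_deg (B : gradedBialgType K) (x : helt B) : deg x != 0 -> counit (el x) = 0.
Proof. exact/counit_homog/elP. Qed.

Lemma hsum_mul (x y : helt A) (F : helt A -> helt A -> W) : lin2 hA hA F ->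
  hsum (hmul x y) F = hsum x (fun a b => hsum y (fun c d =>
    ksign K (deg b * deg c) *: F (hmul a c) (hmul b d))).
Proof.
move=> F2; rewrite -hsum_sw2 // /sw2 /= comulM /tmul (linsum _ _ _ (hterms_lin F2)).
rewrite -hsum_sw2; last by lint.
apply: eq_bigr => u _; rewrite (linsum _ _ _ (hterms_lin F2)) -hsum_sw2; last by lint.
apply: eq_bigr => v _; rewrite (linZ _ _ (hterms_lin F2)); congr (_ *: _).
exact: (hterms_pure F2 (hmul u.1 v.1) (hmul u.2 v.2)).
Qed.

(** F sees the degree of its argument, and the unit has degree 0; in any other
    degree both sides vanish, the counit being homogeneous. *)
Lemma hsum_antipodel x (F : helt A -> W) : lin hA F ->
  hsum x (fun a b => F (hmul (hs a) b)) = counit (el x) *: F hone.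
Proof.
case/lin_hdecE=> G hG FG.
transitivity (hsum x (fun a b => G (deg x) (antipode (el a) * el b))).
  by apply: hsum_ext => a b e; rewrite FG /= e.
rewrite (hsum_csum_el x (f := fun a b => G (deg x) (antipode a * b))); last first.
  by have hGx := hG (deg x); lint.
rewrite (csum_antipodel _ (hG _)) FG /=; have [->//|x0] := eqVneq (deg x) 0.
by rewrite counit_deg // !scale0r.
Qed.

Lemma hsum_antipoder x (F : helt A -> W) : lin hA F ->
  hsum x (fun a b => F (hmul a (hs b))) = counit (el x) *: F hone.
Proof.
case/lin_hdecE=> G hG FG.
transitivity (hsum x (fun a b => G (deg x) (el a * antipode (el b)))).
  by apply: hsum_ext => a b e; rewrite FG /= e.
rewrite (hsum_csum_el x (f := fun a b => G (deg x) (a * antipode b))); last first.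
  by have hGx := hG (deg x); lint.
rewrite (csum_antipoder _ (hG _)) FG /=; have [->//|x0] := eqVneq (deg x) 0.
by rewrite counit_deg // !scale0r.
Qed.

Lemma hsum_cocomm x (F : helt A -> helt A -> W) : cocommutative A -> lin2 hA hA F ->
  hsum x F = hsum x (fun a b => ksign K (deg a * deg b) *: F b a).
Proof.
move=> hc F2; rewrite -hsum_sw2 // {1}/sw2 hc (linsum _ _ _ (hterms_lin F2)).
rewrite -[RHS]hsum_sw2; last by lint.
apply: eq_bigr => u _; rewrite (linZ _ _ (hterms_lin F2)); congr (_ *: _).
exact: (hterms_pure F2 u.2 u.1).
Qed.
End HsumHopf.

(** * Antipodes of graded Hopf algebras *)

Section AntipodeMul.
Variables (K : comNzRingType) (A : gradedHopfType K).
Implicit Types x y : helt A.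

(** As the counit vanishes outside of degree 0, a factor counit (el x) makes the
    degree of x even in the computation of signs. *)
Lemma counit_if (W : lmodType K) (C : gradedBialgType K) (x : helt C) (v w : W) :
  (parity (deg x) = false -> v = w) -> counit (el x) *: v = counit (el x) *: w.
Proof.
move=> h; have [x0|x0] := eqVneq (deg x) 0; last by rewrite counit_deg // !scale0r.
by rewrite h // x0.
Qed.

Lemma hsum_collapsel (W : lmodType K) (C : gradedBialgType K) (x : helt C)
    (F : helt C -> W) (H : helt C -> helt C -> W) : lin (@helin K C) F ->
  (forall a b, deg x = deg a + deg b -> H a b = counit (el a) *: F b) -> hsum x H = F x.
Proof. by move=> hF hH; rewrite -[RHS]hsum_counitl //; apply: hsum_ext. Qed.

Lemma hsum_collapser (W : lmodType K) (C : gradedBialgType K) (x : helt C)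
    (F : helt C -> W) (H : helt C -> helt C -> W) : lin (@helin K C) F ->
  (forall a b, deg x = deg a + deg b -> H a b = counit (el b) *: F a) -> hsum x H = F x.
Proof. by move=> hF hH; rewrite -[RHS]hsum_counitr //; apply: hsum_ext. Qed.

Lemma counit_sgn (W : lmodType K) (C : gradedBialgType K) (x : helt C) k l (w : W) :
  (parity (deg x) = false -> parity k = parity l) ->
  counit (el x) *: (ksign K k *: w) = counit (el x) *: (ksign K l *: w).
Proof.
move=> h; have [x0|x0] := eqVneq (deg x) 0; last by rewrite counit_deg // !scale0r.
by rewrite (ksign_parity K (h _)) // x0.
Qed.

Lemma counit_sgn1 (W : lmodType K) (C : gradedBialgType K) (x : helt C) k (w : W) :
  (parity (deg x) = false -> parity k = false) ->
  counit (el x) *: (ksign K k *: w) = counit (el x) *: w.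
Proof. by move=> h; rewrite (counit_sgn (l := 0)) ?ksign0 ?scale1r. Qed.

(** Both sides are convolution inverses of the multiplication of A.  The sum of G
    is the convolution product of the left side, the multiplication and the right
    side, and collapses to either of them. *)
Lemma antipode_mul x y :
  antipode (el x * el y) =
  ksign K (deg x * deg y) *: (antipode (el y) * antipode (el x)).
Proof.
(* The convolution product of three maps on A ⊗ A. *)
pose G (x1 x2 x3 y1 y2 y3 : helt A) : A :=
  ksign K ((deg x2 + deg x3) * deg y1 + deg x3 * (deg y2 + deg y3)) *:
    (antipode (el x1 * el y1) * (el x2 * el y2) * (antipode (el y3) * antipode (el x3))).
have l1 x2 x3 y1 y2 y3 : lin (@helin K A) (fun x1 => G x1 x2 x3 y1 y2 y3) by rewrite /G; lint.
have l2 x1 x3 y1 y2 y3 : lin (@helin K A) (fun x2 => G x1 x2 x3 y1 y2 y3) by rewrite /G; lint.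
have l3 x1 x2 y1 y2 y3 : lin (@helin K A) (fun x3 => G x1 x2 x3 y1 y2 y3) by rewrite /G; lint.
have l4 x1 x2 x3 y2 y3 : lin (@helin K A) (fun y1 => G x1 x2 x3 y1 y2 y3) by rewrite /G; lint.
have l5 x1 x2 x3 y1 y3 : lin (@helin K A) (fun y2 => G x1 x2 x3 y1 y2 y3) by rewrite /G; lint.
have l6 x1 x2 x3 y1 y2 : lin (@helin K A) (fun y3 => G x1 x2 x3 y1 y2 y3) by rewrite /G; lint.
transitivity (hsum x (fun x1 X => hsum X (fun x2 x3 =>
   hsum y (fun y1 Y => hsum Y (fun y2 y3 => G x1 x2 x3 y1 y2 y3))))).
  transitivity (hsum x (fun x1 X => counit (el X) *: hsum y (fun y1 Y =>
       counit (el Y) *: antipode (el x1 * el y1)))).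
    by rewrite (hsum_counitr x (F := fun a => _)) ?hsum_counitr; lint.
  apply: hsum_ext => x1 X _; rewrite hsum_exch hsum_scale; apply: hsum_ext => y1 Y _.
  transitivity (hsum X (fun x2 x3 => counit (el Y) *: (ksign K (deg X * deg y1) *:
    (antipode (el x1 * el y1) * (el x2 * antipode (el x3)))))).
    rewrite scalerA mulrC -scalerA.
    rewrite -hsum_scale -(hsum_scale X (ksign K _)).
    rewrite (hsum_antipoder X (F := fun z => antipode (el x1 * el y1) * el z)) /=; last by lint.
    rewrite mulr1; congr (_ *: _); rewrite scalerA mulrC -scalerA.
    rewrite -{1}[antipode _]scale1r -(ksign0 K); apply: counit_sgn => X0.
    by rewrite parityM X0.
  apply: hsum_ext => x2 x3 eX; rewrite /G.
  transitivity (hsum Y (fun y2 y3 => ksign K ((deg x2 + deg x3) * deg y1 + deg x3 * deg Y) *: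
    (antipode (el x1 * el y1) * el x2 * (el y2 * antipode (el y3)) * antipode (el x3))));
      last first.
    by apply: hsum_ext => y2 y3 ->; rewrite !mulrA.
  rewrite -hsum_scale (hsum_antipoder Y (F := fun z =>
    antipode (el x1 * el y1) * el x2 * el z * antipode (el x3))); last by lint.
  rewrite /= mulr1 scalerA [RHS]scalerA [_ * counit _]mulrC -!scalerA eX mulrA.
  by apply: counit_sgn => Y0; parity_tauto.
transitivity (hsum x (fun X x3 => hsum y (fun Y y3 =>
  counit (el X) *: (counit (el Y) *: (ksign K (deg x3 * deg y)
   *: (antipode (el y3) * antipode (el x3))))))); last first.
  rewrite (hsum_exch x y) (_ : hsum y _ =
    hsum y (fun Y y3 => counit (el Y) *: (ksign K (deg x * deg y)
   *: (antipode (el y3) * antipode (el x))))).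
    by rewrite hsum_counitl; lint.
  apply: hsum_ext => Y y3 _.
  rewrite -(hsum_counitl x (F := fun x3 => counit (el Y) *: (ksign K (deg x3 * deg y)
   *: (antipode (el y3) * antipode (el x3))))) //; lint.
rewrite -(hsum_coassoc x (F := fun x1 x2 x3 => hsum y (fun y1 Y => hsum Y (fun y2 y3 =>
  G x1 x2 x3 y1 y2 y3)))); try lint.
apply: hsum_ext => X x3 ex.
transitivity (hsum X (fun x1 x2 => hsum y (fun Y y3 => hsum Y (fun y1 y2 => G x1 x2 x3 y1 y2 y3)))).
  by apply: hsum_ext => x1 x2 _; rewrite (hsum_coassoc y (F := G x1 x2 x3)).
rewrite hsum_exch; apply: hsum_ext => Y y3 ey.
transitivity (hsum (hmul X Y) (fun u v => ksign K (deg x3 * deg y) *: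
   (antipode (el u) * el v * (antipode (el y3) * antipode (el x3))))).
  rewrite hsum_mul; last by lint.
  apply: hsum_ext => x1 x2 _; apply: hsum_ext => y1 y2 eY; rewrite ksignZ /G.
  by congr (_ *: _); sgn.
rewrite -hsum_scale (hsum_antipodel (hmul X Y) (F := fun z =>
  el z * (antipode (el y3) * antipode (el x3)))); last by lint.
by rewrite /= mul1r counitM !scalerA [ksign _ _ * _]mulrC.
Qed.
End AntipodeMul.

Section AntipodeComul.
Variables (K : comNzRingType) (A : gradedHopfType K).
Implicit Types x y : helt A.
Notation hA := (@helin K A).

Lemma csum_one (C : gradedBialgType K) (W : lmodType K) (f : C -> C -> W) :
  lin2 (@elin K C) (@elin K C) f -> csum 1 f = f 1 1.
Proof. by move=> f2; rewrite /csum comul1 (terms_pure f2). Qed.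

Lemma hsum_one (W : lmodType K) (F : helt A -> helt A -> W) : lin2 hA hA F ->
  hsum hone F = F hone hone.
Proof. by move=> F2; rewrite (hsum_csum _ F2) (csum_one (hdec2_lin F2)) -(hdec2_el F2). Qed.

Lemma antipode1 : antipode (1 : A) = 1.
Proof.
have := csum_antipodel (1 : A) (@lin_id K A); rewrite csum_one /=; last by lint.
by rewrite mulr1 counit1 scale1r.
Qed.

(** Both sides are convolution inverses of the comultiplication of A, by the same
    argument as for products. *)
Lemma hsum_antipode (W : lmodType K) x (G : helt A -> helt A -> W) : lin2 hA hA G ->
  hsum (hs x) G = hsum x (fun a b => ksign K (deg a * deg b) *: G (hs b) (hs a)).
Proof.
move=> G2.
(* The convolution product of three maps from A to A ⊗ A, tested by G. *)
pose H (a a' p p' w1 w2 : helt A) : W :=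
  ksign K (deg p * deg a' + deg w2 * (deg a' + deg p' + deg w1)) *:
    G (hmul a (hmul p (hs w2))) (hmul a' (hmul p' (hs w1))).
have l1 a a' p p' w1 : lin hA (H a a' p p' w1) by rewrite /H; lint.
have l2 a a' p p' w2 : lin hA (fun w1 => H a a' p p' w1 w2) by rewrite /H; lint.
have l3 a a' p w1 w2 : lin hA (fun p' => H a a' p p' w1 w2) by rewrite /H; lint.
have l4 a a' p' w1 w2 : lin hA (fun p => H a a' p p' w1 w2) by rewrite /H; lint.
have l5 a p p' w1 w2 : lin hA (fun a' => H a a' p p' w1 w2) by rewrite /H; lint.
have l6 a' p p' w1 w2 : lin hA (fun a => H a a' p p' w1 w2) by rewrite /H; lint.
have lH a a' : lin2 hA hA (fun P w => hsum P (fun p p' => hsum w (H a a' p p'))).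
  by split; lint.
pose F x1 P w := hsum (hs x1) (fun a a' => hsum P (fun p p' => hsum w (H a a' p p'))).
transitivity (hsum x (fun x1 X => hsum X (fun P w => F x1 P w))).
  rewrite -(hsum_counitr x (F := fun x1 => hsum (hs x1) G)); last by lint.
  apply: hsum_ext => x1 X _; rewrite hsum_scale [RHS]hsum_exch; apply: hsum_ext => a a' _.
  rewrite (hsum_coassoc X (F := fun p p' w => hsum w (H a a' p p'))); try by lint.
  transitivity (hsum X (fun p Y => hsum Y (fun V w2 => hsum V (fun p' w1 => H a a' p p' w1 w2))));
    last by apply: hsum_ext => p Y _; rewrite (hsum_coassoc Y (F := H a a' p)).
  transitivity (hsum X (fun p Y => hsum Y (fun V w2 => counit (el V) *:
     (ksign K ((deg p + deg w2) * deg a') *: G (hmul a (hmul p (hs w2))) a')))).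
    transitivity (hsum X (fun p w2 =>
     (ksign K ((deg p + deg w2) * deg a') *: G (hmul a (hmul p (hs w2))) a'))); last first.
      by apply: hsum_ext => p Y _; rewrite hsum_counitl //; lint.
    transitivity (hsum X (fun p w2 =>
     (ksign K (deg X * deg a') *: G (hmul a (hmul p (hs w2))) a'))); last first.
      by apply: hsum_ext => p w2 ->.
    rewrite -hsum_scale (hsum_antipoder X (F := fun z => G (hmul a z) a')); last by lint.
    have -> : G (hmul a hone) a' = G a a'.
      by apply: (lin_eq (G2.1 a')); rewrite /= ?addr0 ?mulr1.
    by rewrite scaleC counit_sgn1 // => X0; parity_tauto.
  apply: hsum_ext => p Y _; apply: hsum_ext => V w2 eY.
  transitivity (hsum V (fun p' w1 => ksign K (deg p * deg a' + deg w2 * (deg a' + deg V)) *: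
     G (hmul a (hmul p (hs w2))) (hmul a' (hmul p' (hs w1))))); last first.
    by apply: hsum_ext => p' w1 eV; rewrite /H; congr (_ *: _); sgn.
  rewrite -hsum_scale (hsum_antipoder V (F := fun z =>
    G (hmul a (hmul p (hs w2))) (hmul a' z))); last by lint.
  have -> : G (hmul a (hmul p (hs w2))) (hmul a' hone) = G (hmul a (hmul p (hs w2))) a'.
    by apply: (lin_eq (G2.2 _)); rewrite /= ?addr0 ?mulr1.
  by rewrite [RHS]scaleC; apply: counit_sgn => V0; parity_tauto.
rewrite -(hsum_coassoc x (F := F)); try by rewrite /F; lint.
transitivity (hsum x (fun Q w => counit (el Q) *: hsum w (fun w1 w2 =>
     ksign K (deg w1 * deg w2) *: G (hs w2) (hs w1)))); last first.
  by rewrite hsum_counitl //; lint.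
apply: hsum_ext => Q w _.
pose G' (u u' : helt A) := hsum w (fun w1 w2 => ksign K (deg w2 * (deg u' + deg w1)) *:
  G (hmul u (hs w2)) (hmul u' (hs w1))).
have G'2 : lin2 hA hA G' by rewrite /G'; lint.
transitivity (hsum Q (fun x1 P => hsum (hmul (hs x1) P) G')).
  apply: hsum_ext => x1 P _; rewrite hsum_mul // /F; apply: hsum_ext => a a' _.
  apply: hsum_ext => p p' _; rewrite hsum_scale; apply: hsum_ext => w1 w2 _.
  rewrite ksignZ /H (_ : G (hmul (hmul a p) (hs w2)) _ =
     G (hmul a (hmul p (hs w2))) (hmul a' (hmul p' (hs w1)))).
    by congr (_ *: _); sgn.
  rewrite (lin_eq (b := hmul a (hmul p (hs w2))) (G2.1 _)) /= ?addrA ?mulrA //.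
  by apply: (lin_eq (G2.2 _)); rewrite /= ?addrA ?mulrA.
rewrite (hsum_antipodel Q (F := fun z => hsum z G')); last by lint.
rewrite hsum_one // /G'; congr (_ *: _); apply: hsum_ext => w1 w2 _.
rewrite /= add0r [deg w2 * _]mulrC; congr (_ *: _).
rewrite (lin_eq (b := hs w2) (G2.1 _)) /= ?add0r ?mul1r //.
by apply: (lin_eq (G2.2 _)); rewrite /= ?add0r ?mul1r.
Qed.

Hypothesis A_cocomm : cocommutative A.

(** By cocommutativity and antipode_mul, the square of the antipode is a
    convolution inverse of the antipode, and so is the identity. *)
Lemma antipodeK x : antipode (antipode (el x)) = el x.
Proof.
have inv x' : hsum x' (fun a b => antipode (antipode (el a)) * antipode (el b)) =
    counit (el x') *: 1.
  rewrite -[in RHS]antipode1 -(hsum_antipoder x' (F := fun z => antipode (el z))); last by lint.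
  rewrite [RHS](hsum_cocomm x' A_cocomm); last by lint.
  apply: hsum_ext => a b _.
  by rewrite /= (antipode_mul b (hs a)) /= ksignZ (@ksign_parity _ _ 0) ?ksign0 ?scale1r //;
    parity_tauto.
rewrite -(hsum_counitr x (F := fun a => antipode (antipode (el a)))); last by lint.
transitivity (hsum x (fun a X => hsum X (fun b c =>
   antipode (antipode (el a)) * (antipode (el b) * el c)))).
  apply: hsum_ext => a X _.
  rewrite (hsum_antipodel X (F := fun z => antipode (antipode (el a)) * el z)) /= ?mulr1 //.
  by lint.
rewrite -(hsum_coassoc x (F := fun a b c =>
  antipode (antipode (el a)) * (antipode (el b) * el c))); try by lint.
rewrite -[RHS](hsum_counitl x (F := fun c => el c)); last by lint.
apply: hsum_ext => X c _.
transitivity (hsum X (fun a b => antipode (antipode (el a)) * antipode (el b)) * el c).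
  by rewrite (hsum_app X (g := fun z => z * el c)); [apply: hsum_ext => a b _;
    rewrite mulrA | lint].
by rewrite inv -scalerAl mul1r.
Qed.
End AntipodeComul.

Lemma counit_antipode (K : comNzRingType) (A : gradedHopfType K) (x : A) :
  counit (antipode x) = counit x.
Proof.
have := csum_antipodel (W := K^o) x (linK_counit (@lin_id K A)).
rewrite counit1 [RHS]mulr1 => <-.
rewrite -[LHS](csum_counitr (W := K^o) x (f := fun z => counit (antipode z))); last by lint.
by apply: eq_bigr => u _; rewrite counitM [LHS]mulrC.
Qed.

(** * The digamma map against an invariant form *)

Definition hrho (K : comNzRingType) (A : gradedHopfType K) (n : int) (rho : A -> A -> A)
    (h : forall p q x y, homog p x -> homog q y -> homog (p + q + n) (rho x y))
    (x y : helt A) : helt A :=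
  HElt (h _ _ _ _ (elP x) (elP y)).

Ltac lint_trilin lint := match goal with
  | H : forall a b, lin _ (?lf a b) |- @lin _ _ _ _ (fun x => ?lf (@?lg x) (@?lh x) (@?lk x)) =>
      tryif depends lg then match goal with H : forall b c, lin _ (fun a => lf a b c) |- _ =>
        first [ refine (lin_appe (F:=lg) (H _ _) _) | refine (lin_apph (F:=lg) (H _ _) _) ] end
      else tryif depends lh then match goal with H : forall a c, lin _ (fun b => lf a b c) |- _ =>
        first [ refine (lin_appe (F:=lh) (H _ _) _) | refine (lin_apph (F:=lh) (H _ _) _) ] end
      else first [ refine (lin_appe (F:=lk) (H _ _) _) | refine (lin_apph (F:=lk) (H _ _) _) ]; lint
  end.

Section FoxCore.
Variables (K : comNzRingType) (A : gradedHopfType K) (n : int) (rho : A -> A -> A).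
Hypothesis A_cocomm : cocommutative A.
Hypothesis rho2 : is_bilinear rho.
Hypothesis rho_homog : forall p q x y, homog p x -> homog q y -> homog (p + q + n) (rho x y).
Notation hA := (@helin K A).
Notation eA := (@elin K A).
Notation r_ := (hrho rho_homog).

Lemma hmorph_rhol (D : Type) (E : K -> D -> D -> D -> Prop) (g : D -> helt A) y :
  hmorph E g -> hmorph E (fun x => r_ (g x) y).
Proof.
move=> hg k a b c /hg[da db e]; split; rewrite /= ?da ?db //.
by rewrite e rho2.1.
Qed.

Lemma hmorph_rhor (D : Type) (E : K -> D -> D -> D -> Prop) (g : D -> helt A) y :
  hmorph E g -> hmorph E (fun x => r_ y (g x)).
Proof.
move=> hg k a b c /hg[da db e]; split; rewrite /= ?da ?db //.
by rewrite e rho2.2.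
Qed.

Ltac lint_ext lint ::= match goal with
  | |- @hmorph _ _ _ _ (fun x => r_ (@?lg x) (@?lh x)) =>
      tryif depends lg then refine (@hmorph_rhol _ _ lg _ _)
      else refine (@hmorph_rhor _ _ lh _ _); lint
  | |- @hmorph _ _ _ _ (r_ _) => refine (hmorph_rhor _ _); lint
  | |- _ => lint_trilin lint
  end.

Variable (Q : lmodType K).

(** The composition of digamma with a trilinear map G. *)
Definition dig (G : helt A -> helt A -> helt A -> Q) (x y z : helt A) : Q :=
  hsum x (fun x1 x2 => hsum y (fun y1 y2 => hsum z (fun z1 z2 =>
  hsum (r_ x2 y2) (fun r1 R => hsum R (fun r2 r3 => hsum (r_ r3 z2) (fun q1 q2 =>
    ksign K (deg y1 * (deg x + n) + deg z1 * (deg x2 + deg y2)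
           + (deg x1 + deg z1) * deg r1 + deg r2 * deg q1) *:
    G (hmul (hmul y1 (hs r1)) x1) (hmul (hmul z1 (hs q1)) r2) q2)))))).

(** What ρ contributes to the double bracket of x, y and z: ρ(x, y'') is split in two,
    and its second component is paired with z''. *)
Definition core (F : helt A -> helt A -> Q) (x y z : helt A) : Q :=
  hsum y (fun y1 y2 => hsum z (fun z1 z2 => hsum (r_ x y2) (fun r1 r2 =>
    ksign K (deg y1 * (deg x + n) + deg z1 * (deg r2 + n)) *:
    F (hmul y1 (hs r1)) (hmul z1 (hs (r_ r2 z2)))))).

(** The composition of G with the permutation P_312. *)
Definition hrot (G : helt A -> helt A -> helt A -> Q) (a1 a2 a3 : helt A) : Q :=
  ksign K (deg a3 * (deg a1 + deg a2)) *: G a3 a1 a2.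

(** The vanishing of the tritensor map as it is seen by G. *)
Definition dig_cyclic (G : helt A -> helt A -> helt A -> Q) : Prop := forall x y z,
  dig G x y z
  + ksign K ((deg x + n) * ((deg y + n) + (deg z + n))) *: dig (hrot G) y z x
  + ksign K ((deg z + n) * ((deg x + n) + (deg y + n))) *: dig (hrot (hrot G)) z x y = 0.

(** T stands for the contraction tri of the cubic form. *)
Variable T : A -> A -> A -> Q.
Hypothesis T1 : forall b c, lin eA (fun a => T a b c).
Hypothesis T2 : forall a c, lin eA (fun b => T a b c).
Hypothesis T3 : forall a b, lin eA (T a b).
Hypothesis T_inv : forall a1 a2 a3 v : helt A,
  hsum v (fun v1 V => hsum V (fun v2 v3 =>
     ksign K (deg v1 * (deg a2 + deg a3) + deg v2 * deg a3) *:
     T (el a1 * el v1) (el a2 * el v2) (el a3 * el v3))) =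
  counit (el v) *: T (el a1) (el a2) (el a3).

(** Multiplying all three arguments by components of v creates s(v') v'' in the first
    slot, which the antipode identity removes. *)
Lemma T_antipode (a1 a2 a3 v : helt A) :
  T (el a1 * antipode (el v)) (el a2) (el a3) =
  hsum v (fun v1 v2 => ksign K (deg v * deg a2 + deg v2 * deg a3) *:
     T (el a1) (el a2 * el v1) (el a3 * el v2)).
Proof.
rewrite -(hsum_counitr v (F := fun v => T (el a1 * antipode (el v)) (el a2) (el a3))); last by lint.
pose F (u v1 V : helt A) := hsum V (fun v2 v3 =>
    ksign K ((deg v1 + deg v2 + deg v3) * (deg a2 + deg a3) + deg v1 *
      (deg a2 + deg a3) + deg v2 * deg a3) *:
    T (el a1 * (antipode (el u) * el v1)) (el a2 * el v2) (el a3 * el v3)).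
transitivity (hsum v (fun u X => hsum X (fun v1 V => F u v1 V))).
  apply: hsum_ext => u X _.
  rewrite -(counit_sgn1 (k := deg X * (deg a2 + deg a3))); last by move=> h; parity_tauto.
  rewrite scaleC -(T_inv (hmul a1 (hs u)) a2 a3 X).
  rewrite hsum_scale; apply: hsum_ext => v1 V eX; rewrite hsum_scale; apply: hsum_ext => v2 v3 eV.
  by rewrite ksignZ /= !mulrA; congr (_ *: _); sgn.
rewrite -(hsum_coassoc v (F := F)); try by rewrite /F; lint.
transitivity (hsum v (fun P V => counit (el P) *: hsum V (fun v2 v3 =>
    ksign K ((deg v2 + deg v3) * (deg a2 + deg a3) + deg v2 * deg a3) *:
    T (el a1) (el a2 * el v2) (el a3 * el v3)))).
  apply: hsum_ext => P V _; rewrite /F.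
  pose G (w : helt A) := hsum V (fun v2 v3 =>
    ksign K ((deg v2 + deg v3) * (deg a2 + deg a3) + deg v2 * deg a3) *:
    T (el a1 * el w) (el a2 * el v2) (el a3 * el v3)).
  transitivity (hsum P (fun u v1 => G (hmul (hs u) v1))).
    by apply: hsum_ext => u v1 _; apply: hsum_ext => v2 v3 _; congr (_ *: _); sgn.
  rewrite hsum_antipodel; last by rewrite /G; lint.
  by congr (_ *: _); apply: hsum_ext => v2 v3 _; rewrite /= mulr1.
rewrite hsum_counitl; last by lint.
by apply: hsum_ext => v1 v2 e; congr (_ *: _); sgn.
Qed.

Lemma T_mul (a1 a2 a3 v : helt A) :
  T (el a1 * el v) (el a2) (el a3) =
  hsum v (fun v1 v2 => ksign K (deg v * deg a2 + deg v2 * deg a3) *: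
     T (el a1) (el a2 * antipode (el v1)) (el a3 * antipode (el v2))).
Proof.
rewrite -{1}(antipodeK A_cocomm v) (T_antipode a1 a2 a3 (hs v)) hsum_antipode; last by lint.
rewrite [RHS](hsum_cocomm v A_cocomm); last by lint.
by apply: hsum_ext => v1 v2 _; rewrite !ksignZ.
Qed.

(** The functional by which the tritensor map is tested; X and Z will be components
    split off x and z. *)
Definition theta (X Z a1 a2 a3 : helt A) : Q :=
  counit (el a2) *: (ksign K ((deg X + deg Z) * deg a1) *:
    T 1 (el a1 * antipode (el X)) (el Z * antipode (el a3))).

Lemma dig_theta X Z x y z : dig (theta X Z) x y z =
  hsum x (fun x1 x2 => hsum y (fun y1 y2 => hsum (r_ x2 y2) (fun r1 R =>
   ksign K (deg y1 * (deg x + n) + deg x1 * deg r1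
            + (deg X + deg Z) * (deg y1 + deg r1 + deg x1)) *:
   T 1 (el y1 * antipode (el r1) * (el x1 * antipode (el X)))
       (el Z * antipode (el (r_ R z)))))).
Proof.
apply: hsum_ext => x1 x2 ex; apply: hsum_ext => y1 y2 ey.
apply: (hsum_collapsel (F := fun z => hsum (r_ x2 y2) (fun r1 R =>
   ksign K (deg y1 * (deg x + n) + deg x1 * deg r1
            + (deg X + deg Z) * (deg y1 + deg r1 + deg x1)) *:
   T 1 (el y1 * antipode (el r1) * (el x1 * antipode (el X)))
       (el Z * antipode (el (r_ R z)))))); first by lint.
move=> z1 z2 ez; rewrite hsum_scale; apply: hsum_ext => r1 R er.
apply: (hsum_collapsel (F := fun R => counit (el z1) *: (
   ksign K (deg y1 * (deg x + n) + deg x1 * deg r1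
            + (deg X + deg Z) * (deg y1 + deg r1 + deg x1)) *:
   T 1 (el y1 * antipode (el r1) * (el x1 * antipode (el X)))
       (el Z * antipode (el (r_ R z2)))))); first by lint.
move=> r2 r3 eR.
apply: (hsum_collapsel (F := fun q => counit (el r2) *: (counit (el z1) *: (
   ksign K (deg y1 * (deg x + n) + deg x1 * deg r1
            + (deg X + deg Z) * (deg y1 + deg r1 + deg x1)) *:
   T 1 (el y1 * antipode (el r1) * (el x1 * antipode (el X)))
       (el Z * antipode (el q)))))); first by lint.
move=> q1 q2 eq; rewrite /theta /= !counitM counit_antipode.
rewrite scaleC ksignZ [_ * _ * _]mulrC [counit (el z1) * _]mulrC mulrA -!scalerA !mulrA.
rewrite [LHS]scaleC.
apply: counit_if => hq; apply: counit_if => hr; apply: counit_if => hz.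
by congr (_ *: _); sgn.
Qed.

(** The component under the antipode comes first here; cocommutativity puts it
    second. *)
Lemma hsum_antipoder_swap (W : lmodType K) (P : helt A)
    (F : helt A -> W) (H : helt A -> helt A -> W) :
  lin hA F ->
  (forall a b, deg P = deg a + deg b -> H a b = ksign K (deg a * deg b) *: F (hmul b (hs a))) ->
  hsum P H = counit (el P) *: F hone.
Proof.
move=> hF hH; rewrite -hsum_antipoder // [RHS](hsum_cocomm P A_cocomm); last by lint.
exact: hsum_ext.
Qed.

(** The component of x to the right of the antipode in the first factor of digamma
    cancels with s(X). *)
Lemma dig_core1 x y z :
  hsum x (fun X x' => hsum z (fun Z z' => ksign K (deg Z * (deg x' + deg y)) *:
    dig (theta X Z) x' y z')) =
  core (fun u v => T 1 (el u) (el v)) x y z.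
Proof.
rewrite hsum_exch /core [RHS]hsum_exch; apply: hsum_ext => Z z' ez.
pose H X x1 x2 := hsum y (fun y1 y2 => hsum (r_ x2 y2) (fun r1 R =>
   ksign K (deg Z * (deg x1 + deg x2 + deg y1 + deg y2)
            + deg y1 * (deg x1 + deg x2 + n) + deg x1 * deg r1
            + (deg X + deg Z) * (deg y1 + deg r1 + deg x1)) *:
   T 1 (el y1 * antipode (el r1) * (el x1 * antipode (el X)))
       (el Z * antipode (el (r_ R z'))))).
transitivity (hsum x (fun X x' => hsum x' (fun x1 x2 => H X x1 x2))).
  apply: hsum_ext => X x' _; rewrite dig_theta // hsum_scale; apply: hsum_ext => x1 x2 ex.
  rewrite hsum_scale; apply: hsum_ext => y1 y2 ey; rewrite hsum_scale; apply: hsum_ext => r1 R er.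
  by rewrite ksignZ; congr (_ *: _); sgn.
rewrite -(hsum_coassoc x (F := H)); try by rewrite /H; lint.
apply: (hsum_collapsel (F := fun x => hsum y (fun y1 y2 => hsum (r_ x y2) (fun r1 r2 =>
    ksign K (deg y1 * (deg x + n) + deg Z * (deg r2 + n)) *:
    T 1 (el (hmul y1 (hs r1))) (el (hmul Z (hs (r_ r2 z')))))))); first by lint.
move=> P x2 ex.
pose F (w : helt A) := hsum y (fun y1 y2 => hsum (r_ x2 y2) (fun r1 R =>
   ksign K (deg Z * (deg x2 + deg y1 + deg y2) + deg y1 * (deg x2 + n)
      + deg w * (deg y1 + deg r1) + deg Z * (deg y1 + deg r1)) *:
   T 1 (el y1 * antipode (el r1) * el w) (el Z * antipode (el (r_ R z'))))).
rewrite (hsum_antipoder_swap (F := F)).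
- congr (_ *: _); apply: hsum_ext => y1 y2 ey; apply: hsum_ext => r1 R er.
  by rewrite mulr1; congr (_ *: _); sgn.
- by rewrite /F; lint.
move=> X x1 eP; rewrite hsum_scale; apply: hsum_ext => y1 y2 ey.
rewrite hsum_scale; apply: hsum_ext => r1 R er.
by rewrite ksignZ; congr (_ *: _); sgn.
Qed.

Lemma dig_theta2 X Z x y z : dig (hrot (theta X Z)) y z x =
  hsum x (fun x1 x2 => hsum (r_ y z) (fun r2 r3 => hsum (r_ r3 x2) (fun q1 q2 =>
   ksign K (deg x1 * (deg y + deg z) + deg r2 * deg q1
     + deg q2 * (deg x1 + deg q1 + deg r2) + (deg X + deg Z) * deg q2
     + deg x1 * deg q1 + (deg x1 + deg q1) * deg r2) *:
   T 1 (el q2 * antipode (el X))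
       (el Z * antipode (el r2) * el q1 * antipode (el x1))))).
Proof.
pose f (r2 x1 q1 q2 y z : helt A) :=
   ksign K (deg x1 * (deg y + deg z) + deg r2 * deg q1
     + deg q2 * (deg x1 + deg q1 + deg r2) + (deg X + deg Z) * deg q2
     + deg x1 * deg q1 + (deg x1 + deg q1) * deg r2) *:
   T 1 (el q2 * antipode (el X))
       (el Z * antipode (el r2) * el q1 * antipode (el x1)).
refine (hsum_collapsel (F := fun y => hsum x (fun x1 x2 => hsum (r_ y z) (fun r2 r3 =>
    hsum (r_ r3 x2) (fun q1 q2 => f r2 x1 q1 q2 y z)))) _ _); first by rewrite /f; lint.
move=> y1 y2 ey.
apply: (hsum_collapsel (F := fun z => counit (el y1) *: hsum x (fun x1 x2 => hsum (r_ y2 z)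
  (fun r2 r3 => hsum (r_ r3 x2) (fun q1 q2 => f r2 x1 q1 q2 y2 z)))));
  first by rewrite /f; lint.
move=> z1 z2 ez; rewrite !hsum_scale; apply: hsum_ext => x1 x2 ex.
apply: (hsum_collapsel (F := fun R => counit (el z1) *: (counit (el y1) *: hsum R
  (fun r2 r3 => hsum (r_ r3 x2) (fun q1 q2 => f r2 x1 q1 q2 y2 z2)))));
  first by rewrite /f; lint.
move=> r1 R er; rewrite !hsum_scale; apply: hsum_ext => r2 r3 eR.
rewrite !hsum_scale; apply: hsum_ext => q1 q2 eq.
rewrite /hrot /theta /f /= !counitM counit_antipode.
rewrite (antipode_mul (hmul x1 (hs q1)) r2) /= (antipode_mul x1 (hs q1)) /=.
rewrite (antipodeK A_cocomm) -!scalerAr !(linZ _ _ (T3 _ _)) !mulrA.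
rewrite -!scalerA !(scaleC (ksign _ _) (counit _)) [LHS](scaleC (counit (el z1))).
apply: counit_if => hr; apply: counit_if => hz; apply: counit_if => hy.
by rewrite !ksignZ; congr (_ *: _); sgn.
Qed.

(** Invariance moves the antipode of the first slot x' s(ρ(ρ(y, z'')'', x'')) of the
    form to the two other slots, and then x' as well. *)
Lemma dig_core2 x y z :
  hsum x (fun X x' => hsum z (fun Z z' => ksign K (deg Z * (deg x' + deg y)
      + (deg x' + n) * ((deg y + n) + (deg z' + n))) *:
    dig (hrot (theta X Z)) y z' x')) =
  ksign K ((deg x + n) * ((deg y + n) + (deg z + n))) *:
  core (fun u v => ksign K (deg u * deg v) *: T (el v) 1 (el u)) y z x.
Proof.
rewrite hsum_exch /core hsum_scale; apply: hsum_ext => Z z' ez.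
pose H X x1 x2 := hsum (r_ y z') (fun r2 r3 => hsum (r_ r3 x2) (fun q1 q2 =>
   ksign K (deg Z * (deg x1 + deg x2 + deg y)
      + (deg x1 + deg x2 + n) * ((deg y + n) + (deg z' + n))
     + deg x1 * (deg y + deg z') + deg r2 * deg q1
     + deg q2 * (deg x1 + deg q1 + deg r2) + (deg X + deg Z) * deg q2
     + deg x1 * deg q1 + (deg x1 + deg q1) * deg r2) *:
   T 1 (el q2 * antipode (el X))
       (el Z * antipode (el r2) * el q1 * antipode (el x1)))).
transitivity (hsum x (fun X x' => hsum x' (fun x1 x2 => H X x1 x2))).
  apply: hsum_ext => X x' _; rewrite dig_theta2 // hsum_scale; apply: hsum_ext => x1 x2 ex.
  rewrite hsum_scale; apply: hsum_ext => r2 r3 er; rewrite hsum_scale; apply: hsum_ext => q1 q2 eq.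
  by rewrite ksignZ; congr (_ *: _); sgn.
rewrite -(hsum_coassoc x (F := H)); try by rewrite /H; lint.
rewrite hsum_scale; apply: hsum_ext => P x2 ex.
rewrite /H hsum_exch hsum_scale; apply: hsum_ext => r2 r3 er; rewrite hsum_exch.
pose q := r_ r3 x2.
have -> : T (el (hmul P (hs q))) 1 (el (hmul Z (hs r2))) =
    hsum q (fun q1 q2 => ksign K (deg q1 * deg q2) *: (ksign K (deg q1 * (deg Z + deg r2)) *:
     T (el P) (el q2) (el Z * antipode (el r2) * el q1))).
  rewrite (T_antipode P hone (hmul Z (hs r2)) q).
  rewrite (hsum_cocomm q A_cocomm); last by lint.
  by apply: hsum_ext => a b _; rewrite /= mulr0 add0r mul1r.
rewrite !hsum_scale; apply: hsum_ext => q1 q2 eq.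
have := T_mul hone q2 (hmul (hmul Z (hs r2)) q1) P.
rewrite /= mul1r => ->.
rewrite !hsum_scale; apply: hsum_ext => X x1 eP.
by rewrite !ksignZ; congr (_ *: _); sgn.
Qed.

Lemma dig_theta3 X Z x y z : dig (hrot (hrot (theta X Z))) z x y =
  hsum z (fun z1 z2 => hsum x (fun x1 x2 => hsum y (fun y1 y2 =>
  hsum (r_ z2 x2) (fun r1 R => hsum R (fun r2 r3 =>
   ksign K (deg x1 * (deg z + n) + deg y1 * (deg z2 + deg x2)
     + (deg z1 + deg y1) * deg r1 + deg r2 * (deg r3 + deg y2 + n)
     + (deg y1 + (deg r3 + deg y2 + n) + deg r2) * (deg x1 + deg r1 + deg z1)
     + (deg X + deg Z) * (deg y1 + (deg r3 + deg y2 + n) + deg r2)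
     + deg x1 * deg r1 + (deg x1 + deg r1) * deg z1) *:
   T 1 (el y1 * antipode (el (r_ r3 y2)) * el r2 * antipode (el X))
       (el Z * antipode (el z1) * el r1 * antipode (el x1))))))).
Proof.
apply: hsum_ext => z1 z2 ez; apply: hsum_ext => x1 x2 ex; apply: hsum_ext => y1 y2 ey.
apply: hsum_ext => r1 R er; apply: hsum_ext => r2 r3 eR.
refine (hsum_collapser (F := fun q => ksign K (deg x1 * (deg z + n)
     + deg y1 * (deg z2 + deg x2)
     + (deg z1 + deg y1) * deg r1 + deg r2 * (deg r3 + deg y2 + n)
     + (deg y1 + (deg r3 + deg y2 + n) + deg r2) * (deg x1 + deg r1 + deg z1)
     + (deg X + deg Z) * (deg y1 + (deg r3 + deg y2 + n) + deg r2)
     + deg x1 * deg r1 + (deg x1 + deg r1) * deg z1) *: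
   T 1 (el y1 * antipode (el q) * el r2 * antipode (el X))
       (el Z * antipode (el z1) * el r1 * antipode (el x1))) _ _); first by lint.
move=> q1 q2 eq; rewrite /hrot /theta /=.
rewrite (antipode_mul (hmul x1 (hs r1)) z1) /= (antipode_mul x1 (hs r1)) /=.
rewrite (antipodeK A_cocomm) -!scalerAr !(linZ _ _ (T3 _ _)) !mulrA.
rewrite !(scaleC (ksign _ _) (counit _)); apply: counit_if => hq.
by rewrite !ksignZ; congr (_ *: _); sgn.
Qed.

(** The product Z s(z') cancels; invariance then brings the component of x and the
    first component of ρ(z, x'') to the first slot. *)
Lemma dig_core3 x y z :
  hsum x (fun X x' => hsum z (fun Z z' => ksign K (deg Z * (deg x' + deg y)
      + (deg z' + n) * ((deg x' + n) + (deg y + n))) *: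
    dig (hrot (hrot (theta X Z))) z' x' y)) =
  ksign K ((deg z + n) * ((deg x + n) + (deg y + n))) *:
  core (fun u v => T (el u) (el v) 1) z x y.
Proof.
pose sg (X x1 x2 y1 y2 z2 r1 r2 r3 : helt A) (w : int) : int :=
   w * (deg x1 + deg x2 + deg y1 + deg y2 + deg y1 + (deg r3 + deg y2 + n) + deg r2)
   + (deg z2 + n) * (deg x1 + deg x2 + deg y1 + deg y2)
   + deg x1 * (deg z2 + n) + deg y1 * (deg z2 + deg x2) + deg y1 * deg r1
   + deg r2 * (deg r3 + deg y2 + n)
   + (deg y1 + (deg r3 + deg y2 + n) + deg r2) * (deg x1 + deg r1)
   + deg X * (deg y1 + (deg r3 + deg y2 + n) + deg r2) + deg x1 * deg r1.
pose F (X x1 x2 z2 w : helt A) := hsum y (fun y1 y2 =>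
  hsum (r_ z2 x2) (fun r1 R => hsum R (fun r2 r3 =>
   ksign K (sg X x1 x2 y1 y2 z2 r1 r2 r3 (deg w)) *:
   T 1 (el y1 * antipode (el (r_ r3 y2)) * el r2 * antipode (el X))
       (el w * el r1 * antipode (el x1))))).
transitivity (hsum x (fun X x' => hsum x' (fun x1 x2 => F X x1 x2 z hone))).
  apply: hsum_ext => X x' _.
  pose H Z z1 z2 := hsum x' (fun x1 x2 => F X x1 x2 z2 (hmul Z (hs z1))).
  transitivity (hsum z (fun Z z' => hsum z' (fun z1 z2 => H Z z1 z2))).
    apply: hsum_ext => Z z' _; rewrite dig_theta3 hsum_scale; apply: hsum_ext => z1 z2 ez.
    rewrite hsum_scale; apply: hsum_ext => x1 x2 ex.
    rewrite hsum_scale; apply: hsum_ext => y1 y2 ey.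
    rewrite hsum_scale; apply: hsum_ext => r1 R er.
    rewrite hsum_scale; apply: hsum_ext => r2 r3 eR.
    by rewrite ksignZ; congr (_ *: _); rewrite /sg; sgn.
  rewrite -(hsum_coassoc z (F := H)); try by rewrite /H /F /sg; lint.
  refine (hsum_collapsel (F := fun z => hsum x' (fun x1 x2 => F X x1 x2 z hone)) _ _).
    by rewrite /F /sg; lint.
  move=> P z2 ez; rewrite /H.
  rewrite -(hsum_antipoder P (F := fun w => hsum x' (fun x1 x2 => F X x1 x2 z2 w))) //.
  by rewrite /F /sg; lint.
rewrite -(hsum_coassoc x (F := fun X x1 x2 => F X x1 x2 z hone)); try by rewrite /F /sg; lint.
rewrite /core hsum_scale; apply: hsum_ext => P x2 ex.
rewrite /F hsum_exch hsum_scale; apply: hsum_ext => y1 y2 ey.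
pose G (V r3 : helt A) : Q :=
  ksign K ((deg z + n) * ((deg x + n) + (deg y + n)) +
    (deg P * (deg z + n) + deg y1 * (deg r3 + n))) *:
  T (el P * antipode (el V)) (el y1 * antipode (el (r_ r3 y2))) 1.
transitivity (hsum (r_ z x2) G); last first.
  by rewrite hsum_scale; apply: hsum_ext => V r3 _; rewrite ksignZ.
pose L (r1 r2 r3 : helt A) := ksign K ((deg z + n) * ((deg x + n) + (deg y + n)) +
    (deg P * (deg z + n) + deg y1 * (deg r3 + n)) +
    (deg r1 + deg r2) * (deg y1 + (deg r3 + deg y2 + n)) + deg r2 * deg r1) *:
  T (el P) (el y1 * antipode (el (r_ r3 y2)) * el r2) (el r1).
transitivity (hsum (r_ z x2) (fun r1 R => hsum R (fun r2 r3 => L r1 r2 r3))).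
  rewrite hsum_exch; apply: hsum_ext => r1 R er; rewrite hsum_exch; apply: hsum_ext => r2 r3 eR.
  rewrite /L.
  have := T_mul hone (hmul (hmul y1 (hs (r_ r3 y2))) r2) r1 P.
  rewrite /= mul1r => ->; rewrite hsum_scale; apply: hsum_ext => X x1 eP.
  by rewrite !ksignZ mul1r; congr (_ *: _); rewrite /sg; sgn.
rewrite -(hsum_coassoc (r_ z x2) (F := L)); try by rewrite /L; lint.
apply: hsum_ext => V r3 er; rewrite /G.
have := T_antipode P (hmul y1 (hs (r_ r3 y2))) hone V.
rewrite /= => ->; rewrite hsum_scale (hsum_cocomm V A_cocomm); last by rewrite /L; lint.
apply: hsum_ext => r2 r1 eV; rewrite /L !ksignZ mul1r.
by congr (_ *: _); sgn.
Qed.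
End FoxCore.

Lemma finv_eq (X Y : Type) (x0 : X) (f : X -> Y) x y :
  injective f -> f x = y -> Defs.finv x0 f y = x.
Proof.
move=> fI fx; rewrite /Defs.finv; case: pselect => [e|]; last by case; exists x.
by apply: fI; rewrite (projT2 (cid e)).
Qed.

(** * The tritensor map *)

Section Tritensor.
Variables (K : comNzRingType) (A : gradedHopfType K).
Notation hA := (@helin K A).
Notation eA := (@elin K A).

(** The linear map on the triple tensor product defined by a trilinear G. *)
Definition hsum3 (Q : lmodType K) (G : helt A -> helt A -> helt A -> Q)
    (T : tensor3 A) : Q :=
  \sum_(u <- hterms3 T) G u.1.1 u.1.2 u.2.

Definition trilin (Q : lmodType K) (G : helt A -> helt A -> helt A -> Q) : Prop :=
  [/\ forall b c, lin hA (fun a => G a b c), forall a c, lin hA (fun b => G a b c)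
    & forall a b, lin hA (G a b)].

Definition pure3 (x y z : helt A) : tensor3 A := el x ⊗ el y ⊗ el z.

Section Hsum3.
Variables (Q : lmodType K) (G : helt A -> helt A -> helt A -> Q).
Hypothesis G3 : trilin G.

Let g (x : A) (U : tensor A A) : Q :=
  \sum_(a <- hdec x) \sum_(v <- hterms U) G a v.1 v.2.

Let G2 a : lin2 hA hA (G a).
Proof. by case: G3 => _ h2 h3; split. Qed.

Let g2 : lin2 eA (@elin K _) g.
Proof.
split=> [U|x]; last by apply: lin_sum => a; apply: hterms_lin.
apply: (hdec_lin (F := fun a => \sum_(v <- hterms U) G a v.1 v.2)).
by apply: lin_sum => v; case: G3.
Qed.

Lemma hsum3E T : hsum3 G T = \sum_(u <- terms T) g u.1 u.2.
Proof.
rewrite /hsum3 /hterms3 big_flatten big_map; apply: eq_bigr => u _.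
by rewrite big_allpairs_dep.
Qed.

Lemma hsum3_lin : lin (@elin K (tensor3 A)) (hsum3 G).
Proof. by move=> k S T U /(terms_lin g2); rewrite -!hsum3E. Qed.

Lemma hsum3_pure x y z : hsum3 G (pure3 x y z) = G x y z.
Proof.
rewrite hsum3E (terms_pure g2) /g.
under eq_bigr => a _ do rewrite (hterms_pure (G2 a)).
by rewrite (hdec_el (F := fun a => G a y z)) //; case: G3.
Qed.
End Hsum3.

Lemma pure3_tri : trilin pure3.
Proof.
have [h1 h2] := tpure_bilinear A A; have [h3 h4] := tpure_bilinear A (tensor A A).
split=> [b c|a c|a b].
- exact: (lin_app (h3 _) (@lin_el _ _)).
- apply: (lin_app (h4 _)); exact: (lin_app (h1 _) (@lin_el _ _)).
- apply: (lin_app (h4 _)); exact: (lin_app (h2 _) (@lin_el _ _)).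
Qed.

(** Pure tensors of homogeneous elements span. *)
Lemma tensor3_ext (Q : lmodType K) (f g : tensor3 A -> Q) T :
  lin (@elin K _) f -> lin (@elin K _) g ->
  (forall x y z, f (pure3 x y z) = g (pure3 x y z)) -> f T = g T.
Proof.
move=> hf hg fg.
have [h1 h2] := tpure_bilinear A A; have [h3 h4] := tpure_bilinear A (tensor A A).
have l1 (b : A) : lin eA (fun a : A => a ⊗ b) by move=> k x y z ->; apply: (h1 b).
have l2 (a : A) : lin eA (fun b : A => a ⊗ b) by move=> k x y z ->; apply: (h2 a).
have l3 (b : tensor A A) : lin eA (fun a : A => a ⊗ b) by move=> k x y z ->; apply: (h3 b).
have l4 (a : A) : lin (@elin K _) (fun b : tensor A A => a ⊗ b) by move=> k x y z ->; apply: (h4 a).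
rewrite (termsE T) (linsum _ _ _ hf) (linsum _ _ _ hg); apply: eq_bigr => u _.
rewrite (termsE u.2) !(linsum _ _ _ (l4 _)) (linsum _ _ _ hf) (linsum _ _ _ hg).
apply: eq_bigr => v _; rewrite (hdecE u.1) (linsum _ _ _ (l3 _)).
rewrite (linsum _ _ _ hf) (linsum _ _ _ hg); apply: eq_bigr => a _.
rewrite (hdecE v.1) (linsum _ _ _ (l1 _)) (linsum _ _ _ (l4 _)).
rewrite (linsum _ _ _ hf) (linsum _ _ _ hg); apply: eq_bigr => b _.
rewrite (hdecE v.2) (linsum _ _ _ (l2 _)) (linsum _ _ _ (l4 _)).
by rewrite (linsum _ _ _ hf) (linsum _ _ _ hg); apply: eq_bigr => c _; apply: fg.
Qed.

Lemma hrot_tri (Q : lmodType K) (G : helt A -> helt A -> helt A -> Q) :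
  trilin G -> trilin (hrot G).
Proof. by case=> h1 h2 h3; split=> ? ?; rewrite /hrot; apply: lin_scale => //; degc. Qed.

Section P312.
Variable m : int.

Let G (a b c : helt A) : tensor3 A :=
  ksign K ((deg c + m) * (deg a + m) + (deg c + m) * (deg b + m)) *: pure3 c a b.

Let G3 : trilin G.
Proof.
by case: pure3_tri => h1 h2 h3; split=> ? ?; rewrite /G; apply: lin_scale => //; degc.
Qed.

Let PE (T : tensor3 A) : P312 m T = hsum3 G T.
Proof. by apply: eq_bigr => -[[a b] c] _. Qed.

Lemma P312_lin : lin (@elin K (tensor3 A)) (@P312 K A m).
Proof. by move=> k S T U; rewrite !PE; apply: hsum3_lin. Qed.

Lemma P312_pure (a b c : helt A) : P312 m (pure3 a b c) =
  ksign K ((deg c + m) * (deg a + m) + (deg c + m) * (deg b + m)) *: pure3 c a b.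
Proof. by rewrite PE hsum3_pure. Qed.

(** The inverse of P_312 is therefore its square, a linear map. *)
Lemma P312_cube (T : tensor3 A) : P312 m (P312 m (P312 m T)) = T.
Proof.
have Pl := P312_lin.
apply: (tensor3_ext (f := fun T => P312 m (P312 m (P312 m T)))) => [||x y z].
- exact: (lin_appe Pl (lin_appe Pl Pl)).
- exact: lin_id.
rewrite P312_pure !(linZ _ _ Pl) P312_pure !(linZ _ _ Pl) P312_pure !ksignZ.
by rewrite (@ksign_parity _ _ 0) ?ksign0 ?scale1r //; parity_tauto.
Qed.

Lemma P312_inj : injective (@P312 K A m).
Proof. by move=> S T e; rewrite -(P312_cube S) e P312_cube. Qed.

Lemma finv_P312 (a b c : helt A) : Defs.finv 0 (P312 m) (pure3 a b c) =
  ksign K ((deg a + m) * ((deg b + m) + (deg c + m))) *: pure3 b c a.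
Proof.
apply: (finv_eq _ P312_inj).
rewrite (linZ _ _ P312_lin) P312_pure ksignZ.
by rewrite (@ksign_parity _ _ 0) ?ksign0 ?scale1r //; parity_tauto.
Qed.

Lemma finv_P312_lin : lin (@elin K (tensor3 A)) (Defs.finv 0 (@P312 K A m)).
Proof.
have inv (T : tensor3 A) : Defs.finv 0 (P312 m) T = P312 m (P312 m T).
  by apply: (finv_eq _ P312_inj); rewrite P312_cube.
by move=> k S T U; rewrite !inv; apply: (lin_appe P312_lin P312_lin).
Qed.
End P312.

Lemma hsum3_P312 (Q : lmodType K) (G : helt A -> helt A -> helt A -> Q) T :
  trilin G -> hsum3 G (P312 0 T) = hsum3 (hrot G) T.
Proof.
move=> G3; have G3' := hrot_tri G3.
apply: (tensor3_ext (f := fun T => hsum3 G (P312 0 T))) => [||x y z].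
- exact: (lin_appe (hsum3_lin G3) (P312_lin 0)).
- exact: hsum3_lin.
rewrite P312_pure (linZ _ _ (hsum3_lin G3)) !hsum3_pure // /hrot !addr0.
by congr (_ *: _); sgn.
Qed.

Variables (n : int) (rho : A -> A -> A).
Hypothesis rho2 : is_bilinear rho.
Hypothesis rho_homog : forall p q x y, homog p x -> homog q y -> homog (p + q + n) (rho x y).
Notation r_ := (hrho rho_homog).

Ltac lint_ext lint ::= lazymatch goal with
  | |- @hmorph _ _ _ _ (fun x => r_ (@?lg x) (@?lh x)) =>
      tryif depends lg then refine (@hmorph_rhol _ _ _ _ rho2 _ _ _ lg _ _)
      else refine (@hmorph_rhor _ _ _ _ rho2 _ _ _ lh _ _); lint
  | |- @hmorph _ _ _ _ (r_ _) => refine (hmorph_rhor rho2 _ _ _); lint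
  | |- @lin _ _ _ _ (fun x => pure3 (@?lg x) (@?lh x) (@?lk x)) =>
      let h := fresh in case: pure3_tri => ? ? ?;
      tryif depends lg then match goal with H : forall b c, lin _ (fun a => pure3 a b c) |- _ =>
        refine (lin_apph (F:=lg) (H _ _) _) end
      else tryif depends lh then match goal with H : forall a c, lin _ (fun b =>
        pure3 a b c) |- _ =>
         refine (lin_apph (F:=lh) (H _ _) _) end
      else match goal with H : forall a b, lin _ (pure3 a b) |- _ =>
         refine (lin_apph (F:=lk) (H _ _) _) end; lint
  end.

Lemma digamma_homogE x y z :
  digamma_homog n rho x y z = dig rho_homog pure3 x y z.
Proof.
rewrite /digamma_homog /dig -hsum_sw2; last by lint.
apply: eq_bigr => -[x1 x2] _; rewrite -hsum_sw2; last by lint.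
apply: eq_bigr => -[y1 y2] _; rewrite -hsum_sw2; last by lint.
apply: eq_bigr => -[z1 z2] _.
rewrite /sw3 big_allpairs_dep -hsum_sw2; last by lint.
apply: eq_bigr => -[r1 R] _; rewrite -hsum_sw2; last by lint.
apply: eq_bigr => -[r2 r3] _; rewrite -hsum_sw2; last by lint.
by apply: eq_bigr => -[q1 q2] _.
Qed.

Lemma dig_pure_tri : trilin (dig rho_homog pure3).
Proof. by split=> ? ?; rewrite /dig; lint. Qed.

Lemma dig_app (Q : lmodType K) (G : helt A -> helt A -> helt A -> Q) x y z :
  trilin G -> hsum3 G (dig rho_homog pure3 x y z) = dig rho_homog G x y z.
Proof.
move=> G3; have hG := hsum3_lin G3; rewrite /dig.
do 6!(rewrite (hsum_app _ _ hG); apply: hsum_ext => ? ? _).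
by rewrite (linZ _ _ hG) hsum3_pure.
Qed.

(** The three summands of the tritensor map, in the order of the powers of P_312,
    give the three terms. *)
Lemma gerstenhaber_dig (Q : lmodType K) (G : helt A -> helt A -> helt A -> Q) :
  gerstenhaber_fox n rho -> trilin G -> dig_cyclic rho_homog G.
Proof.
move=> hG G3 x y z.
have DE T : digamma n rho T = hsum3 (dig rho_homog pure3) T.
  by apply: eq_bigr => -[[a b] c] _; apply: digamma_homogE.
have Dl : lin (@elin K (tensor3 A)) (@digamma K A n rho).
  by move=> k S T U e; rewrite !DE; apply: (hsum3_lin dig_pure_tri).
have := congr1 (hsum3 G) (hG (pure3 x y z)).
have Gl := hsum3_lin G3; have G3' := hrot_tri G3; have G3'' := hrot_tri G3'.
rewrite /tritensor (lin0 Gl) 3!big_ord_recl big_ord0 addr0 /=.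
rewrite !(linD Gl) !hsum3_P312 // !finv_P312 !(linZ _ _ (finv_P312_lin n)) !finv_P312.
rewrite !(linZ _ _ Dl) !DE !(hsum3_pure dig_pure_tri).
rewrite !(linZ _ _ (hsum3_lin G3')) !(linZ _ _ (hsum3_lin G3'')) !dig_app //.
rewrite ksignZ addrA => <-; by congr (_ + _ *: _ + _ *: _); sgn.
Qed.

Ltac lint_ext lint ::= lint_trilin lint.

(** The tritensor map is tested against theta, for all components X of x and Z of z. *)
Lemma core_cyclic (Q : lmodType K) (T : A -> A -> A -> Q) :
  cocommutative A ->
  (forall b c, lin eA (fun a => T a b c)) -> (forall a c, lin eA (fun b => T a b c)) ->
  (forall a b, lin eA (T a b)) ->
  (forall a1 a2 a3 v : helt A,
    hsum v (fun v1 V => hsum V (fun v2 v3 =>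
     ksign K (deg v1 * (deg a2 + deg a3) + deg v2 * deg a3) *:
     T (el a1 * el v1) (el a2 * el v2) (el a3 * el v3))) =
    counit (el v) *: T (el a1) (el a2) (el a3)) ->
  gerstenhaber_fox n rho -> forall x y z,
  core rho_homog (fun u v => T 1 (el u) (el v)) x y z
  + ksign K ((deg x + n) * ((deg y + n) + (deg z + n))) *:
    core rho_homog (fun u v => ksign K (deg u * deg v) *: T (el v) 1 (el u)) y z x
  + ksign K ((deg z + n) * ((deg x + n) + (deg y + n))) *:
    core rho_homog (fun u v => T (el u) (el v) 1) z x y = 0.
Proof.
move=> A_cocomm T1 T2 T3 T_inv hG x y z.
rewrite -(dig_core1 A_cocomm rho2) // -(dig_core2 A_cocomm rho2) // -(dig_core3 A_cocomm rho2) //.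
have theta3 X Z : trilin (theta T X Z).
  split=> ? ?; rewrite /theta /=.
  - lint.
  - lint.
  - lint.
rewrite !hsum_add {1}/hsum big1 // => -[X x'] _; rewrite !hsum_add {1}/hsum big1 // => -[Z z'] _.
rewrite -!ksignZ -!scalerDr [X in _ *: X](_ : _ = 0) ?scaler0 //.
exact: gerstenhaber_dig.
Qed.
End Tritensor.

(** * The coadjoint coaction *)

Definition lin3 (K : comNzRingType) (V W : lmodType K) (f : V -> V -> V -> W) : Prop :=
  [/\ forall b c, lin (@elin K V) (fun a => f a b c),
      forall a c, lin (@elin K V) (fun b => f a b c)
    & forall a b, lin (@elin K V) (f a b)].

Section Coadjoint.
Variables (K : comNzRingType) (B : gradedHopfType K).
Hypothesis B_ungraded : ungraded B.
Hypothesis B_comm : graded_commutative B.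
Notation eB := (@elin K B).
Notation s := (@antipode K B).

Ltac lint_ext lint ::= match goal with
  | H : lin3 ?lf |- @lin _ _ _ _ (fun x => ?lf (@?lg x) (@?lh x) (@?lk x)) =>
      case: (H) => ? ? ?;
      tryif depends lg then match goal with H' : forall b c, lin _ (fun a => lf a b c) |- _ =>
        first [ exact: H' | refine (lin_appe (F:=lg) (H' _ _) _) ] end
      else tryif depends lh then match goal with H' : forall a c, lin _ (fun b => lf a b c) |- _ =>
        first [ exact: H' | refine (lin_appe (F:=lh) (H' _ _) _) ] end
      else match goal with H' : forall a b, lin _ (lf a b) |- _ =>
         first [ exact: H' | refine (lin_appe (F:=lk) (H' _ _) _) ] end; lint
  | H : lin3 ?lf |- @lin _ _ _ _ (?lf _ _) => case: (H) => ? ? ?; solve [auto]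
  end.

Definition hb (b : B) : helt B := HElt (B_ungraded b).

Lemma ungraded_deg (u : helt B) : deg u = 0 \/ el u = 0.
Proof.
have [->|u0] := eqVneq (deg u) 0; [by left | right].
pose f p := if p == 0 then - el u else if p == deg u then el u else 0.
have hf q : homog q (f q).
  rewrite /f; case: eqP => [->|_]; first exact: B_ungraded.
  by case: eqP => [->|_]; [apply: elP | apply: homog0].
have := @homog_indep _ _ [:: 0; deg u] f; rewrite /= inE eq_sym u0 => /(_ isT hf).
rewrite !big_cons big_nil /f eqxx (negbTE u0) eqxx addr0 addNr.
by move=> /(_ erefl (deg u)); rewrite !inE eqxx orbT (negbTE u0) => ->.
Qed.

Lemma mulBC (b c : B) : b * c = c * b.
Proof. by rewrite (B_comm (B_ungraded b) (B_ungraded c)) mulr0 ksign0 scale1r. Qed.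

Lemma antipodeM (b c : B) : s (b * c) = s b * s c.
Proof.
by rewrite (antipode_mul (hb b) (hb c)) /= mulr0 ksign0 scale1r mulBC.
Qed.

Section W.
Variable W : lmodType K.
Implicit Types (b c : B) (f : B -> B -> W).

Lemma csum_mul b c f : lin2 eB eB f ->
  csum (b * c) f = csum b (fun b1 b2 => csum c (fun c1 c2 => f (b1 * c1) (b2 * c2))).
Proof.
move=> f2; rewrite -(hsum_csum_el (hmul (hb b) (hb c)) f2) hsum_mul; last by lint.
rewrite -(hsum_csum_el (hb b) (f := fun b1 b2 => csum c (fun c1 c2 => f (b1 * c1) (b2 * c2))));
  last by lint.
apply: hsum_ext => b1 b2 _; rewrite -(hsum_csum_el (hb c) (f := fun c1 c2 =>
  f (el b1 * c1) (el b2 * c2))); last by lint.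
apply: hsum_ext => c1 c2 _ /=; have [->|->] := ungraded_deg b2.
  by rewrite mul0r ksign0 scale1r.
by rewrite mul0r (lin0 (f2.2 _)) scaler0.
Qed.

Lemma csum_antipode b f : lin2 eB eB f -> csum (s b) f = csum b (fun b1 b2 => f (s b2) (s b1)).
Proof.
move=> f2; rewrite -(hsum_csum_el (hs (hb b)) f2) hsum_antipode; last by lint.
rewrite -(hsum_csum_el (hb b) (f := fun b1 b2 => f (s b2) (s b1))); last by lint.
apply: hsum_ext => b1 b2 _ /=; have [->|->] := ungraded_deg b1.
  by rewrite mul0r ksign0 scale1r.
by rewrite raddf0 (lin0 (f2.2 _)) scaler0.
Qed.

(** The terms b'' ⊗ b' s(b''') of the coadjoint coaction. *)
Definition ad b : seq (B * B) :=
  [seq (v.1, u.1 * s v.2) | u <- terms (comul b), v <- terms (comul u.2)].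

Definition adsum b f : W := \sum_(w <- ad b) f w.1 w.2.

Lemma adsumE b f : adsum b f = csum b (fun b1 y => csum y (fun b2 b3 => f b2 (b1 * s b3))).
Proof. by rewrite /adsum big_allpairs_dep. Qed.

Lemma adsum_lin f : lin2 eB eB f -> lin eB (fun b => adsum b f).
Proof.
move=> f2 k x y z e; rewrite !adsumE; move: k x y z e.
suff: lin eB (fun b => csum b (fun b1 y => csum y (fun b2 b3 => f b2 (b1 * s b3)))) by [].
by lint.
Qed.

Lemma lin_adsum_body (E : Type) (D : K -> E -> E -> E -> Prop) b (f : E -> B -> B -> W) :
  (forall u v, lin D (fun x => f x u v)) -> lin D (fun x => adsum b (f x)).
Proof. by move=> h; apply: lin_sum => i; apply: h. Qed.

Lemma adsum_ext b f g : (forall u e, f u e = g u e) -> adsum b f = adsum b g.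
Proof. by move=> h; apply: eq_bigr => w _; apply: h. Qed.

Lemma adsum_exch b c (f : B -> B -> B -> B -> W) :
  adsum b (fun u e => adsum c (f u e)) = adsum c (fun v e' => adsum b (fun u e => f u e v e')).
Proof. exact: exchange_big. Qed.

(** Coassociativity of the coaction; the antipode reverses the comultiplication
    of b''', so that the conjugations nest. *)
Lemma adsum_coaction b (f : B -> B -> B -> W) : lin3 f ->
  adsum b (fun u e => adsum u (fun w e' => f w e e')) =
  adsum b (fun u e => csum e (fun e1 e2 => f u e1 e2)).
Proof.
move=> f3.
pose g b1 b2 b3 b4 b5 := f b3 (b1 * s b5) (b2 * s b4).
transitivity (csum b (fun b1 y1 => csum y1 (fun b2 y2 => csum y2 (fun b3 y3 => csum y3 (fun b4 b5 =>
   g b1 b2 b3 b4 b5))))).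
  rewrite adsumE; apply: csum_ext => b1 y.
  transitivity (csum y (fun b2 b3 => csum b2 (fun w1 v => csum v (fun w2 w3 => g b1 w1 w2 w3 b3)))).
    by apply: csum_ext => b2 b3; rewrite adsumE.
  rewrite (csum_coassoc y (f := fun w1 v b3 => csum v (fun w2 w3 => g b1 w1 w2 w3 b3)));
    try by rewrite /g; lint.
  apply: csum_ext => w1 y'; rewrite (csum_coassoc y' (f := fun w2 w3 b3 => g b1 w1 w2 w3 b3)) //;
    by rewrite /g; lint.
rewrite adsumE; transitivity (csum b (fun b1 y => csum b1 (fun p p' => csum y (fun b2 b3 =>
  csum b3 (fun q q' =>
   g p p' b2 q q'))))); last first.
  apply: csum_ext => b1 y; rewrite csum_exch; apply: csum_ext => b2 b3.
  rewrite csum_mul; last by lint.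
  apply: csum_ext => p p'; rewrite csum_antipode //; by lint.
by rewrite (csum_coassoc b (f := fun p p' y => csum y (fun b2 b3 => csum b3 (fun q q' =>
   g p p' b2 q q')))) //; rewrite /g; lint.
Qed.

Lemma adsum_counit b (f : B -> W) : lin eB f ->
  adsum b (fun u e => counit e *: f u) = f b.
Proof.
move=> fl; rewrite adsumE -[RHS]csum_counitl //; apply: csum_ext => b1 y.
rewrite -[f y](csum_counitr y) //; rewrite /csum scaler_sumr; apply: eq_bigr => w _.
by rewrite counitM counit_antipode scalerA.
Qed.

Lemma adsum_counitl b (f : B -> W) : lin eB f ->
  adsum b (fun u e => counit u *: f e) = counit b *: f 1.
Proof.
move=> fl; rewrite adsumE -csum_antipoder //; apply: csum_ext => b1 y.
by rewrite (csum_counitl y (f := fun b3 => f (b1 * s b3))) //; lint.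
Qed.

(** The last factor s(b''') of the coefficient cancels with the component that
    multiplies it on the right. *)
Lemma adsum_translate b f : lin2 eB eB f ->
  csum b (fun b1 b2 => adsum b1 (fun u e => f u (e * b2))) = csum b (fun b1 b2 => f b2 b1).
Proof.
move=> f2.
transitivity (csum b (fun b1 b2 => csum b1 (fun p1 y => csum y (fun p2 p3 =>
  f p2 (p1 * (s p3 * b2)))))).
  by apply: csum_ext => b1 b2; rewrite adsumE; do 2!(apply: csum_ext => ? ?); rewrite mulrA.
rewrite (csum_coassoc b (f := fun p1 y b2 => csum y (fun p2 p3 => f p2 (p1 * (s p3 * b2)))));
  try by lint.
apply: csum_ext => p1 y.
rewrite (csum_coassoc y (f := fun p2 p3 b2 => f p2 (p1 * (s p3 * b2)))); try by lint.
rewrite -[RHS](csum_counitr y (f := fun z => f z p1)); last by lint.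
apply: csum_ext => p2 y'; rewrite (csum_antipodel y' (f := fun z => f p2 (p1 * z))); last by lint.
by rewrite mulr1.
Qed.

(** The coaction is compatible with the comultiplication: the inner factors
    s(b^(3)) b^(4) cancel. *)
Lemma adsum_comul b (f : B -> B -> B -> W) : lin3 f ->
  csum b (fun b1 b2 => adsum b1 (fun u e => adsum b2 (fun v e' => f u v (e * e')))) =
  adsum b (fun u e => csum u (fun u1 u2 => f u1 u2 e)).
Proof.
move=> f3.
transitivity (csum b (fun b1 b2 => csum b1 (fun p1 y => csum y (fun p2 p3 => csum b2 (fun q1 z =>
   csum z (fun q2 q3 => f p2 q2 (p1 * (s p3 * q1 * s q3)))))))).
  apply: csum_ext => b1 b2; rewrite adsumE; do 2!(apply: csum_ext => ? ?).
  by rewrite adsumE; do 2!(apply: csum_ext => ? ?); rewrite !mulrA.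
rewrite (csum_coassoc b (f := fun p1 y b2 => csum y (fun p2 p3 => csum b2 (fun q1 z =>
   csum z (fun q2 q3 => f p2 q2 (p1 * (s p3 * q1 * s q3))))))); try by lint.
rewrite adsumE; apply: csum_ext => p1 b'.
rewrite (csum_coassoc b' (f := fun p2 p3 b2 => csum b2 (fun q1 z =>
   csum z (fun q2 q3 => f p2 q2 (p1 * (s p3 * q1 * s q3)))))); try by lint.
rewrite [RHS](csum_coassoc b' (f := fun u1 u2 q3 => f u1 u2 (p1 * s q3))); try by lint.
apply: csum_ext => p2 b''.
rewrite -(csum_coassoc b'' (f := fun p3 q1 z => csum z (fun q2 q3 =>
  f p2 q2 (p1 * (s p3 * q1 * s q3)))));
  try by lint.
rewrite -[RHS](csum_counitl b'' (f := fun z => csum z (fun q2 q3 => f p2 q2 (p1 * s q3))));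
  last by lint.
apply: csum_ext => w z.
rewrite (csum_antipodel w (f := fun a => csum z (fun q2 q3 => f p2 q2 (p1 * (a * s q3)))));
  last by lint.
by congr (_ *: _); apply: csum_ext => ? ?; rewrite mul1r.
Qed.

Lemma adsum_mul b c f : lin2 eB eB f ->
  adsum (b * c) f = adsum b (fun u e => adsum c (fun v e' => f (u * v) (e * e'))).
Proof.
move=> f2; rewrite adsumE csum_mul; last by lint.
rewrite adsumE; apply: csum_ext => b1 y.
transitivity (csum c (fun c1 z => csum y (fun b2 b3 => csum z (fun c2 c3 =>
   f (b2 * c2) (b1 * s b3 * (c1 * s c3)))))).
  apply: csum_ext => c1 z; rewrite csum_mul; last by lint.
  apply: csum_ext => b2 b3; apply: csum_ext => c2 c3; rewrite antipodeM !mulrA; congr (f _ (_ * _)).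
  by rewrite -!mulrA; congr (_ * _); apply: mulBC.
by rewrite csum_exch; apply: csum_ext => b2 b3; rewrite adsumE.
Qed.
End W.
End Coadjoint.

(** * The trace pairing *)

Definition pderiv (K : comNzRingType) (B : gradedBialgType K) (W : lmodType K)
    (mu : B -> W) : Prop :=
  forall b c, mu (b * c) = counit b *: mu c + counit c *: mu b.

Section PointDerivations.
Variables (K : comNzRingType) (B : gradedHopfType K) (W : lmodType K).
Notation eB := (@elin K B).
Notation s := (@antipode K B).
Variable mu : B -> W.
Hypotheses (mu_lin : lin eB mu) (mu_der : pderiv mu).

Lemma pderiv1 : mu 1 = 0.
Proof.
have := mu_der 1 1; rewrite mulr1 counit1 scale1r => h.
by apply: (addIr (mu 1)); rewrite add0r -h.
Qed.

Lemma pderiv_antipode b : mu (s b) = - mu b.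
Proof.
have := csum_antipodel b mu_lin; rewrite pderiv1 scaler0.
have -> : csum b (fun b1 b2 => mu (s b1 * b2)) =
    csum b (fun b1 b2 => counit b1 *: mu b2) + csum b (fun b1 b2 => counit b2 *: mu (s b1)).
  rewrite /csum -big_split; apply: eq_bigr => u _.
  by rewrite mu_der counit_antipode.
rewrite csum_counitl // (csum_counitr b (f := fun z => mu (s z))); last by lint.
by move=> h; apply/eqP; rewrite -addr_eq0 addrC h.
Qed.
End PointDerivations.

Section AdDeriv.
Variables (K : comNzRingType) (B : gradedHopfType K) (W : lmodType K).
Notation eB := (@elin K B).
Notation s := (@antipode K B).

(** On a point derivation the antipode is a change of sign: the coaction becomes a
    commutator. *)
Lemma adsum_deriv b (f : B -> B -> W) : lin2 eB eB f -> (forall u, pderiv (f u)) ->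
  adsum b f = csum b (fun b1 b2 => f b2 b1 - f b1 b2).
Proof.
move=> f2 fd; rewrite adsumE.
transitivity (csum b (fun b1 y => csum y (fun b2 b3 => counit b3 *: f b2 b1)) -
   csum b (fun b1 y => counit b1 *: csum y (fun b2 b3 => f b2 b3))).
  rewrite /csum -sumrB; apply: eq_bigr => u _; rewrite scaler_sumr -sumrB.
  apply: eq_bigr => v _; rewrite fd addrC counit_antipode.
  by rewrite (pderiv_antipode (f2.2 _) (fd _)) scalerN.
rewrite (csum_counitl b (f := fun y => csum y f)); last by lint.
rewrite /csum -sumrB; apply: eq_bigr => u _; congr (_ - _).
by rewrite -[RHS](csum_counitr u.2 (f := fun z => f z u.1)) //; lint.
Qed.
End AdDeriv.

Section TracePairing.
Variables (K : comNzRingType) (B : gradedHopfType K) (t : B).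
Hypothesis B_ungraded : ungraded B.
Hypothesis B_comm : graded_commutative B.
Hypothesis t_trace : trace_like t.
Notation eB := (@elin K B).
Notation s := (@antipode K B).
Notation beta := (trace_pairing t).

Lemma beta_derivr b : lin eB (beta b : B -> K^o) /\ pderiv (beta b : B -> K^o).
Proof.
rewrite /trace_pairing; case: (Defs.finv _ _ _) => mu [mu1 mu2] /=; split.
  by move=> k x y z ->; apply: mu1.
exact: mu2.
Qed.

(** The defining property of the pairing; trace-likeness makes cot_map t onto. *)
Lemma cot_map_beta b :
  \sum_(u <- terms (comul t)) beta b u.1 *: cot_proj u.2 = cot_proj b.
Proof.
rewrite -[LHS]/(cot_map t (Defs.finv (liealg0 B) (cot_map t) (cot_proj b))).
have [_ [g gK Kg]] := t_trace; rewrite /Defs.finv; case: pselect => [e|].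
  exact: (projT2 (cid e)).
by case; exists (g (cot_proj b)).
Qed.

Lemma lquot_pi_lin (V : lmodType K) (S : V -> Prop)
    (h : S 0 /\ forall a u v, S u -> S v -> S (a *: u + v)) :
  lin (@elin K V) (lquot_pi h : V -> lquot h).
Proof.
move=> k x y z ->; rewrite -[RHS]/(qadd (qscale k (lquot_pi h x)) (lquot_pi h y)).
by rewrite qscaleE qaddE.
Qed.

(** A point derivation factors through the cotangent module, where b is the
    contraction of t with the pairing. *)
Lemma pderiv_beta (W : lmodType K) (mu : B -> W) b : lin eB mu -> pderiv mu ->
  mu b = csum t (fun t1 t2 => beta b t1 *: mu t2).
Proof.
move=> mul mud; have := cot_map_beta b.
pose v c : aug B := Aug (sub_counitP c).
have vlin : lin (@elin K (aug B)) (fun u : aug B => mu (val u)).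
  by move=> k x y z ->; rewrite linearP /= (mul k (val x) (val y)).
have muv c : mu (val (v c)) = mu c.
  have := mul (- counit c) 1 c (val (v c)); rewrite (pderiv1 mud) scaler0 add0r.
  by apply; rewrite /elin /= addrC scaleNr.
have pl := lquot_pi_lin (aug_sqP B).
have -> : \sum_(u <- terms (comul t)) beta b u.1 *: cot_proj u.2 =
   lquot_pi (aug_sqP B) (\sum_(u <- terms (comul t)) beta b u.1 *: v u.2).
  by rewrite (linsum _ _ _ pl); apply: eq_bigr => u _; rewrite (linZ _ _ pl).
rewrite -[cot_proj b]/(lquot_pi (aug_sqP B) (v b)) => /lquotP[r hr].
apply/esym/eqP; rewrite -subr_eq0; apply/eqP.
transitivity (mu (\sum_(u <- r) val u.1 * val u.2)).
  rewrite -hr [RHS](linD vlin) -scaleN1r (linZ _ _ vlin) scaleN1r muv (linsum _ _ _ vlin).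
  by congr (_ - _); apply: eq_bigr => u _; rewrite (linZ _ _ vlin) muv.
rewrite (linsum _ _ _ mul) big1 // => u _; rewrite mud.
by rewrite (eqP (aug_valP u.1)) (eqP (aug_valP u.2)) !scale0r addr0.
Qed.

Lemma csum_cosym (W : lmodType K) (f : B -> B -> W) : lin2 eB eB f ->
  csum t f = csum t (fun t1 t2 => f t2 t1).
Proof.
have [tc _] := t_trace; move=> f2; rewrite {1}/csum tc (linsum _ _ _ (terms_lin f2)).
by apply: eq_bigr => u _; rewrite (terms_pure f2).
Qed.

(** By pderiv_beta both sides are contractions of t with the same two derivations,
    in the two orders of the components of t. *)
Lemma betaC b c : beta b c = beta c b.
Proof.
have [bl bd] := beta_derivr b; have [cl cd] := beta_derivr c.
rewrite (pderiv_beta c bl bd) (pderiv_beta b cl cd).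
rewrite (csum_cosym (W := K^o)) //; last first.
  split=> [y|x]; first exact: (linK_mull _ cl).
  exact: (linK_mulr (beta c x) bl).
by apply: eq_bigr => u _; rewrite [LHS]mulrC.
Qed.

Lemma lin_betar (D : Type) (E : K -> D -> D -> D -> Prop) (F : D -> B) b :
  lin E F -> lin E ((fun x => beta b (F x)) : D -> K^o).
Proof. exact: (lin_appe (proj1 (beta_derivr b))). Qed.

Lemma lin_betal (D : Type) (E : K -> D -> D -> D -> Prop) (F : D -> B) b :
  lin E F -> lin E ((fun x => beta (F x) b) : D -> K^o).
Proof.
by move=> hF k x y z e; rewrite !(betaC _ b); apply: (lin_betar b hF).
Qed.

Lemma beta_mulr b c d : beta b (c * d) = counit c * beta b d + counit d * beta b c.
Proof. exact: (proj2 (beta_derivr b)). Qed.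

Lemma beta_mull b c d : beta (c * d) b = counit c * beta d b + counit d * beta c b.
Proof. by rewrite !(betaC _ b) beta_mulr. Qed.
End TracePairing.

(** * Invariant forms on B *)

Section Balanced.
Variables (K : comNzRingType) (B : gradedHopfType K) (t : B).
Hypothesis B_ungraded : ungraded B.
Hypothesis B_comm : graded_commutative B.
Hypothesis t_trace : trace_like t.
Notation eB := (@elin K B).
Notation s := (@antipode K B).
Notation beta := (trace_pairing t).

Ltac lint_ext lint ::= match goal with
  | |- @lin _ _ _ _ (fun x => trace_pairing _ (@?lg x) (@?lh x)) =>
      tryif depends lg then refine (lin_betal t_trace (F:=lg) _ _)
      else refine (lin_betar t (F:=lh) _ _); lint
  end.

Section W.
Variable W : lmodType K.

(** The coaction b'' ⊗ s(b') b''' on the other side. *)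
Definition adsumR (c : B) (f : B -> B -> W) : W :=
  csum c (fun c1 y => csum y (fun c2 c3 => f c2 (s c1 * c3))).

Lemma adsumR_mul b c f : lin2 eB eB f ->
  adsumR (b * c) f = adsumR b (fun u e => adsumR c (fun v e' => f (u * v) (e * e'))).
Proof.
move=> f2; rewrite /adsumR (csum_mul B_ungraded); last by lint.
apply: csum_ext => b1 y.
transitivity (csum c (fun c1 z => csum y (fun b2 b3 => csum z (fun c2 c3 =>
   f (b2 * c2) (s b1 * b3 * (s c1 * c3)))))).
  apply: csum_ext => c1 z; rewrite (csum_mul B_ungraded); last by lint.
  do 2!(apply: csum_ext => ? ?); rewrite (antipodeM B_ungraded) // !mulrA; congr (f _ (_ * _)).
  by rewrite -!mulrA; congr (_ * _); apply: (mulBC B_ungraded).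
by rewrite csum_exch.
Qed.

Lemma adsumR_counitl c (f : B -> W) : lin eB f ->
  adsumR c (fun u e => counit u *: f e) = counit c *: f 1.
Proof.
move=> fl; rewrite -csum_antipodel //; apply: csum_ext => b1 y.
by rewrite (csum_counitl y (f := fun b3 => f (s b1 * b3))) //; lint.
Qed.

Lemma adsumR_adsum c (f : B -> B -> W) : lin2 eB eB f ->
  adsum c (fun v e' => adsumR v (fun w d => f w (d * e'))) = f c 1.
Proof.
move=> f2; rewrite adsumE.
pose g c1 p1 p2 p3 c3 := f p2 ((c1 * s p1) * (p3 * s c3)).
transitivity (csum c (fun c1 y => csum y (fun p1 y' => csum y' (fun z c3 => csum z (fun p2 p3 =>
   g c1 p1 p2 p3 c3))))).
  apply: csum_ext => c1 y.
  rewrite -(csum_coassoc y (f := fun p1 z c3 => csum z (fun p2 p3 => g c1 p1 p2 p3 c3)));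
    try by rewrite /g; lint.
  do 3!(apply: csum_ext => ? ?); rewrite /g; congr (f _ _).
  rewrite (mulBC B_ungraded) // -!mulrA; congr (_ * _).
  by rewrite (mulBC B_ungraded) // -!mulrA.
rewrite -(csum_coassoc c (f := fun c1 p1 y' => csum y' (fun z c3 => csum z (fun p2 p3 =>
   g c1 p1 p2 p3 c3)))); try by rewrite /g; lint.
transitivity (csum c (fun z c3 => csum z (fun p2 p3 => f p2 (p3 * s c3)))).
  rewrite -[RHS](csum_counitl c (f := fun y => csum y (fun z c3 => csum z (fun p2 p3 =>
    f p2 (p3 * s c3))))); last by lint.
  apply: csum_ext => w y; rewrite (csum_antipoder w (f := fun a => csum y (fun z c3 =>
    csum z (fun p2 p3 =>
    f p2 (a * (p3 * s c3)))))); last by lint.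
  by congr (_ *: _); do 2!(apply: csum_ext => ? ?); rewrite mul1r.
rewrite (csum_coassoc c (f := fun p2 p3 c3 => f p2 (p3 * s c3))); try by lint.
rewrite -[RHS](csum_counitr c (f := fun z => f z 1)); last by lint.
apply: csum_ext => p2 y; rewrite (csum_antipoder y (f := fun z => f p2 z)) //.
by lint.
Qed.
End W.

(** The left side is a point derivation in c, the right side one in b; expanded
    along t by pderiv_beta, both are sums over four components of t, and differ by
    a rotation of these components by two places. *)
Lemma beta_balanced b c :
  adsumR c (fun c1 e => beta b c1 *: e) = adsum b (fun b1 e => beta b1 c *: e).
Proof.
have Ll : lin eB (fun c => adsumR c (fun c1 e => beta b c1 *: e)) by rewrite /adsumR; lint.
have Rl : lin eB (fun b => adsum b (fun b1 e => beta b1 c *: e)).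
  by apply: adsum_lin => //; lint.
rewrite (pderiv_beta t_trace c Ll); last first.
  move=> c1 c2; rewrite adsumR_mul; last by lint.
  transitivity (adsumR c1 (fun u e => counit u *: adsumR c2 (fun v e' => beta b v *: (e * e')))
   + adsumR c1 (fun u e => beta b u *: adsumR c2 (fun v e' => counit v *: (e * e')))).
    rewrite /adsumR /csum -big_split; apply: eq_bigr => ? _; rewrite -big_split;
      apply: eq_bigr => ? _ /=.
    rewrite !scaler_sumr -big_split; apply: eq_bigr => ? _; rewrite !scaler_sumr -big_split.
    by apply: eq_bigr => ? _ /=; rewrite beta_mulr scalerDl -!scalerA; congr (_ + _); apply: scaleC.
  rewrite (adsumR_counitl c1 (f := fun e => adsumR c2 (fun v e' => beta b v *: (e * e'))));
    last first.
    by rewrite /adsumR; lint.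
  congr (_ *: _ + _).
    by do 2!(apply: csum_ext => ? ?); rewrite mul1r.
  transitivity (adsumR c1 (fun u e => counit c2 *: (beta b u *: e))).
    apply: csum_ext => p y; apply: csum_ext => u q.
    rewrite (adsumR_counitl c2 (f := fun e' => s p * q * e')); last by lint.
    by rewrite mulr1 scaleC.
  by rewrite /adsumR /csum scaler_sumr; apply: eq_bigr => ? _; rewrite scaler_sumr.
rewrite (pderiv_beta t_trace b Rl); last first.
  move=> b1 b2; rewrite (adsum_mul B_ungraded) //; last by lint.
  transitivity (adsum b1 (fun u e => counit u *: adsum b2 (fun v e' => beta v c *: (e * e')))
   + adsum b1 (fun u e => beta u c *: adsum b2 (fun v e' => counit v *: (e * e')))).
    rewrite /adsum -big_split; apply: eq_bigr => ? _.
    rewrite !scaler_sumr -big_split; apply: eq_bigr => ? _ /=.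
    by rewrite (beta_mull t_trace) scalerDl -!scalerA; congr (_ + _); apply: scaleC.
  rewrite (adsum_counitl b1 (f := fun e => adsum b2 (fun v e' => beta v c *: (e * e'))));
    last first.
    by apply: lin_adsum_body => ? ?; lint.
  congr (_ *: _ + _).
    by apply: adsum_ext => ? ?; rewrite mul1r.
  transitivity (adsum b1 (fun u e => counit b2 *: (beta u c *: e))).
    apply: adsum_ext => u e; rewrite (adsum_counitl b2 (f := fun e' => e * e')); last by lint.
    by rewrite mulr1 scaleC.
  by rewrite /adsum scaler_sumr.
pose g t1 p q r : B := beta c t1 *: (beta b q *: (s p * r)).
transitivity (csum t (fun t1 y => csum y (fun p z => csum z (fun q r => g t1 p q r)))).
  apply: csum_ext => t1 y; rewrite /adsumR /csum scaler_sumr; apply: eq_bigr => u _.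
  by rewrite scaler_sumr.
rewrite -(csum_coassoc t (f := fun t1 p z => csum z (fun q r => g t1 p q r)));
  try by rewrite /g; lint.
rewrite (csum_cosym t_trace); last by rewrite /g; lint.
pose h t1 p q r : B := beta b t1 *: (beta q c *: (p * s r)).
transitivity (csum t (fun t1 y => csum y (fun p z => csum z (fun q r => h t1 p q r)))); last first.
  apply: csum_ext => t1 y; rewrite adsumE /csum scaler_sumr; apply: eq_bigr => u _.
  by rewrite scaler_sumr.
rewrite -(csum_coassoc t (f := fun t1 p z => csum z (fun q r => h t1 p q r)));
  try by rewrite /h; lint.
apply: csum_ext => w z; rewrite csum_exch; do 2!(apply: csum_ext => ? ?).
by rewrite /g /h scaleC (betaC t_trace c) (mulBC B_ungraded).
Qed.

(** Balance exchanges the coaction on b for the coaction on c from the other side,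
    and the two coactions on c cancel. *)
Lemma beta_inv b c : adsum b (fun u e => adsum c (fun v e' => beta u v *: (e * e'))) =
  beta b c *: 1.
Proof.
rewrite adsum_exch -[RHS](adsumR_adsum c (f := fun w d => beta b w *: d)); last by lint.
apply: adsum_ext => v e'.
transitivity (adsum b (fun u e => beta u v *: e) * e').
  by rewrite /adsum mulr_suml; apply: eq_bigr => u _; rewrite -scalerAl.
rewrite -beta_balanced /adsumR /csum mulr_suml; apply: eq_bigr => u _; rewrite mulr_suml.
by apply: eq_bigr => w _; rewrite -scalerAl.
Qed.

(** The pairing of the commutator of two point derivations with a third one, as a
    form on B. *)
Definition cubic (b c d : B) : K :=
  csum b (fun b1 b2 => (beta b1 d * beta b2 c - beta b2 d * beta b1 c : K^o)).

Lemma adsumR_deriv (W : lmodType K) c (f : B -> B -> W) : lin2 eB eB f ->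
  (forall u, pderiv (f u)) -> adsumR c f = csum c (fun c1 c2 => f c1 c2 - f c2 c1).
Proof.
move=> f2 fd; rewrite /adsumR.
transitivity (csum c (fun c1 y => counit c1 *: csum y f) -
   csum c (fun c1 y => csum y (fun c2 c3 => counit c3 *: f c2 c1))).
  rewrite /csum -sumrB; apply: eq_bigr => u _; rewrite scaler_sumr -sumrB.
  apply: eq_bigr => v _; rewrite fd counit_antipode.
  by rewrite (pderiv_antipode (f2.2 _) (fd _)) scalerN.
rewrite (csum_counitl c (f := fun y => csum y f)); last by lint.
rewrite /csum -sumrB; apply: eq_bigr => u _; congr (_ - _).
by rewrite -[RHS](csum_counitr u.2 (f := fun z => f z u.1)) //; lint.
Qed.

(** By adsum_deriv and adsumR_deriv the two sides are d paired with the two members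
    of the balance identity. *)
Lemma cubic_cycle b c d : cubic b c d = cubic c d b.
Proof.
have dl : lin eB (fun e => beta e d : K^o) by lint.
have dd : pderiv (fun e => beta e d : K^o) by move=> x y; rewrite (beta_mull t_trace).
have fd (k : K) : pderiv (fun e => k * beta e d : K^o).
  by move=> x y; rewrite (beta_mull t_trace) mulrDr; congr (_ + _); apply: mulrCA.
transitivity (adsum b (fun u e => beta u c * beta e d : K^o)).
  rewrite adsum_deriv //; last by split=> ?; lint.
  by apply: eq_bigr => u _; rewrite [beta u.2 d * _]mulrC [beta u.1 d * _]mulrC.
transitivity (adsumR c (fun u e => beta b u * beta e d : K^o)); last first.
  rewrite adsumR_deriv //; last by split=> ?; lint.
  by apply: eq_bigr => u _; rewrite !(betaC t_trace _ b).
transitivity (beta (adsum b (fun u e => beta u c *: e)) d : K^o).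
  rewrite /adsum (linsum _ _ _ dl); apply: eq_bigr => w _.
  by rewrite (linZ _ _ dl).
rewrite -beta_balanced /adsumR /csum (linsum _ _ _ dl); apply: eq_bigr => w _.
by rewrite (linsum _ _ _ dl); apply: eq_bigr => w' _; rewrite (linZ _ _ dl).
Qed.

(** The coaction respects the comultiplication of b, so that the invariance of the
    pairing applies to each of its two factors. *)
Lemma cubic_inv b c d :
  adsum b (fun u e => adsum c (fun v e' => adsum d (fun w e'' =>
    cubic u v w *: (e * e' * e'')))) = cubic b c d *: 1.
Proof.
pose f u1 u2 (e : B) : B := adsum c (fun v e' => adsum d (fun w e'' =>
   (beta u1 w * beta u2 v - beta u2 w * beta u1 v) *: (e * e' * e''))).
have f3 : lin3 f.
  by split=> ? ?; rewrite /f; apply: lin_adsum_body => ? ?; apply: lin_adsum_body => ? ?; lint.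
transitivity (adsum b (fun u e => csum u (fun u1 u2 => f u1 u2 e))).
  apply: adsum_ext => u e; rewrite /f /adsum [RHS]exchange_big; apply: eq_bigr => v _.
  rewrite [RHS]exchange_big; apply: eq_bigr => w _.
  by rewrite /cubic /csum scaler_suml.
rewrite -adsum_comul // /cubic /csum scaler_suml; apply: eq_bigr => -[b1 b2] _ /=.
pose L (u e c0 : B) : B := adsum c0 (fun x y => beta u x *: (e * y)).
have LE a c0 : \sum_(w <- ad a) L w.1 w.2 c0 = beta a c0 *: 1 by rewrite -beta_inv.
transitivity (\sum_(u <- ad b1) \sum_(v <- ad b2)
    (L u.1 u.2 d * L v.1 v.2 c - L u.1 u.2 c * L v.1 v.2 d)); last first.
  under eq_bigr => u _ do rewrite sumrB.
  by rewrite sumrB -!big_distrlr !LE /= -!scalerAl !mul1r !scalerA -scalerBl [beta b1 c * _]mulrC.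
apply: eq_bigr => -[u e] _; apply: eq_bigr => -[v e'] _ /=.
rewrite /L /f /adsum !big_distrlr [X in _ = X - _]exchange_big -sumrB /=.
apply: eq_bigr => -[p q] _; rewrite -sumrB; apply: eq_bigr => -[x y] _ /=.
rewrite -!scalerAl -!scalerAr !scalerA scalerBl; congr (_ *: _ - _ *: _).
  by rewrite -!mulrA; congr (_ * _); rewrite [RHS](mulBC B_ungraded) // -mulrA.
  exact: mulrC.
by rewrite -!mulrA; congr (_ * _); rewrite mulrA [_ * q](mulBC B_ungraded) // -mulrA.
Qed.
End Balanced.

(** * Invariant forms with values in the representation algebra *)

Section RepAlg.
Variables (K : comNzRingType) (A B : gradedBialgType K).
Notation R := (rep_alg A B).

Lemma rep_comm p q (u v : R) : homog p u -> homog q v ->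
  u * v = ksign K (p * q) *: (v * u).
Proof.
move=> hu; elim: hu q v => {p u}.
- move=> p q x b hx hb r v; elim=> {r v}.
  + by move=> r s y c hy hc; apply: rgenC.
  + by move=> r; rewrite mulr0 mul0r scaler0.
  + by rewrite mulr1 mul1r mulr0 ksign0 scale1r.
  + by move=> r k u v _ hu _ hv; rewrite mulrDr [X in _ =
    _ *: X]mulrDl -scalerAr hu hv -scalerAl scalerDr scaleC.
  + move=> r s u v _ hu _ hv; rewrite mulrA hu -scalerAl -[u * _ *
    v]mulrA hv -scalerAr ksignZ mulrA.
    by congr (_ *: _); sgn.
- by move=> p q v _; rewrite mulr0 mul0r scaler0.
- by move=> q v _; rewrite mulr1 mul1r mul0r ksign0 scale1r.
- by move=> p k u v _ hu _ hv q w hw;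
  rewrite mulrDl [X in _ = _ *: X]mulrDr -scalerAl (hu _ _ hw) (hv _ _ hw) -scalerAr scalerDr
  scaleC.
- move=> p q u v _ hu _ hv r w hw;
  rewrite -mulrA (hv _ _ hw) -scalerAr [u * (w * v)]mulrA (hu _ _ hw).
  by rewrite -scalerAl ksignZ mulrA; congr (_ *: _); sgn.
Qed.
End RepAlg.

Section Slots.
Variables (K : comNzRingType) (A B : gradedHopfType K) (t : B).
Hypothesis A_cocomm : cocommutative A.
Hypothesis B_ungraded : ungraded B.
Hypothesis B_comm : graded_commutative B.
Hypothesis t_trace : trace_like t.
Notation hA := (@helin K A).
Notation eA := (@elin K A).
Notation eB := (@elin K B).
Notation beta := (trace_pairing t).
Notation cub := (cubic t).
Notation R := (rep_alg A B).
Notation "x @ b" := (rgen (el x) b) (at level 30).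

Lemma rgen_homog (x : helt A) (b : B) : homog (deg x) (x @ b : R).
Proof. by rewrite -[deg x]addr0; apply: rep_homog_gen; [apply: elP | apply: B_ungraded]. Qed.

Lemma rgen_mull (x y : A) (b : B) : rgen (x * y) b =
  csum b (fun b1 b2 => rgen x b1 * rgen y b2) :> R.
Proof. exact: rgenMl. Qed.

Lemma rgen_mulr (x : helt A) (b c : B) : x @ (b * c) = hsum x (fun x1 x2 => x1 @ b * x2 @ c) :> R.
Proof.
rewrite rgenMr -[LHS]/(csum (el x) (fun u v => rgen u b * rgen v c)).
by rewrite -hsum_csum_el //; lint.
Qed.

Ltac lint_ext lint ::= lazymatch goal with
  | |- @lin _ _ _ _ (fun x => trace_pairing _ (@?lg x) (@?lh x)) =>
      tryif depends lg then refine (lin_betal t_trace (F:=lg) _ _)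
      else refine (lin_betar t (F:=lh) _ _); lint
  end.

Section LinCubic.
Variables (D : Type) (E : K -> D -> D -> D -> Prop) (F : D -> B).
Hypothesis hF : lin E F.

Lemma lin_cubic1 c d : lin E ((fun x => cub (F x) c d) : D -> K^o).
Proof.
apply: (lin_appe (g := fun b => cub b c d : K^o)) => //.
by rewrite /cubic; lint.
Qed.

Lemma lin_cubic2 b d : lin E ((fun x => cub b (F x) d) : D -> K^o).
Proof. by rewrite /cubic; apply: (lin_csum_body (W := K^o)) => ? ?; lint. Qed.

Lemma lin_cubic3 b c : lin E ((fun x => cub b c (F x)) : D -> K^o).
Proof. by rewrite /cubic; apply: (lin_csum_body (W := K^o)) => ? ?; lint. Qed.
End LinCubic.

Lemma lin_adsum (W : lmodType K) (D : Type) (E : K -> D -> D -> D -> Prop) (F : D -> B)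
   (f : B -> B -> W) : lin2 eB eB f -> lin E F -> lin E (fun x => adsum (F x) f).
Proof. by move=> f2; apply: (lin_appe (g := fun z => adsum z f)); apply: adsum_lin. Qed.

(** A acts on the linear maps from B to A_B through the coadjoint coaction. *)
Definition act (a : A) (m : B -> R) (b : B) : R := adsum b (fun u e => rgen a e * m u).

(** The contractions of the pairing (uno, duo) and of the cubic form (tri) with
    elements of A; in uno the second slot is left empty. *)
Definition uno (a : A) (b c : B) : R := adsum b (fun u e => beta u c *: rgen a e).

Definition duo (a1 a2 : A) (b c : B) : R :=
  adsum b (fun u e => adsum c (fun v e' => beta u v *: (rgen a1 e * rgen a2 e'))).

Definition tri (a1 a2 a3 : A) (b c d : B) : R :=
  adsum b (fun u e => adsum c (fun v e' => adsum d (fun w e'' =>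
    cub u v w *: (rgen a1 e * (rgen a2 e' * rgen a3 e''))))).

Ltac lint_pairings lint := lazymatch goal with
  | |- @lin _ _ _ _ (fun x => trace_pairing _ (@?lg x) (@?lh x)) =>
      tryif depends lg then refine (lin_betal t_trace (F:=lg) _ _)
      else refine (lin_betar t (F:=lh) _ _); lint
  | |- @lin _ _ _ _ (fun x => cubic _ (@?lg x) (@?lh x) (@?lk x)) =>
      tryif depends lg then refine (lin_cubic1 (F:=lg) _ _ _)
      else tryif depends lh then refine (lin_cubic2 (F:=lh) _ _ _)
      else refine (lin_cubic3 (F:=lk) _ _ _); lint
  | |- @lin _ _ _ _ (fun x => adsum (@?lg x) (@?lG x)) =>
      tryif depends lg then refine (lin_adsum (F:=lg) _ _)
      else refine (@lin_adsum_body _ _ _ _ _ _ lG _); lint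
  end.

Ltac lint_ext lint ::= lint_pairings lint.

Section LinContractions.
Variables (D : Type) (E : K -> D -> D -> D -> Prop).

Lemma lin_uno1 (F : D -> A) a2 a3 :
  lin E F -> lin E (fun x => uno (F x) a2 a3).
Proof. by move=> hF; rewrite /uno; lint. Qed.

Lemma lin_uno2 (F : D -> B) a1 a3 :
  lin E F -> lin E (fun x => uno a1 (F x) a3).
Proof. by move=> hF; rewrite /uno; lint. Qed.

Lemma lin_uno3 (F : D -> B) a1 a2 :
  lin E F -> lin E (fun x => uno a1 a2 (F x)).
Proof. by move=> hF; rewrite /uno; lint. Qed.

Lemma lin_duo1 (F : D -> A) a2 a3 a4 :
  lin E F -> lin E (fun x => duo (F x) a2 a3 a4).
Proof. by move=> hF; rewrite /duo; lint. Qed.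

Lemma lin_duo2 (F : D -> A) a1 a3 a4 :
  lin E F -> lin E (fun x => duo a1 (F x) a3 a4).
Proof. by move=> hF; rewrite /duo; lint. Qed.

Lemma lin_duo3 (F : D -> B) a1 a2 a4 :
  lin E F -> lin E (fun x => duo a1 a2 (F x) a4).
Proof. by move=> hF; rewrite /duo; lint. Qed.

Lemma lin_duo4 (F : D -> B) a1 a2 a3 :
  lin E F -> lin E (fun x => duo a1 a2 a3 (F x)).
Proof. by move=> hF; rewrite /duo; lint. Qed.

Lemma lin_tri1 (F : D -> A) a2 a3 a4 a5 a6 :
  lin E F -> lin E (fun x => tri (F x) a2 a3 a4 a5 a6).
Proof. by move=> hF; rewrite /tri; lint. Qed.

Lemma lin_tri2 (F : D -> A) a1 a3 a4 a5 a6 :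
  lin E F -> lin E (fun x => tri a1 (F x) a3 a4 a5 a6).
Proof. by move=> hF; rewrite /tri; lint. Qed.

Lemma lin_tri3 (F : D -> A) a1 a2 a4 a5 a6 :
  lin E F -> lin E (fun x => tri a1 a2 (F x) a4 a5 a6).
Proof. by move=> hF; rewrite /tri; lint. Qed.

Lemma lin_tri4 (F : D -> B) a1 a2 a3 a5 a6 :
  lin E F -> lin E (fun x => tri a1 a2 a3 (F x) a5 a6).
Proof. by move=> hF; rewrite /tri; lint. Qed.

Lemma lin_tri5 (F : D -> B) a1 a2 a3 a4 a6 :
  lin E F -> lin E (fun x => tri a1 a2 a3 a4 (F x) a6).
Proof. by move=> hF; rewrite /tri; lint. Qed.

Lemma lin_tri6 (F : D -> B) a1 a2 a3 a4 a5 :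
  lin E F -> lin E (fun x => tri a1 a2 a3 a4 a5 (F x)).
Proof. by move=> hF; rewrite /tri; lint. Qed.

End LinContractions.

Ltac lint_slots lint := lazymatch goal with
  | |- @lin _ _ _ _ (fun x => uno (@?f1 x) (@?f2 x) (@?f3 x)) =>
      tryif depends f1 then refine (lin_uno1 (F:=f1) _ _ _)
      else tryif depends f2 then refine (lin_uno2 (F:=f2) _ _ _)
      else refine (lin_uno3 (F:=f3) _ _ _); lint
  | |- @lin _ _ _ _ (fun x => duo (@?f1 x) (@?f2 x) (@?f3 x) (@?f4 x)) =>
      tryif depends f1 then refine (lin_duo1 (F:=f1) _ _ _ _)
      else tryif depends f2 then refine (lin_duo2 (F:=f2) _ _ _ _)
      else tryif depends f3 then refine (lin_duo3 (F:=f3) _ _ _ _)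
      else refine (lin_duo4 (F:=f4) _ _ _ _); lint
  | |- @lin _ _ _ _ (fun x => tri (@?f1 x) (@?f2 x) (@?f3 x) (@?f4 x) (@?f5 x) (@?f6 x)) =>
      tryif depends f1 then refine (lin_tri1 (F:=f1) _ _ _ _ _ _)
      else tryif depends f2 then refine (lin_tri2 (F:=f2) _ _ _ _ _ _)
      else tryif depends f3 then refine (lin_tri3 (F:=f3) _ _ _ _ _ _)
      else tryif depends f4 then refine (lin_tri4 (F:=f4) _ _ _ _ _ _)
      else tryif depends f5 then refine (lin_tri5 (F:=f5) _ _ _ _ _ _)
      else refine (lin_tri6 (F:=f6) _ _ _ _ _ _); lint
  | _ => lint_pairings lint
  end.

Ltac lint_ext lint ::= lint_slots lint.

Lemma adsum_homog p b (f : B -> B -> R) : (forall u e, homog p (f u e)) -> homog p (adsum b f).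
Proof. by move=> h; apply: homog_sum => w _; apply: h. Qed.

Lemma tri_homog (a1 a2 a3 : helt A) b c d :
  homog (deg a1 + (deg a2 + deg a3)) (tri (el a1) (el a2) (el a3) b c d).
Proof.
by do 3!(apply: adsum_homog => ? ?); apply/homogZ/homogM/homogM; apply: rgen_homog.
Qed.

Lemma uno_homog (a : helt A) b c : homog (deg a) (uno (el a) b c).
Proof. by apply: adsum_homog => ? ?; apply/homogZ/rgen_homog. Qed.

Lemma duo_homog (a1 a2 : helt A) b c : homog (deg a1 + deg a2) (duo (el a1) (el a2) b c).
Proof. by do 2!(apply: adsum_homog => ? ?); apply/homogZ/homogM; apply: rgen_homog. Qed.

(** The generator of a product splits the coefficient of the coaction, which is
    coassociative. *)
Lemma act_mul (a a' : A) (m : B -> R) b : lin eB m ->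
  act (a * a') m b = act a (act a' m) b.
Proof.
move=> ml; rewrite /act.
transitivity (adsum b (fun u e => csum e (fun e1 e2 => rgen a e1 * rgen a' e2 * m u) : R)).
  by apply: adsum_ext => u e; rewrite rgen_mull /csum mulr_suml.
rewrite -(adsum_coaction B_ungraded b (f := fun u e1 e2 => rgen a e1 * rgen a' e2 * m u)).
  by apply: adsum_ext => u e; rewrite /adsum mulr_sumr; apply: eq_bigr => w _; rewrite mulrA.
by split=> ? ?; lint.
Qed.

(** Multiplying by the second component of Y removes the coefficient of the coaction
    by which its first component has acted (adsum_translate). *)
Lemma act_translate p (Y : helt A) (m : B -> R) c :
  lin eB m -> (forall c, homog p (m c)) ->
  hsum Y (fun y1 y2 => ksign K (p * deg y1) *: csum c (fun c1 c2 =>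
    act (el y1) m c1 * y2 @ c2)) = csum c (fun c1 c2 => m c2 * Y @ c1).
Proof.
move=> ml mh.
transitivity (csum c (fun c1 c2 => adsum c1 (fun v e' => m v * Y @ (e' * c2)))); last first.
  by rewrite -(adsum_translate c (f := fun v e => m v * Y @ e)) //; lint.
transitivity (hsum Y (fun y1 y2 => csum c (fun c1 c2 => adsum c1 (fun v e' =>
    m v * (y1 @ e' * y2 @ c2))))).
  apply: hsum_ext => y1 y2 _; rewrite /csum scaler_sumr; apply: eq_bigr => u _.
  rewrite /act /adsum mulr_suml scaler_sumr; apply: eq_bigr => w _.
  rewrite [y1 @ _ * m _](rep_comm (rgen_homog _ _) (mh _)) -scalerAl ksignZ -mulrA.
  by rewrite (@ksign_parity _ _ 0) ?ksign0 ?scale1r //; parity_tauto.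
rewrite hsum_csum_exch; apply: csum_ext => c1 c2; rewrite /hsum /adsum exchange_big.
by apply: eq_bigr => w _; rewrite rgen_mulr [RHS]mulr_sumr.
Qed.

Lemma adsum_rgen_mul (a a' : A) (F : B -> R -> R) b : lin2 eB (@elin K R) F ->
  adsum b (fun u e => F u (rgen (a * a') e)) =
  adsum b (fun u e => adsum u (fun u' f => F u' (rgen a e * rgen a' f))).
Proof.
move=> F2.
rewrite (adsum_coaction B_ungraded b (f := fun u e1 e2 => F u (rgen a e1 * rgen a' e2)));
  last by split=> ? ?; lint.
by apply: adsum_ext => u e; rewrite rgen_mull /csum (linsum _ _ _ (F2.2 u)).
Qed.

Lemma tri_mul (a1 a2 a3 v1 v2 v3 : A) b c d :
  tri (a1 * v1) (a2 * v2) (a3 * v3) b c d =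
  adsum b (fun u e => adsum c (fun v e' => adsum d (fun w e'' =>
    adsum u (fun u' f => adsum v (fun v' f' => adsum w (fun w' f'' => cub u' v' w' *:
     (rgen a1 e * rgen v1 f * (rgen a2 e' * rgen v2 f' * (rgen a3 e'' * rgen v3 f'')))))))))
  .
Proof.
rewrite /tri (adsum_rgen_mul a1 v1 (F := fun u r => adsum c (fun v e' => adsum d (fun w e'' =>
    cub u v w *: (r * (rgen (a2 * v2) e' * rgen (a3 * v3) e''))))));
  last by split=> ?; lint.
apply: adsum_ext => u e.
transitivity (adsum u (fun u' f => adsum c (fun v e' => adsum v (fun v' f' =>
   adsum d (fun w e'' => adsum w (fun w' f'' => cub u' v' w' *:
     (rgen a1 e * rgen v1 f * (rgen a2 e' * rgen v2 f' * (rgen a3 e'' * rgen v3 f''))))))))).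
  apply: adsum_ext => u' f.
  rewrite (adsum_rgen_mul a2 v2 (F := fun v r => adsum d (fun w e'' =>
    cub u' v w *: (rgen a1 e * rgen v1 f * (r * rgen (a3 * v3) e'')))));
    last by split=> ?; lint.
  apply: adsum_ext => v e'; apply: adsum_ext => v' f'.
  by rewrite (adsum_rgen_mul a3 v3 (F := fun w r =>
    cub u' v' w *: (rgen a1 e * rgen v1 f * (rgen a2 e' * rgen v2 f' * r))));
    last by split=> ?; lint.
rewrite adsum_exch; apply: adsum_ext => v e'; rewrite [RHS]adsum_exch.
by apply: adsum_ext => u' f; rewrite [RHS]adsum_exch.
Qed.

Lemma hsum_adsum_exch (W : lmodType K) (x : helt A) b (f : helt A -> helt A -> B -> B -> W) :
  hsum x (fun a c => adsum b (f a c)) = adsum b (fun u e => hsum x (fun a c => f a c u e)).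
Proof. exact: exchange_big. Qed.

Lemma mul_swap (C : algType K) (x y z w : C) (k : K) :
  y * z = k *: (z * y) -> (x * y) * (z * w) = k *: ((x * z) * (y * w)).
Proof. by move=> h; rewrite -!mulrA [y * (z * w)]mulrA h -scalerAl -scalerAr -!mulrA. Qed.

(** The coefficients that the three factors v1, v2, v3 receive are collected into one
    generator by the rule for x_(bc); the invariance of the cubic form replaces
    them by the unit. *)
Lemma tri_inv b c d (a1 a2 a3 v : helt A) :
  hsum v (fun v1 V => hsum V (fun v2 v3 =>
     ksign K (deg v1 * (deg a2 + deg a3) + deg v2 * deg a3) *:
     tri (el a1 * el v1) (el a2 * el v2) (el a3 * el v3) b c d)) =
  counit (el v) *: tri (el a1) (el a2) (el a3) b c d.
Proof.
transitivity (hsum v (fun v1 V => hsum V (fun v2 v3 =>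
  adsum b (fun u e => adsum c (fun v e' => adsum d (fun w e'' =>
    adsum u (fun u' f => adsum v (fun v' f' => adsum w (fun w' f'' => cub u' v' w' *:
     ((a1 @ e * (a2 @ e' * a3 @ e'')) * (v1 @ f * (v2 @ f' * v3 @ f'')))))))))))).
  apply: hsum_ext => v1 V _; apply: hsum_ext => v2 v3 _; rewrite tri_mul.
  rewrite -[in RHS](ksignK (deg v1 * (deg a2 + deg a3) + deg v2 * deg a3) (adsum _ _)).
  congr (_ *: _); rewrite /adsum scaler_sumr; apply: eq_bigr => -[u e] _.
  rewrite scaler_sumr; apply: eq_bigr => -[p e'] _.
  rewrite scaler_sumr; apply: eq_bigr => -[w e''] _.
  rewrite scaler_sumr; apply: eq_bigr => -[u' f] _.
  rewrite scaler_sumr; apply: eq_bigr => -[p' f'] _.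
  rewrite scaler_sumr; apply: eq_bigr => -[w' f''] _ /=.
  rewrite scaleC; congr (_ *: _).
  have c1 := rep_comm (rgen_homog v1 f) (homogM _ _ _ _ (rgen_homog a2 e') (rgen_homog a3 e'')).
  have c2 := rep_comm (rgen_homog v2 f') (rgen_homog a3 e'').
  rewrite (mul_swap _ _ c2) -scalerAr (mul_swap _ _ c1) ksignZ.
  by congr (_ *: _); sgn.
transitivity (adsum b (fun u e => adsum c (fun p e' => adsum d (fun w e'' =>
   (a1 @ e * (a2 @ e' * a3 @ e'')) * v @ (cub u p w *: 1))))).
  transitivity (adsum b (fun u e => adsum c (fun p e' => adsum d (fun w e'' =>
    adsum u (fun u' f => adsum p (fun p' f' => adsum w (fun w' f'' =>
    hsum v (fun v1 V => hsum V (fun v2 v3 => cub u' p' w' *: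
     ((a1 @ e * (a2 @ e' * a3 @ e'')) * (v1 @ f * (v2 @ f' * v3 @ f'')))))))))))).
    do 6!(under hsum_ext => v1 V _ do rewrite hsum_adsum_exch; rewrite hsum_adsum_exch;
      apply: adsum_ext => ? ?).
    by [].
  apply: adsum_ext => u e; apply: adsum_ext => p e'; apply: adsum_ext => w e''.
  set X : R := a1 @ e * _; pose g z : R := X * v @ z.
  have gl : lin eB g by rewrite /g; lint.
  rewrite -(cubic_inv B_ungraded B_comm t_trace) -/(g _) /adsum (linsum _ _ _ gl).
  apply: eq_bigr => -[u' f] _; rewrite (linsum _ _ _ gl).
  apply: eq_bigr => -[p' f'] _; rewrite (linsum _ _ _ gl).
  apply: eq_bigr => -[w' f''] _ /=; rewrite (linZ _ _ gl) /g -mulrA rgen_mulr.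
  rewrite (hsum_app v (g := fun z => X * z)); last by lint.
  rewrite hsum_scale; apply: hsum_ext => v1 V _; rewrite rgen_mulr.
  rewrite (hsum_app V (g := fun z => X * (v1 @ f * z))); last by lint.
  by rewrite hsum_scale.
rewrite /tri /adsum scaler_sumr; apply: eq_bigr => -[u e] _.
rewrite scaler_sumr; apply: eq_bigr => -[p e'] _.
rewrite scaler_sumr; apply: eq_bigr => -[w e''] _ /=.
by rewrite rgenZr rgen1r -!scalerAr mulr1 scaleC.
Qed.

Lemma adsum_push (V W : lmodType K) (g : V -> W) b (f : B -> B -> V) :
  lin (@elin K V) g -> g (adsum b f) = adsum b (fun u e => g (f u e)).
Proof. exact: linsum. Qed.

Lemma duo_mul (a1 a2 v1 v2 : A) b c : duo (a1 * v1) (a2 * v2) b c =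
  adsum b (fun u e => adsum c (fun v e' => adsum u (fun u' f => adsum v (fun v' f' =>
     beta u' v' *: (rgen a1 e * rgen v1 f * (rgen a2 e' * rgen v2 f')))))).
Proof.
rewrite /duo (adsum_rgen_mul a1 v1 (F := fun u r => adsum c (fun v e' =>
    beta u v *: (r * rgen (a2 * v2) e')))); last by split=> ?; lint.
apply: adsum_ext => u e; rewrite [RHS]adsum_exch; apply: adsum_ext => u' f.
by rewrite (adsum_rgen_mul a2 v2 (F := fun v r => beta u' v *: (rgen a1 e * rgen v1 f * r)));
  last by split=> ?; lint.
Qed.

Lemma duo_inv b c (a1 a2 v : helt A) :
  hsum v (fun v1 v2 => ksign K (deg v1 * deg a2) *:
     duo (el a1 * el v1) (el a2 * el v2) b c) =
  counit (el v) *: duo (el a1) (el a2) b c.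
Proof.
transitivity (hsum v (fun v1 v2 => adsum b (fun u e => adsum c (fun v e' =>
    adsum u (fun u' f => adsum v (fun v' f' => beta u' v' *:
     ((a1 @ e * a2 @ e') * (v1 @ f * v2 @ f')))))))).
  apply: hsum_ext => v1 v2 _; rewrite duo_mul.
  rewrite -[in RHS](ksignK (deg v1 * deg a2) (adsum _ _)).
  congr (_ *: _); rewrite /adsum scaler_sumr; apply: eq_bigr => -[u e] _.
  rewrite scaler_sumr; apply: eq_bigr => -[p e'] _.
  rewrite scaler_sumr; apply: eq_bigr => -[u' f] _.
  rewrite scaler_sumr; apply: eq_bigr => -[p' f'] _ /=.
  by rewrite scaleC (mul_swap _ _ (rep_comm (rgen_homog v1 f) (rgen_homog a2 e'))).
transitivity (adsum b (fun u e => adsum c (fun p e' => (a1 @ e * a2 @ e') * v @ (beta u p *: 1)))).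
  rewrite hsum_adsum_exch; apply: adsum_ext => u e; rewrite hsum_adsum_exch;
    apply: adsum_ext => p e'.
  set X : R := a1 @ e * _; pose g z : R := X * v @ z.
  have gl : lin eB g by rewrite /g; lint.
  rewrite -(beta_inv B_ungraded B_comm t_trace) -/(g _) hsum_adsum_exch (adsum_push _ _ gl).
  apply: adsum_ext => u' f; rewrite (adsum_push _ _ gl) hsum_adsum_exch.
  apply: adsum_ext => p' f'; rewrite (linZ _ _ gl) /g rgen_mulr.
  by rewrite (hsum_app v (g := fun z => X * z)) ?hsum_scale //; lint.
rewrite /duo /adsum scaler_sumr; apply: eq_bigr => -[u e] _.
rewrite scaler_sumr; apply: eq_bigr => -[p e'] _ /=.
by rewrite rgenZr rgen1r -!scalerAr mulr1 scaleC.
Qed.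

(** The lemmas on invariant trilinear forms apply to duo once a third slot,
    evaluated by the counit, is added. *)
Section DuoT.
Variables b c : B.
Let T (a1 a2 a3 : A) : R := counit a3 *: duo a1 a2 b c.
Let T1 a2 a3 : lin eA (fun a1 => T a1 a2 a3). Proof. by rewrite /T; lint. Qed.
Let T2 a1 a3 : lin eA (fun a2 => T a1 a2 a3). Proof. by rewrite /T; lint. Qed.
Let T3 a1 a2 : lin eA (T a1 a2). Proof. by rewrite /T; lint. Qed.

Let T_inv (a1 a2 a3 v : helt A) :
  hsum v (fun v1 V => hsum V (fun v2 v3 =>
     ksign K (deg v1 * (deg a2 + deg a3) + deg v2 * deg a3) *:
     T (el a1 * el v1) (el a2 * el v2) (el a3 * el v3))) =
  counit (el v) *: T (el a1) (el a2) (el a3).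
Proof.
rewrite /T [RHS]scaleC -duo_inv hsum_scale; apply: hsum_ext => v1 V _.
apply: (hsum_collapser (F := fun v2 => counit (el a3) *: (ksign K (deg v1 * deg a2) *:
   duo (el a1 * el v1) (el a2 * el v2) b c))).
  by lint.
move=> v2 v3 _; rewrite counitM [counit (el a3) * _]mulrC -scalerA scaleC.
apply: counit_if => h; rewrite scaleC; apply: counit_if => h3.
by congr (_ *: _); sgn.
Qed.

Lemma duo_s (a1 a2 v : helt A) : duo (el a1 * antipode (el v)) (el a2) b c =
  ksign K (deg v * deg a2) *: duo (el a1) (el a2 * el v) b c.
Proof.
have := T_antipode T1 T2 T3 T_inv a1 a2 hone v; rewrite /T /= counit1 scale1r => ->.
apply: (hsum_collapser (F := fun v1 =>
  ksign K (deg v * deg a2) *: duo (el a1) (el a2 * el v1) b c)).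
  by lint.
by move=> v1 v2 _; rewrite mul1r mulr0 addr0 scaleC.
Qed.

Lemma duo_m (a1 a2 v : helt A) : duo (el a1 * el v) (el a2) b c =
  ksign K (deg v * deg a2) *: duo (el a1) (el a2 * antipode (el v)) b c.
Proof. by rewrite -(duo_s a1 a2 (hs v)) /= antipodeK. Qed.
End DuoT.

Lemma duo_uno (a : A) b c : duo a 1 b c = uno a b c.
Proof.
apply: adsum_ext => u e; rewrite -[RHS](adsum_counit c (f := fun v => beta u v *: (rgen a e : R)));
  last by lint.
by apply: adsum_ext => v e'; rewrite rgen1l -scalerAr mulr1 scaleC.
Qed.

Lemma duo1 (a : A) b c : duo 1 a b c = adsum c (fun v e => beta b v *: rgen a e).
Proof.
rewrite /duo adsum_exch; apply: adsum_ext => v e'.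
rewrite -[RHS](adsum_counit b (f := fun u => beta u v *: (rgen a e' : R))); last by lint.
by apply: adsum_ext => u e; rewrite rgen1l -scalerAl mul1r scaleC.
Qed.

Lemma duoC (a1 a2 : helt A) b c : duo (el a1) (el a2) b c =
  ksign K (deg a1 * deg a2) *: duo (el a2) (el a1) c b.
Proof.
rewrite /duo adsum_exch /adsum scaler_sumr; apply: eq_bigr => v _; rewrite scaler_sumr.
apply: eq_bigr => u _; rewrite (betaC t_trace) scaleC.
by rewrite -(rep_comm (rgen_homog _ _) (rgen_homog _ _)).
Qed.

Lemma tri1 (a2 a3 : A) b c d : tri 1 a2 a3 b c d =
  adsum c (fun v e' => adsum d (fun w e'' => cub b v w *: (rgen a2 e' * rgen a3 e''))).
Proof.
rewrite /tri adsum_exch; apply: adsum_ext => v e'; rewrite adsum_exch; apply: adsum_ext => w e''.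
rewrite -[RHS](adsum_counit b (f := fun u => cub u v w *: (rgen a2 e' * rgen a3 e'' : R)));
  last by lint.
by apply: adsum_ext => u e; rewrite rgen1l -scalerAl mul1r scaleC.
Qed.

Lemma tri_cycle (a1 a2 a3 : helt A) b c d : tri (el a1) (el a2) (el a3) c d b =
  ksign K (deg a3 * (deg a1 + deg a2)) *: tri (el a3) (el a1) (el a2) b c d.
Proof.
rewrite /tri; transitivity (adsum b (fun w e'' => adsum c (fun u e => adsum d (fun v e' =>
   cub u v w *: (a1 @ e * (a2 @ e' * a3 @ e''))))) : R).
  by rewrite [RHS]adsum_exch; apply: adsum_ext => u e; rewrite [RHS]adsum_exch.
rewrite /adsum scaler_sumr; apply: eq_bigr => -[w e''] _.
rewrite scaler_sumr; apply: eq_bigr => -[u e] _.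
rewrite scaler_sumr; apply: eq_bigr => -[v e'] _ /=.
rewrite (cubic_cycle B_ungraded B_comm t_trace w u v) scaleC mulrA; congr (_ *: _).
rewrite (rep_comm (homogM _ _ _ _ (rgen_homog a1 e) (rgen_homog a2 e')) (rgen_homog a3 e'')).
by congr (_ *: _); sgn.
Qed.

(** * The bracket of two generators *)

Variables (n : int) (rho : A -> A -> A) (br : R -> R -> R).
Hypothesis rho2 : is_bilinear rho.
Hypothesis rho_homog : forall p q x y, homog p x -> homog q y -> homog (p + q + n) (rho x y).
Hypothesis br_formula : rep_bracket_formula n rho (trace_pairing t) br.
Notation r_ := (hrho rho_homog).

Ltac lint_rho lint := lazymatch goal with
  | |- @hmorph _ _ _ _ (fun x => r_ (@?lg x) (@?lh x)) =>
      tryif depends lg then refine (@hmorph_rhol _ _ _ _ rho2 _ _ _ lg _ _)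
      else refine (@hmorph_rhor _ _ _ _ rho2 _ _ _ lh _ _); lint
  | |- @hmorph _ _ _ _ (r_ _) => refine (hmorph_rhor rho2 _ _ _); lint
  | _ => lint_slots lint
  end.

Ltac lint_ext lint ::= lint_rho lint.

Lemma sw2_csum (W : lmodType K) (b : B) (f : B -> B -> W) : lin2 eB eB f ->
  \sum_(u <- sw2 b) f (el u.1) (el u.2) = csum b f.
Proof.
move=> f2; rewrite -(hsum_csum_el (hb B_ungraded b) f2) -hsum_sw2 //; lint.
Qed.

(** The coefficients s(b^(3)) b^(1) of the defining formula are those of the coadjoint
    coaction on the first three components of b. *)
Lemma br_rgen (x y : helt A) (b c : B) : br (x @ b) (y @ c) =
  hsum x (fun x1 x2 => hsum y (fun y1 y2 => ksign K (deg x2 * (deg y1 + n)) *: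
    csum b (fun b1 b2 => csum c (fun c1 c2 =>
      uno (el (r_ x1 y1)) b1 c2 * x2 @ b2 * y2 @ c1)))).
Proof.
rewrite br_formula -hsum_sw2; last by lint.
apply: eq_bigr => -[x1 x2] _; rewrite -hsum_sw2; last by lint.
apply: eq_bigr => -[y1 y2] _ /=.
pose F b1 b2 b3 b4 (c1 c2 : B) : R := beta c2 b2 *:
    (rgen (rho (el x1) (el y1)) (antipode b3 * b1) * x2 @ b4 * y2 @ c1).
transitivity (ksign K (deg x2 * (deg y1 + n)) *: \sum_(u <- sw2 b) \sum_(v <- sw2 (el u.2))
   \sum_(w <- sw2 (el v.2)) \sum_(e <- sw2 c)
   F (el u.1) (el v.1) (el w.1) (el w.2) (el e.1) (el e.2)).
  rewrite /sw4 /sw3 !big_allpairs_dep scaler_sumr; apply: eq_bigr => u _.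
  rewrite scaler_sumr; apply: eq_bigr => v _ /=.
  rewrite scaler_sumr; apply: eq_bigr => w _; rewrite scaler_sumr.
  by apply: eq_bigr => -[c1 c2] _; rewrite /F scalerA.
congr (_ *: _).
pose G b1 b2 b3 b4 := csum c (F b1 b2 b3 b4).
transitivity (csum b (fun b1 y => csum y (fun b2 z => csum z (fun b3 b4 => G b1 b2 b3 b4)))).
  rewrite -sw2_csum; last by rewrite /G /F; lint.
  apply: eq_bigr => u _; rewrite -sw2_csum; last by rewrite /G /F; lint.
  apply: eq_bigr => v _; rewrite -sw2_csum; last by rewrite /G /F; lint.
  apply: eq_bigr => w _; rewrite -[RHS]sw2_csum //; last by rewrite /F; lint.
transitivity (csum b (fun B1 b4 => csum B1 (fun b1 y' => csum y' (fun b2 b3 => G b1 b2 b3 b4)))).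
  rewrite (csum_coassoc b (f := fun b1 y' b4 => csum y' (fun b2 b3 => G b1 b2 b3 b4)));
    try by rewrite /G /F; lint.
  apply: csum_ext => b1 y'.
  by rewrite (csum_coassoc y' (f := fun b2 b3 b4 => G b1 b2 b3 b4)) //; rewrite /G /F; lint.
apply: csum_ext => B1 b4; rewrite /G.
transitivity (csum c (fun c1 c2 => csum B1 (fun b1 y' => csum y' (fun b2 b3 =>
  F b1 b2 b3 b4 c1 c2)))).
  by rewrite [RHS]csum_exch; apply: csum_ext => ? ?; rewrite csum_exch.
apply: csum_ext => c1 c2; rewrite /uno adsumE /csum !mulr_suml; apply: eq_bigr => u _.
rewrite !mulr_suml; apply: eq_bigr => v _.
by rewrite /F -!scalerAl (betaC t_trace) (mulBC B_ungraded).
Qed.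

Lemma act_uno (y a : helt A) b c :
  act (el y) (uno (el a) b) c = ksign K (deg a * deg y) *: duo (el a) (el y) b c.
Proof.
rewrite /act /uno /duo adsum_exch /adsum scaler_sumr; apply: eq_bigr => v _.
rewrite mulr_sumr scaler_sumr; apply: eq_bigr => u _.
rewrite -scalerAr scaleC; congr (_ *: _).
rewrite (rep_comm (rgen_homog y _) (rgen_homog a _)).
by congr (_ *: _); sgn.
Qed.

(** The coefficient of x''_b'' y''_c'' in the bracket of x_b and y_c. *)
Definition duocore (x y : helt A) (b c : B) : R :=
  hsum y (fun y1 y2 => duo (el (r_ x y1)) (el y2) b c).

Lemma lin_duocore1 (D : Type) (E : K -> D -> D -> D -> Prop) (F : D -> helt A) y b c :
  hmorph E F -> lin E (fun x => duocore (F x) y b c).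
Proof. by move=> hF; rewrite /duocore; lint. Qed.

Lemma lin_duocore2 (D : Type) (E : K -> D -> D -> D -> Prop) (F : D -> helt A) y b c :
  hmorph E F -> lin E (fun x => duocore y (F x) b c).
Proof. by move=> hF; rewrite /duocore; lint. Qed.

Lemma lin_duocore3 (D : Type) (E : K -> D -> D -> D -> Prop) (F : D -> B) x y c :
  lin E F -> lin E (fun b => duocore x y (F b) c).
Proof. by move=> hF; rewrite /duocore; lint. Qed.

Ltac lint_duocore lint := lazymatch goal with
  | |- @lin _ _ _ _ (fun x => duocore (@?lg x) (@?lh x) (@?lk x) _) =>
      tryif depends lg then refine (lin_duocore1 (F:=lg) _ _ _ _)
      else tryif depends lh then refine (lin_duocore2 (F:=lh) _ _ _ _)
      else refine (lin_duocore3 (F:=lk) _ _ _ _); lint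
  | _ => lint_rho lint
  end.

Ltac lint_ext lint ::= lint_duocore lint.

(** The component y'' at c' in the bracket is split once more: a part of it acts on
    the slot of c, which puts the components of c in the other order
    (act_translate). *)
Lemma uno_core p (M : R) (x y : helt A) (b c : B) : homog p M ->
  hsum y (fun y1 Y => ksign K (p * deg y1) *: csum c (fun c1 c2 =>
    uno (el (r_ x y1)) b c2 * M * Y @ c1)) =
  hsum y (fun y1 y2 => ksign K (p * deg y1) *: csum c (fun c1 c2 =>
    duocore x y1 b c1 * M * y2 @ c2)).
Proof.
move=> hM.
pose F y1 y2 y3 := ksign K (p * (deg y1 + deg y2)) *: csum c (fun c1 c2 =>
    duo (el (r_ x y1)) (el y2) b c1 * M * y3 @ c2).
transitivity (hsum y (fun y1 Y => hsum Y (fun y2 y3 => F y1 y2 y3))).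
  apply: hsum_ext => y1 Y ey.
  pose m c0 := uno (el (r_ x y1)) b c0 * M.
  rewrite -/(csum c (fun c1 c2 => m c2 * Y @ c1)).
  rewrite -(act_translate (p := deg (r_ x y1) + p) Y (m := m)).
  - rewrite hsum_scale; apply: hsum_ext => y2 y3 _; rewrite ksignZ /F /csum !scaler_sumr.
    apply: eq_bigr => -[c1 c2] _ /=.
    have -> : act (el y2) m c1 = act (el y2) (uno (el (r_ x y1)) b) c1 * M.
      by rewrite /act /adsum mulr_suml; apply: eq_bigr => w _; rewrite /m mulrA.
    by rewrite act_uno -!scalerAl ksignZ; congr (_ *: _); sgn.
  - by rewrite /m; lint.
  by move=> c0; apply: homogM; [apply: uno_homog | ].
rewrite -(hsum_coassoc y (F := F)); try by rewrite /F; lint.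
apply: hsum_ext => Y y3 ey; rewrite /duocore /F.
transitivity (hsum Y (fun y1 y2 => ksign K (p * deg Y) *:
  csum c (fun c1 c2 => duo (el (r_ x y1)) (el y2) b c1 * M * y3 @ c2))).
  by apply: hsum_ext => y1 y2 ->.
rewrite -hsum_scale; congr (_ *: _); rewrite hsum_csum_exch; apply: csum_ext => c1 c2.
by rewrite (hsum_app Y (g := fun z => z * M * y3 @ c2)) //; lint.
Qed.

Lemma br_rgen_core (x y : helt A) (b c : B) : br (x @ b) (y @ c) =
  hsum x (fun x1 x2 => hsum y (fun y1 y2 => ksign K (deg x2 * (deg y1 + n)) *:
    csum b (fun b1 b2 => csum c (fun c1 c2 =>
      duocore x1 y1 b1 c1 * x2 @ b2 * y2 @ c2)))).
Proof.
rewrite br_rgen; apply: hsum_ext => x1 x2 ex.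
pose G (f : helt A -> helt A -> B -> B -> R) := csum b (fun b1 b2 =>
  ksign K (deg x2 * n) *: hsum y (fun y1 y2 => ksign K (deg x2 * deg y1) *: f y1 y2 b1 b2)).
have GE f : hsum y (fun y1 y2 => ksign K (deg x2 * (deg y1 + n)) *: csum b (f y1 y2)) = G f.
  transitivity (hsum y (fun y1 y2 => csum b (fun b1 b2 =>
    ksign K (deg x2 * (deg y1 + n)) *: f y1 y2 b1 b2))).
    by apply: hsum_ext => y1 y2 _; rewrite /csum scaler_sumr.
  rewrite hsum_csum_exch; apply: csum_ext => b1 b2; rewrite hsum_scale; apply: hsum_ext => y1 y2 _.
  by rewrite ksignZ; congr (_ *: _); sgn.
rewrite !GE; apply: csum_ext => b1 b2; congr (_ *: _).
exact/uno_core/rgen_homog.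
Qed.

Lemma duocore_homog (x y : helt A) b c : homog (deg x + deg y + n) (duocore x y b c).
Proof.
apply: homog_sum => -[y1 y2] /= /eqP <-.
rewrite (_ : _ + _ = deg (r_ x y1) + deg y2); first exact: duo_homog.
by rewrite /= !addrA [LHS]addrAC.
Qed.

Hypothesis rhoMr : forall x y z, rho x (y * z) = rho x y * z + counit y *: rho x z.
Hypothesis rhoMl : forall x y z, rho (x * y) z = counit y *: rho x z + x * rho y z.

Lemma rho1l z : rho 1 z = 0.
Proof.
have := rhoMl 1 1 z; rewrite !mul1r counit1 scale1r => h.
by apply: (addIr (rho 1 z)); rewrite add0r -h.
Qed.

Lemma rho1r z : rho z 1 = 0.
Proof.
have := rhoMr z 1 1; rewrite !mulr1 counit1 scale1r => h.
by apply: (addIr (rho z 1)); rewrite add0r -h.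
Qed.

Lemma rho_sl (y : helt A) z : rho (antipode (el y)) z =
  - hsum y (fun y1 y2 => antipode (el y1) * rho (el y2) z).
Proof.
have rl := rho2.1 z.
have := hsum_antipodel y (F := fun v => rho (el v) z); rewrite /= rho1l scaler0 => h.
have {h} : hsum y (fun a b => rho (antipode (el a) * el b) z) = 0 by apply: h; lint.
have -> : hsum y (fun a b => rho (antipode (el a) * el b) z) =
    hsum y (fun y1 y2 => counit (el y2) *: rho (antipode (el y1)) z) +
    hsum y (fun y1 y2 => antipode (el y1) * rho (el y2) z).
  by rewrite hsum_add; apply: hsum_ext => y1 y2 _; rewrite rhoMl.
rewrite (hsum_counitr y (F := fun v => rho (antipode (el v)) z)); last by lint.
by move/eqP; rewrite addr_eq0 => /eqP.
Qed.

Lemma rho_sr (x : helt A) z : rho z (antipode (el x)) =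
  - hsum x (fun x1 x2 => rho z (el x1) * antipode (el x2)).
Proof.
have := hsum_antipoder x (F := fun v => rho z (el v)); rewrite /= rho1r scaler0 => h.
have {h} : hsum x (fun a b => rho z (el a * antipode (el b))) = 0 by apply: h; lint.
have -> : hsum x (fun a b => rho z (el a * antipode (el b))) =
    hsum x (fun x1 x2 => rho z (el x1) * antipode (el x2)) +
    hsum x (fun x1 x2 => counit (el x1) *: rho z (antipode (el x2))).
  by rewrite hsum_add; apply: hsum_ext => x1 x2 _; rewrite rhoMr.
rewrite (hsum_counitl x (F := fun v => rho z (antipode (el v)))); last by lint.
by rewrite addrC => /eqP; rewrite addr_eq0 => /eqP.
Qed.

Lemma antipode_invol : involutive (@antipode K A).
Proof.
move=> x; rewrite {1}(hdecE x) !linear_sum [RHS](hdecE x).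
by apply: eq_bigr => a _ /=; rewrite (antipodeK A_cocomm).
Qed.

Hypothesis rho_anti : antisymmetric_fox n rho.

(** Antisymmetry with the antipodes of the arguments expanded by the Fox rules for
    ρ(s(y), -) and ρ(-, s(x)). *)
Lemma rho_flip (x y : helt A) : rho (el x) (el y) =
  - (ksign K ((deg x + n) * (deg y + n)) *: hsum y (fun y1 y2 => hsum x (fun x1 x2 =>
     ksign K (deg y1 * (deg (r_ y2 x1) + deg x2) + deg (r_ y2 x1) * deg x2) *:
     (el x2 * antipode (el (r_ y2 x1)) * el y1)))).
Proof.
have := rho_anti (elP x) (elP y).
rewrite (finv_eq _ (can_inj antipode_invol) (antipode_invol _)) => h.
rewrite -[LHS]opprK -h; congr (- (_ *: _)).
rewrite rho_sl linearN /= (hsum_app y _ (lin_antipode (@lin_id K A))) hsum_opp.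
apply: hsum_ext => y1 y2 _.
rewrite rho_sr mulrN linearN /= opprK.
rewrite (hsum_app x (g := fun z => antipode (antipode (el y1) * z))); last by lint.
apply: hsum_ext => x1 x2 _.
rewrite (antipode_mul (hs y1) (hmul (r_ y2 x1) (hs x2))) /= (antipodeK A_cocomm).
rewrite (antipode_mul (r_ y2 x1) (hs x2)) /= (antipodeK A_cocomm).
by rewrite -scalerAl ksignZ; congr (_ *: _); sgn.
Qed.

(** In the expansion of ρ(x, y') by rho_flip, the component of y to the right of ρ is
    moved to the second slot, where it cancels with another component of y; what
    is left has the two slots exchanged. *)
Lemma duocore_anti (x y : helt A) (b c : B) :
  duocore x y b c = - (ksign K ((deg x + n) * (deg y + n)) *: duocore y x c b).
Proof.
pose F y1 y2 y3 := hsum x (fun x1 x2 =>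
  ksign K ((deg x + n) * (deg y1 + deg y2 + n) + deg y1 * (deg (r_ y2 x1) + deg x2)
     + deg (r_ y2 x1) * deg x2 + deg y1 * deg y3) *:
  duo (el (hmul x2 (hs (r_ y2 x1)))) (el y3 * antipode (el y1)) b c).
transitivity (- hsum y (fun Y y3 => hsum Y (fun y1 y2 => F y1 y2 y3))).
  rewrite /duocore hsum_opp; apply: hsum_ext => Y y3 eY.
  pose g (z : A) : R := duo z (el y3) b c.
  have gl : lin eA g by rewrite /g; lint.
  rewrite -[LHS]/(g _) /= rho_flip -scaleN1r (linZ _ _ gl) scaleN1r (linZ _ _ gl).
  congr (- _); rewrite (hsum_app Y _ gl) hsum_scale; apply: hsum_ext => y1 y2 ey.
  rewrite (hsum_app x _ gl) hsum_scale; apply: hsum_ext => x1 x2 ex.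
  rewrite (linZ _ _ gl) /g (duo_m b c (hmul x2 (hs (r_ y2 x1))) y3 y1).
  by rewrite !ksignZ; congr (_ *: _); sgn.
rewrite (hsum_coassoc y (F := F)); try by rewrite /F; lint.
congr (- _).
transitivity (hsum y (fun y1 Z => hsum Z (fun y3 y2 => ksign K (deg y3 * deg y2) *: F y1 y2 y3))).
  by apply: hsum_ext => y1 Z _; apply: (hsum_cocomm Z A_cocomm); rewrite /F; lint.
rewrite -(hsum_coassoc y (F := fun y1 y3 y2 => ksign K (deg y3 * deg y2) *: F y1 y2 y3));
  try by rewrite /F; lint.
rewrite /duocore hsum_scale.
apply: (hsum_collapsel (F := fun y2 => hsum x (fun x1 x2 =>
   ksign K ((deg x + n) * (deg y2 + n)) *: duo (el (r_ y2 x1)) (el x2) c b))).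
  by lint.
move=> P y2 ey.
pose G w := hsum x (fun x1 x2 => ksign K ((deg x + n) * (deg y2 + n)
    + deg P * deg y2 + deg (r_ y2 x1) * deg x2) *:
  duo (el (hmul x2 (hs (r_ y2 x1)))) (el w) b c).
rewrite (hsum_antipoder_swap A_cocomm (F := G)); first last.
- move=> y1 y3 eP; rewrite /F /G !hsum_scale; apply: hsum_ext => x1 x2 ex.
  rewrite !ksignZ; congr (_ *: _); sgn.
- by rewrite /G; lint.
rewrite /G !hsum_scale; apply: hsum_ext => x1 x2 ex.
rewrite (duo_s b c x2 hone (r_ y2 x1)) /= mul1r.
rewrite (duoC x2 (r_ y2 x1)) !ksignZ /=.
apply: counit_sgn => hP; parity_tauto.
Qed.

Lemma br_rgen_anti (x y : helt A) (b c : B) : br (x @ b) (y @ c) =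
  - (ksign K ((deg x + n) * (deg y + n)) *: br (y @ c) (x @ b)).
Proof.
rewrite !br_rgen_core hsum_exch hsum_scale hsum_opp; apply: hsum_ext => y1 y2 ey.
rewrite hsum_scale hsum_opp; apply: hsum_ext => x1 x2 ex.
rewrite csum_exch /csum ksignZ !scaler_sumr -sumrN; apply: eq_bigr => -[c1 c2] _.
rewrite !scaler_sumr -sumrN; apply: eq_bigr => -[b1 b2] _ /=.
rewrite duocore_anti !mulNr -!scalerAl -!mulrA.
rewrite (rep_comm (rgen_homog x2 b2) (rgen_homog y2 c2)).
by rewrite -scalerAr scalerN !ksignZ; congr (- (_ *: _)); sgn.
Qed.

(** * The double bracket of generators *)

(** The cubic form arises here: duo is a derivation in the coefficient e, so
    that the coaction on b acts by a commutator (adsum_deriv). *)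
Lemma adsum_duo_uno (a Z : helt A) b c d :
  adsum b (fun u e => duo 1 (el Z) e d * uno (el a) u c) =
  ksign K (deg Z * deg a) *: tri 1 (antipode (el a)) (el Z) b c d.
Proof.
rewrite adsum_deriv; first last.
- move=> u e e'; rewrite !(duo1) /adsum !mulr_suml !scaler_sumr -big_split.
  apply: eq_bigr => w _ /=; rewrite (beta_mull t_trace) scalerDl mulrDl.
  by rewrite -!scalerAl -!scalerA.
- by lint.
have unoE u : uno (el a) u c = adsum c (fun v e' => beta u v *: rgen (antipode (el a)) e').
  rewrite -(duo1) -duo_uno -[el a]mul1r.
  by rewrite (duo_m u c hone hone a) /= mulr0 ksign0 scale1r !mul1r.
rewrite tri1; transitivity (csum b (fun b1 b2 => ksign K (deg Z * deg a) *:
   adsum c (fun v e' => adsum d (fun w e'' => (beta b1 w * beta b2 v - beta b2 w * beta b1 v) *: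
    (rgen (antipode (el a)) e' * Z @ e''))))).
  apply: csum_ext => b1 b2; rewrite !unoE !(duo1) /adsum !big_distrlr.
  rewrite exchange_big [X in _ - X]exchange_big -sumrB scaler_sumr.
  apply: eq_bigr => -[v e'] _; rewrite -sumrB scaler_sumr; apply: eq_bigr => -[w e''] _ /=.
  rewrite -!scalerAl -!scalerAr !scalerA -scalerBl.
  rewrite (rep_comm (rgen_homog Z e'') (rgen_homog (hs a) e')) /=.
  by rewrite scalerA; congr (_ *: _); apply: mulrC.
rewrite /csum -scaler_sumr; congr (_ *: _); rewrite /adsum exchange_big; apply: eq_bigr => v _.
rewrite exchange_big; apply: eq_bigr => w _ /=.
by rewrite -scaler_suml.
Qed.

Hypothesis br2 : is_bilinear br.

(** In the bracket of uno(a, b, c) with z_d: the argument a stands for a'', q for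
    ρ(a', w') and Z for w'', where w = z'. *)
Definition slot (a q Z : helt A) (b c d : B) : R :=
  ksign K (deg q * deg Z + (deg Z + deg q) * deg a) *:
    tri 1 (antipode (el a)) (el Z * antipode (el q)) b c d.

Lemma br_uno (a z : helt A) b c d : br (uno (el a) b c) (z @ d) =
  hsum a (fun a1 a2 => hsum z (fun z1 z2 => ksign K (deg a2 * (deg z1 + n)) *:
    csum d (fun d1 d2 => hsum z1 (fun w1 w2 => slot a2 (r_ a1 w1) w2 b c d1) * z2 @ d2))).
Proof.
have brl u : lin (@elin K R) (br^~ u) by move=> k x y _ ->; apply: br2.1.
rewrite /uno (adsum_push _ _ (brl _)).
pose f a1 a2 z1 z2 u e d1 d2 : R := beta u c *: (duocore a1 z1 e d1 * a2 @ d2).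
transitivity (hsum a (fun a1 a2 => hsum z (fun z1 z2 => ksign K (deg a2 * (deg z1 + n)) *:
    csum d (fun d1 d2 => adsum b (fun u e => csum e (fun e1 e2 =>
      beta u c *: (duocore a1 z1 e1 d1 * a2 @ e2))) * z2 @ d2)))).
  transitivity (adsum b (fun u e => hsum a (fun a1 a2 => hsum z (fun z1 z2 =>
    ksign K (deg a2 * (deg z1 + n)) *: csum d (fun d1 d2 => csum e (fun e1 e2 =>
      beta u c *: (duocore a1 z1 e1 d1 * a2 @ e2)) * z2 @ d2))))).
    apply: adsum_ext => u e; rewrite (linZ _ _ (brl _)).
    rewrite (br_rgen_core) hsum_scale; apply: hsum_ext => a1 a2 _.
    rewrite hsum_scale; apply: hsum_ext => z1 z2 _; rewrite scaleC; congr (_ *: _).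
    rewrite csum_exch /csum scaler_sumr; apply: eq_bigr => -[d1 d2] _.
    rewrite scaler_sumr mulr_suml; apply: eq_bigr => -[e1 e2] _ /=.
    by rewrite -scalerAl.
  rewrite -hsum_adsum_exch; apply: hsum_ext => a1 a2 _; rewrite -hsum_adsum_exch.
  apply: hsum_ext => z1 z2 _; rewrite /adsum /csum -scaler_sumr; congr (_ *: _).
  by rewrite exchange_big; apply: eq_bigr => w _; rewrite mulr_suml.
apply: hsum_ext => a1 a2 _; apply: hsum_ext => z1 z2 _; congr (_ *: _); apply: csum_ext => d1 d2.
congr (_ * _).
rewrite -(adsum_coaction B_ungraded b (f := fun u e1 e2 =>
  beta u c *: (duocore a1 z1 e1 d1 * a2 @ e2)));
  last by split=> ? ?; rewrite /duocore; lint.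
transitivity (adsum b (fun u e => hsum z1 (fun w1 w2 =>
   duo (el (r_ a1 w1)) (el w2) e d1 * uno (el a2) u c))).
  apply: adsum_ext => u e.
  transitivity (duocore a1 z1 e d1 * uno (el a2) u c).
    by rewrite /uno /adsum mulr_sumr; apply: eq_bigr => w _; rewrite scalerAr.
  by rewrite (hsum_app z1 (g := fun v => v * uno (el a2) u c)) //; lint.
rewrite -hsum_adsum_exch; apply: hsum_ext => w1 w2 _; rewrite /slot.
rewrite -ksignZ -(adsum_duo_uno a2 (hmul w2 (hs (r_ a1 w1)))) /adsum scaler_sumr.
apply: eq_bigr => u _; rewrite -[X in duo X]mul1r.
rewrite (duo_m _ _ hone w2 (r_ a1 w1)).
by rewrite -scalerAl.
Qed.

(** Filling the second slot is the action of A on the contraction in which this slot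
    is empty. *)
Lemma tri_act (v : A) (Z : A) b c d : tri 1 v Z b c d = act v (fun c' => tri 1 1 Z b c' d) c.
Proof.
rewrite /act (tri1); apply: adsum_ext => u e.
transitivity (rgen v e * (adsum d (fun w e'' => cub b u w *: rgen Z e'') : R)).
  by rewrite /adsum mulr_sumr; apply: eq_bigr => w _; rewrite scalerAr.
congr (_ * _); rewrite (tri1).
rewrite -(adsum_counit u (f := fun u => adsum d (fun w e'' => cub b u w *: rgen Z e'')));
  last by lint.
apply: adsum_ext => u' e'; rewrite /adsum scaler_sumr; apply: eq_bigr => w _.
by rewrite rgen1l -scalerAl mul1r scaleC.
Qed.

Lemma act_slot (y a q Z : helt A) b c d :
  act (el y) (fun c => slot a q Z b c d) c =
  ksign K (deg q * deg Z + (deg Z + deg q) * deg a) *: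
    tri 1 (el y * antipode (el a)) (el Z * antipode (el q)) b c d.
Proof.
rewrite [tri _ _ _ _ _ _]tri_act act_mul /=; last by lint.
rewrite /slot /act /adsum scaler_sumr; apply: eq_bigr => w _.
by rewrite tri_act scalerAr.
Qed.

Definition slots (a z : helt A) b c d : R :=
  hsum a (fun a1 a2 => ksign K (deg a2 * (deg z + n)) *:
    hsum z (fun w1 w2 => slot a2 (r_ a1 w1) w2 b c d)).

Lemma slots_homog a z b c d : homog (deg a + deg z + n) (slots a z b c d).
Proof.
apply: homog_sum => -[a1 a2] /= /eqP ea; apply: homogZ.
apply: homog_sum => -[w1 w2] /= /eqP ez; apply: homogZ.
have := tri_homog hone (hs a2) (hmul w2 (hs (r_ a1 w1))) b c d.
suff -> : deg (@hone K A) + (deg (hs a2) + deg (hmul w2 (hs (r_ a1 w1)))) = deg a + deg z + n.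
  by [].
rewrite /= -ea -ez; deg_norm; lia.
Qed.

Definition tricore (x y z : helt A) b c d : R :=
  core rho_homog (fun u v => tri 1 (el u) (el v) b c d) x y z.

(** As in uno_core, a component of y acts on the slot of c.  Cocommutativity of A
    then orders the components of y, of z and of ρ(x, y'') as they are in core. *)
Lemma slots_core p (N : R) (x y z : helt A) b c d : homog p N ->
  hsum y (fun y1 Y => ksign K ((deg z + n + p) * deg y1) *: csum c (fun c1 c2 =>
    slots (r_ x y1) z b c2 d * N * Y @ c1)) =
  hsum y (fun y1 y2 => ksign K ((deg z + n + p) * deg y1) *: csum c (fun c1 c2 =>
    tricore x y1 z b c1 d * N * y2 @ c2)).
Proof.
move=> hN.
pose G y1 y2 c1 : R := hsum (r_ x y1) (fun a1 a2 => hsum z (fun w1 w2 =>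
  ksign K ((deg z + n + p) * deg y1 + (deg (r_ x y1) + deg z + n + p) * deg y2
   + deg a2 * (deg z + n) + deg (r_ a1 w1) * deg w2 + (deg w2 + deg (r_ a1 w1)) * deg a2) *:
  tri 1 (el y2 * antipode (el a2)) (el w2 * antipode (el (r_ a1 w1))) b c1 d)).
pose F y1 y2 y3 := csum c (fun c1 c2 => G y1 y2 c1 * N * y3 @ c2).
transitivity (hsum y (fun y1 Y => hsum Y (fun y2 y3 => F y1 y2 y3))).
  apply: hsum_ext => y1 Y ey.
  pose m c0 := slots (r_ x y1) z b c0 d * N.
  rewrite -/(csum c (fun c1 c2 => m c2 * Y @ c1)).
  rewrite -(act_translate (p := deg (r_ x y1) + deg z + n + p) Y (m := m)).
  - rewrite hsum_scale; apply: hsum_ext => y2 y3 _; rewrite ksignZ /F /csum !scaler_sumr.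
    apply: eq_bigr => -[c1 c2] _ /=; rewrite scalerAl; congr (_ * _).
    transitivity (ksign K ((deg z + n + p) * deg y1 + (deg (r_ x y1) + deg z + n + p) * deg y2)
       *: act (el y2) (fun c => slots (r_ x y1) z b c d) c1 * N).
      by rewrite -scalerAl; congr (_ *: _); rewrite /act /adsum mulr_suml;
        apply: eq_bigr => w _; rewrite /m mulrA.
    rewrite /slots /G; congr (_ * _).
    transitivity (ksign K ((deg z + n + p) * deg y1 + (deg (r_ x y1) + deg z + n + p) * deg y2)
      *: hsum (r_ x y1) (fun a1 a2 => ksign K (deg a2 * (deg z + n)) *: hsum z (fun w1 w2 =>
         act (el y2) (fun c => slot a2 (r_ a1 w1) w2 b c d) c1))).
      congr (_ *: _); rewrite /act.
      transitivity (adsum c1 (fun u e => hsum (r_ x y1) (fun a1 a2 =>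
        ksign K (deg a2 * (deg z + n)) *: hsum z (fun w1 w2 =>
         y2 @ e * slot a2 (r_ a1 w1) w2 b u d)))).
        apply: adsum_ext => u e; rewrite /hsum mulr_sumr; apply: eq_bigr => a _.
        by rewrite -scalerAr mulr_sumr.
      rewrite -hsum_adsum_exch; apply: hsum_ext => a1 a2 _;
        by rewrite hsum_adsum_exch /adsum scaler_sumr.
    rewrite hsum_scale; apply: hsum_ext => a1 a2 _; rewrite !hsum_scale; apply: hsum_ext => w1 w2 _.
    by rewrite act_slot !ksignZ; congr (_ *: _); sgn.
  - by rewrite /m /slots /slot; lint.
  by move=> c0; apply: homogM; [apply: slots_homog | ].
rewrite -(hsum_coassoc y (F := F)); try by rewrite /F /G; lint.
apply: hsum_ext => Y y3 ey.
transitivity (hsum Y (fun y2 y1 => ksign K (deg y2 * deg y1) *: F y1 y2 y3)).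
  by apply: (hsum_cocomm Y A_cocomm); rewrite /F /G; lint.
transitivity (hsum Y (fun y2 y1 => csum c (fun c1 c2 =>
   ksign K (deg y2 * deg y1) *: G y1 y2 c1 * N * y3 @ c2))).
  apply: hsum_ext => y2 y1 _; rewrite /F /csum scaler_sumr; apply: eq_bigr => v _.
  by rewrite !scalerAl.
rewrite hsum_csum_exch /csum scaler_sumr; apply: eq_bigr => -[c1 c2] _ /=.
rewrite scalerAl scalerAl -(hsum_app Y (g := fun z => z * N * y3 @ c2)); last by lint.
congr (_ * _ * _); rewrite /tricore /core hsum_scale; apply: hsum_ext => u1 u2 eY.
rewrite /G hsum_exch !hsum_scale [RHS](hsum_cocomm z A_cocomm); last by lint.
apply: hsum_ext => w1 w2 ez; rewrite !hsum_scale.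
rewrite [RHS](hsum_cocomm (r_ x u2) A_cocomm); last by lint.
apply: hsum_ext => a1 a2 ea.
by rewrite /= !ksignZ; congr (_ *: _); sgn.
Qed.

Lemma br_slots (a z : helt A) b c d : br (uno (el a) b c) (z @ d) =
  hsum z (fun z1 z2 => csum d (fun d1 d2 => slots a z1 b c d1 * z2 @ d2)).
Proof.
rewrite br_uno hsum_exch; apply: hsum_ext => z1 z2 _.
transitivity (hsum a (fun a1 a2 => csum d (fun d1 d2 => ksign K (deg a2 * (deg z1 + n)) *:
   hsum z1 (fun w1 w2 => slot a2 (r_ a1 w1) w2 b c d1) * z2 @ d2))).
  apply: hsum_ext => a1 a2 _; rewrite /csum scaler_sumr; apply: eq_bigr => u _.
  by rewrite scalerAl.
rewrite hsum_csum_exch; apply: csum_ext => d1 d2; rewrite /slots.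
by rewrite [RHS](hsum_app a (g := fun v => v * z2 @ d2)) //; lint.
Qed.

Hypothesis brMl : forall p q r x y z, homog p x -> homog q y -> homog r z ->
  br (x * y) z = x * br y z + ksign K (q * (r + n)) *: (br x z * y).

(** The three terms of the Leibniz rule for the bracket of br_rgen with z_d: the
    generator z_d meets the contraction, x'' or y''. *)
Definition part1 (x y z : helt A) (b c d : B) : R :=
  hsum x (fun x1 x2 => hsum y (fun y1 y2 =>
    ksign K (deg x2 * (deg y1 + n) + (deg x2 + deg y2) * (deg z + n)) *:
    csum b (fun b1 b2 => csum c (fun c1 c2 =>
      br (uno (el (r_ x1 y1)) b1 c2) (z @ d) * x2 @ b2 * y2 @ c1)))).

Definition part2 (x y z : helt A) (b c d : B) : R :=
  hsum x (fun x1 x2 => hsum y (fun y1 y2 =>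
    ksign K (deg x2 * (deg y1 + n) + deg y2 * (deg z + n)) *:
    csum b (fun b1 b2 => csum c (fun c1 c2 =>
      uno (el (r_ x1 y1)) b1 c2 * br (x2 @ b2) (z @ d) * y2 @ c1)))).

Definition part3 (x y z : helt A) (b c d : B) : R :=
  hsum x (fun x1 x2 => hsum y (fun y1 y2 => ksign K (deg x2 * (deg y1 + n)) *:
    csum b (fun b1 b2 => csum c (fun c1 c2 =>
      uno (el (r_ x1 y1)) b1 c2 * x2 @ b2 * br (y2 @ c1) (z @ d))))).

Lemma br_br_rgen x y z b c d : br (br (x @ b) (y @ c)) (z @ d) =
  part1 x y z b c d + part2 x y z b c d + part3 x y z b c d.
Proof.
have brl u : lin (@elin K R) (br^~ u) by move=> k v w _ ->; apply: br2.1.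
rewrite (br_rgen) /part1 /part2 /part3.
rewrite !hsum_add (hsum_app x _ (brl _)); apply: hsum_ext => x1 x2 _.
rewrite !hsum_add (hsum_app y _ (brl _)); apply: hsum_ext => y1 y2 _.
rewrite (linZ _ _ (brl _)) /csum (linsum _ _ _ (brl _)) !scaler_sumr -!big_split.
apply: eq_bigr => -[b1 b2] _; rewrite (linsum _ _ _ (brl _)) !scaler_sumr -!big_split.
apply: eq_bigr => -[c1 c2] _ /=.
have hp := uno_homog (r_ x1 y1) b1 c2.
have hx := rgen_homog x2 b2; have hy := rgen_homog y2 c1.
have hz := rgen_homog z d.
rewrite (brMl (homogM _ _ _ _ hp hx) hy hz) (brMl hp hx hz) mulrDl !scalerDr [LHS]addrC [X in X
  + _]addrC.
by rewrite -!scalerAl !ksignZ; congr (_ *: _ + _ *: _ + _); sgn.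
Qed.

Lemma hsum_hsum_exch (W : lmodType K) (y z : helt A) b c d
    (f : helt A -> helt A -> helt A -> helt A -> B -> B -> B -> B -> B -> B -> W) :
  hsum y (fun y1 y2 => csum b (fun b1 b2 => csum c (fun c1 c2 => hsum z (fun z1 z2 =>
    csum d (fun d1 d2 => f y1 y2 z1 z2 b1 b2 c1 c2 d1 d2))))) =
  hsum z (fun z1 z2 => csum b (fun b1 b2 => csum d (fun d1 d2 => hsum y (fun y1 y2 =>
    csum c (fun c1 c2 => f y1 y2 z1 z2 b1 b2 c1 c2 d1 d2))))).
Proof.
rewrite !hsum_csum_exch; apply: csum_ext => b1 b2.
transitivity (hsum y (fun y1 y2 => hsum z (fun z1 z2 => csum c (fun c1 c2 => csum d (fun d1 d2 =>
   f y1 y2 z1 z2 b1 b2 c1 c2 d1 d2))))).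
  by apply: hsum_ext => y1 y2 _; rewrite -hsum_csum_exch.
rewrite hsum_exch; apply: hsum_ext => z1 z2 _; rewrite -[RHS]hsum_csum_exch;
  apply: hsum_ext => y1 y2 _.
exact: csum_exch.
Qed.

Lemma csum_scale (W : lmodType K) (b : B) k (f : B -> B -> W) :
  k *: csum b f = csum b (fun b1 b2 => k *: f b1 b2).
Proof. exact: scaler_sumr. Qed.

(** br_slots produces the contraction of the cubic form, and slots_core absorbs the
    leftover component of y. *)
Lemma part1E x y z b c d : part1 x y z b c d =
  hsum x (fun x1 x2 => hsum y (fun y1 y2 => hsum z (fun z1 z2 =>
    ksign K (deg x2 * (deg y1 + n) + (deg x2 + deg y2) * (deg z1 + n)) *:
    csum b (fun b1 b2 => csum c (fun c1 c2 => csum d (fun d1 d2 =>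
      tricore x1 y1 z1 b1 c1 d1 * (x2 @ b2 * (y2 @ c2 * z2 @ d2)))))))).
Proof.
apply: hsum_ext => x1 x2 ex.
pose e (z1 : helt A) := deg x2 * (deg z1 + n) + deg x2 * n + deg y * (deg z + n).
transitivity (hsum z (fun z1 z2 => csum b (fun b1 b2 => csum d (fun d1 d2 => ksign K (e z1) *:
  hsum y (fun y1 y2 => ksign K ((deg z1 + n + (deg x2 + deg z2)) * deg y1) *: csum c (fun c1 c2 =>
    slots (r_ x1 y1) z1 b1 c2 d1 * (x2 @ b2 * z2 @ d2) * y2 @ c1)))))).
  pose f y1 y2 z1 z2 b1 b2 c1 c2 d1 d2 :=
    ksign K (deg x2 * (deg y1 + n) + (deg x2 + deg y2) * (deg z + n) + deg z2 * deg x2) *: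
    (slots (r_ x1 y1) z1 b1 c2 d1 * (x2 @ b2 * z2 @ d2) * y2 @ c1).
  transitivity (hsum y (fun y1 y2 => csum b (fun b1 b2 => csum c (fun c1 c2 => hsum z (fun z1 z2 =>
    csum d (fun d1 d2 => f y1 y2 z1 z2 b1 b2 c1 c2 d1 d2)))))).
    apply: hsum_ext => y1 y2 _; rewrite csum_scale; apply: csum_ext => b1 b2.
    rewrite csum_scale; apply: csum_ext => c1 c2.
    rewrite br_slots /hsum !mulr_suml scaler_sumr; apply: eq_bigr => -[z1 z2] _.
    rewrite /csum !mulr_suml scaler_sumr; apply: eq_bigr => -[d1 d2] _ /=.
    rewrite -[_ * z2 @ d2 * x2 @ b2]mulrA.
    rewrite (rep_comm (rgen_homog z2 d2) (rgen_homog x2 b2)).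
    by rewrite -scalerAr -scalerAl ksignZ.
  rewrite hsum_hsum_exch; apply: hsum_ext => z1 z2 ez; do 2!(apply: csum_ext => ? ?).
  rewrite hsum_scale; apply: hsum_ext => y1 y2 ey; rewrite ksignZ csum_scale;
    apply: csum_ext => c1 c2.
  by congr (_ *: _); rewrite /e; sgn.
pose f y1 y2 z1 z2 b1 b2 c1 c2 d1 d2 :=
    ksign K (deg x2 * (deg y1 + n) + (deg x2 + deg y2) * (deg z1 + n)) *:
    (tricore x1 y1 z1 b1 c1 d1 * (x2 @ b2 * (y2 @ c2 * z2 @ d2))).
transitivity (hsum y (fun y1 y2 => csum b (fun b1 b2 => csum c (fun c1 c2 => hsum z (fun z1 z2 =>
    csum d (fun d1 d2 => f y1 y2 z1 z2 b1 b2 c1 c2 d1 d2)))))); last first.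
  apply: hsum_ext => y1 y2 _; symmetry.
  transitivity (hsum z (fun z1 z2 => csum b (fun b1 b2 => csum c (fun c1 c2 =>
    csum d (fun d1 d2 => f y1 y2 z1 z2 b1 b2 c1 c2 d1 d2))))).
    by apply: hsum_ext => z1 z2 _; rewrite /f /csum !scaler_sumr; apply: eq_bigr => v _;
      rewrite !scaler_sumr; apply: eq_bigr => w _; rewrite !scaler_sumr.
  by rewrite hsum_csum_exch; apply: csum_ext => b1 b2; rewrite hsum_csum_exch.
rewrite hsum_hsum_exch; apply: hsum_ext => z1 z2 ez; apply: csum_ext => b1 b2;
  apply: csum_ext => d1 d2.
have hN := homogM _ _ _ _ (rgen_homog x2 b2) (rgen_homog z2 d2).
rewrite (slots_core x1 y z1 b1 c d1 hN).
rewrite hsum_scale; apply: hsum_ext => y1 y2 ey; rewrite ksignZ csum_scale;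
  apply: csum_ext => c1 c2.
rewrite /f -!mulrA (rep_comm (rgen_homog y2 c2) (rgen_homog z2 d2)).
by rewrite -!scalerAr ksignZ; congr (_ *: _); rewrite /e; sgn.
Qed.

Section SumTwo.
Variable W : lmodType K.

(** Components of x and of b are always taken together, as for a generator x_b. *)
Definition hcsum (x : helt A) (b : B) (F : helt A -> helt A -> B -> B -> W) : W :=
  hsum x (fun x1 x2 => csum b (F x1 x2)).

Lemma hcsum_ext x b F G :
  (forall x1 x2 b1 b2, deg x = deg x1 + deg x2 -> F x1 x2 b1 b2 = G x1 x2 b1 b2) ->
  hcsum x b F = hcsum x b G.
Proof. by move=> h; apply: hsum_ext => x1 x2 ex; apply: csum_ext => b1 b2; apply: h. Qed.

Lemma hcsum_scale x b k F : k *: hcsum x b F = hcsum x b (fun x1 x2 b1 b2 => k *: F x1 x2 b1 b2).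
Proof. by rewrite /hcsum hsum_scale; apply: hsum_ext => x1 x2 _; rewrite csum_scale. Qed.

Lemma hcsum_cancel x b k1 k2 k3 F G H :
  (forall x1 x2 b1 b2, deg x = deg x1 + deg x2 ->
     k1 *: F x1 x2 b1 b2 + k2 *: G x1 x2 b1 b2 + k3 *: H x1 x2 b1 b2 = 0) ->
  k1 *: hcsum x b F + k2 *: hcsum x b G + k3 *: hcsum x b H = 0.
Proof.
move=> h; rewrite !hcsum_scale /hcsum !hsum_add [LHS]big1 // => -[x1 x2] /eqP ex /=.
by rewrite /csum -!big_split big1 // => -[b1 b2] _ /=; apply: h.
Qed.

Lemma hcsum_exch x b y c F :
  hcsum x b (fun x1 x2 b1 b2 => hcsum y c (F x1 x2 b1 b2)) =
  hcsum y c (fun y1 y2 c1 c2 => hcsum x b (fun x1 x2 b1 b2 => F x1 x2 b1 b2 y1 y2 c1 c2)).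
Proof.
transitivity (hsum x (fun x1 x2 => hsum y (fun y1 y2 => csum b (fun b1 b2 =>
  csum c (F x1 x2 b1 b2 y1 y2))))).
  by apply: hsum_ext => x1 x2 _; rewrite hsum_csum_exch.
rewrite hsum_exch; apply: hsum_ext => y1 y2 _; rewrite -[RHS]hsum_csum_exch.
by apply: hsum_ext => x1 x2 _; apply: csum_exch.
Qed.

Lemma hcsum_exch3 x b y c z d F :
  hcsum x b (fun x1 x2 b1 b2 => hcsum y c (fun y1 y2 c1 c2 =>
    hcsum z d (F x1 x2 b1 b2 y1 y2 c1 c2))) =
  hcsum z d (fun z1 z2 d1 d2 => hcsum y c (fun y1 y2 c1 c2 => hcsum x b (fun x1 x2 b1 b2 =>
    F x1 x2 b1 b2 y1 y2 c1 c2 z1 z2 d1 d2))).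
Proof.
rewrite hcsum_exch [RHS]hcsum_exch; apply: hcsum_ext => y1 y2 c1 c2 _.
exact: hcsum_exch.
Qed.

Lemma hsum_hcsum x y b c k (F : helt A -> helt A -> helt A -> helt A -> B -> B -> B -> B -> W) :
  hsum x (fun x1 x2 => hsum y (fun y1 y2 => k x1 x2 y1 y2 *: csum b (fun b1 b2 =>
    csum c (fun c1 c2 =>
    F x1 x2 y1 y2 b1 b2 c1 c2)))) =
  hcsum x b (fun x1 x2 b1 b2 => hcsum y c (fun y1 y2 c1 c2 =>
    k x1 x2 y1 y2 *: F x1 x2 y1 y2 b1 b2 c1 c2)).
Proof.
apply: hsum_ext => x1 x2 _; rewrite [RHS](_ : _ =
  hsum y (fun y1 y2 => csum b (fun b1 b2 => csum c (fun c1 c2 =>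
   k x1 x2 y1 y2 *: F x1 x2 y1 y2 b1 b2 c1 c2)))); last by rewrite hsum_csum_exch.
apply: hsum_ext => y1 y2 _; rewrite csum_scale; apply: csum_ext => b1 b2.
by rewrite csum_scale.
Qed.
End SumTwo.

Lemma hcsum_app (W W' : lmodType K) x b (g : W -> W') F : lin (@elin K W) g ->
  g (hcsum x b F) = hcsum x b (fun x1 x2 b1 b2 => g (F x1 x2 b1 b2)).
Proof.
move=> gl; rewrite /hcsum (hsum_app x _ gl); apply: hsum_ext => x1 x2 _.
by rewrite /csum (linsum _ _ _ gl).
Qed.

Lemma hcsum_mull x b (F : helt A -> helt A -> B -> B -> R) (r : R) :
  hcsum x b F * r = hcsum x b (fun x1 x2 b1 b2 => F x1 x2 b1 b2 * r).
Proof. by rewrite (hcsum_app x b (g := fun u => u * r)) //; lint. Qed.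

Lemma uno_core_hcsum p (M : R) (x y : helt A) (b c : B) : homog p M ->
  hcsum y c (fun y1 y2 c1 c2 => ksign K (p * deg y1) *: (uno (el (r_ x y1)) b c2 * M * y2 @ c1)) =
  hcsum y c (fun y1 y2 c1 c2 => ksign K (p * deg y1) *: (duocore x y1 b c1 * M * y2 @ c2)).
Proof.
move=> hM; have := uno_core x y b c hM.
rewrite /hcsum => h; transitivity (hsum y (fun y1 Y => ksign K (p * deg y1) *: csum c (fun c1 c2 =>
    uno (el (r_ x y1)) b c2 * M * Y @ c1))).
  by apply: hsum_ext => y1 y2 _; rewrite csum_scale.
by rewrite h; apply: hsum_ext => y1 y2 _; rewrite csum_scale.
Qed.

(** The products of two contractions of the pairing, of x' with y' and of x'' with z';
    they occur in the double brackets of (x, y, z) and of (z, x, y). *)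
Definition crossed (x y z : helt A) b c d : R :=
  hcsum z d (fun z1 z2 d1 d2 => hcsum y c (fun y1 y2 c1 c2 => hcsum x b (fun x1 X b1 b' =>
    hcsum X b' (fun x2 x3 b2 b3 =>
      ksign K ((deg x2 + deg x3) * (deg y1 + n) + deg y2 * (deg z + n)
         + deg x3 * (deg z1 + n) + deg z2 * deg y2) *:
      (duocore x1 y1 b1 c1 * duocore x2 z1 b2 d1 * (x3 @ b3 * (y2 @ c2 * z2 @ d2))))))).

Hypothesis br_homog : forall p q x y, homog p x -> homog q y -> homog (p + q + n) (br x y).

Lemma part2E x y z b c d : part2 x y z b c d = crossed x y z b c d.
Proof.
rewrite /part2 hsum_hcsum /crossed -hcsum_exch3; apply: hcsum_ext => x1 X b1 b' ex.
have hM : homog (deg X + deg z + n) (br (X @ b') (z @ d)).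
  by apply: br_homog; apply: rgen_homog.
transitivity (ksign K (deg X * n + deg y * (deg z + n)) *: hcsum y c (fun y1 y2 c1 c2 =>
  ksign K ((deg X + deg z + n) * deg y1) *:
    (duocore x1 y1 b1 c1 * br (X @ b') (z @ d) * y2 @ c2))).
  rewrite -uno_core_hcsum // hcsum_scale; apply: hcsum_ext => y1 y2 c1 c2 ey.
  by rewrite ksignZ; congr (_ *: _); sgn.
rewrite hcsum_scale; apply: hcsum_ext => y1 y2 c1 c2 ey; rewrite ksignZ.
rewrite (br_rgen_core) hsum_hcsum hcsum_exch.
pose g (u : R) := duocore x1 y1 b1 c1 * u * y2 @ c2.
rewrite -/(g _) hcsum_app; last by rewrite /g; lint.
rewrite hcsum_scale; apply: hcsum_ext => z1 z2 d1 d2 ez.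
rewrite hcsum_app; last by rewrite /g; lint.
rewrite hcsum_scale; apply: hcsum_ext => x2 x3 b2 b3 eX.
rewrite /g -scalerAr -scalerAl ksignZ -!mulrA.
rewrite (rep_comm (rgen_homog z2 d2) (rgen_homog y2 c2)).
by rewrite -!scalerAr ksignZ; congr (_ *: _); sgn.
Qed.

(** The components of x and those of b are split in opposite orders; cocommutativity
    of A reconciles them. *)
Lemma hcsum_coassoc_mid (W : lmodType K) x b
    (f : helt A -> helt A -> helt A -> B -> B -> B -> W) :
  (forall x2 x3 b1 b2 b3, lin hA (fun x1 => f x1 x2 x3 b1 b2 b3)) ->
  (forall x1 x3 b1 b2 b3, lin hA (fun x2 => f x1 x2 x3 b1 b2 b3)) ->
  (forall x1 x2 b1 b2 b3, lin hA (fun x3 => f x1 x2 x3 b1 b2 b3)) ->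
  (forall x1 x2 x3, lin3 (f x1 x2 x3)) ->
  hcsum x b (fun x1 X B1 b3 => hcsum X B1 (fun x2 x3 b1 b2 => f x1 x2 x3 b1 b2 b3)) =
  hcsum x b (fun x2 X b1 b' => hcsum X b' (fun x1 x3 b2 b3 =>
    ksign K (deg x1 * deg x2) *: f x1 x2 x3 b1 b2 b3)).
Proof.
move=> f1 f2 f3 fb.
have fb1 x1 x2 x3 b2 b3 : lin eB (fun b1 => f x1 x2 x3 b1 b2 b3) by case: (fb x1 x2 x3).
have fb2 x1 x2 x3 b1 b3 : lin eB (fun b2 => f x1 x2 x3 b1 b2 b3) by case: (fb x1 x2 x3).
have fb3 x1 x2 x3 b1 b2 : lin eB (fun b3 => f x1 x2 x3 b1 b2 b3) by case: (fb x1 x2 x3).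
pose g x1 x2 x3 := csum b (fun b1 b' => csum b' (fun b2 b3 => f x1 x2 x3 b1 b2 b3)).
transitivity (hsum x (fun x1 X => hsum X (fun x2 x3 => g x1 x2 x3))).
  apply: hsum_ext => x1 X _; rewrite -hsum_csum_exch; apply: hsum_ext => x2 x3 _.
  exact: (csum_coassoc b (f := f x1 x2 x3)).
have gl1 x2 x3 : lin hA (fun x1 => g x1 x2 x3) by rewrite /g; do 2!(apply: lin_csum_body => ? ?).
have gl2 x1 x3 : lin hA (fun x2 => g x1 x2 x3) by rewrite /g; do 2!(apply: lin_csum_body => ? ?).
have gl3 x1 x2 : lin hA (fun x3 => g x1 x2 x3) by rewrite /g; do 2!(apply: lin_csum_body => ? ?).
rewrite -(hsum_coassoc x (F := g)) //.
transitivity (hsum x (fun X x3 => hsum X (fun x2 x1 => ksign K (deg x2 * deg x1) *: g x1 x2 x3))).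
  by apply: hsum_ext => X x3 _; apply: (hsum_cocomm X A_cocomm (F := fun x1 x2 => g x1 x2 x3));
    split=> ?.
rewrite (hsum_coassoc x (F := fun x2 x1 x3 => ksign K (deg x2 * deg x1) *: g x1 x2 x3)).
- apply: hsum_ext => x2 X _; rewrite /hcsum -hsum_csum_exch; apply: hsum_ext => x1 x3 _.
  rewrite /g csum_scale; apply: csum_ext => b1 b'; rewrite csum_scale; apply: csum_ext => b2 b3.
  by rewrite [deg x2 * _]mulrC.
- by move=> *; apply: (lin_scale (c := fun x2 : helt A => ksign K (deg x2 * _))); [degc|].
- by move=> *; apply: (lin_scale (c := fun x2 : helt A => ksign K (_ * deg x2))); [degc|].
- by move=> *; apply: lin_scalec.
Qed.

(** The minus sign is the one of the antisymmetry of duocore in x'' and z'. *)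
Lemma part3E x y z b c d : part3 z x y d b c =
  - (ksign K ((deg x + n) * (deg z + n) + (deg y + n) * (deg z + n)) *: crossed x y z b c d).
Proof.
rewrite /part3 hsum_hcsum /crossed hcsum_scale -scaleN1r hcsum_scale;
  apply: hcsum_ext => z1 z2 d1 d2 ez.
transitivity (hcsum y c (fun y1 y2 c1 c2 => hcsum x b (fun x1 X B1 b3 =>
  hcsum X B1 (fun x2 x3 b1 b2 =>
  ksign K (deg z2 * (deg x1 + n) + deg x3 * (deg y1 + n)) *:
  (uno (el (r_ z1 x1)) d1 b3 * z2 @ d2 * (duocore x2 y1 b1 c1 * x3 @ b2 * y2 @ c2)))))).
  rewrite -hcsum_exch; apply: hcsum_ext => x1 X B1 b3 ex.
  rewrite (br_rgen_core) hsum_hcsum hcsum_exch.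
  pose g (u : R) := uno (el (r_ z1 x1)) d1 b3 * z2 @ d2 * u.
  rewrite -/(g _) hcsum_app; last by rewrite /g; lint.
  rewrite hcsum_scale; apply: hcsum_ext => y1 y2 c1 c2 ey.
  rewrite hcsum_app; last by rewrite /g; lint.
  rewrite hcsum_scale; apply: hcsum_ext => x2 x3 b1 b2 eX.
  by rewrite /g -scalerAr ksignZ.
rewrite hcsum_scale -[RHS]scale1r hcsum_scale hcsum_scale; apply: hcsum_ext => y1 y2 c1 c2 ey;
  rewrite scale1r.
rewrite (hcsum_coassoc_mid x b (f := fun x1 x2 x3 b1 b2 b3 =>
  ksign K (deg z2 * (deg x1 + n) + deg x3 * (deg y1 + n)) *:
  (uno (el (r_ z1 x1)) d1 b3 * z2 @ d2 * (duocore x2 y1 b1 c1 * x3 @ b2 * y2 @ c2))));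
  try by lint.
2: by move=> *; split=> *; lint.
rewrite !hcsum_scale; apply: hcsum_ext => x2 V b1 b' ex.
pose M : R := z2 @ d2 * duocore x2 y1 b1 c1.
have hM : homog (deg z2 + (deg x2 + deg y1 + n)) M.
  by apply: homogM; [apply: rgen_homog | apply: duocore_homog].
transitivity (ksign K (deg z2 * n + deg V * (deg y1 + n)) *: (hcsum V b' (fun x1 x3 b2 b3 =>
   ksign K ((deg z2 + (deg x2 + deg y1 + n)) * deg x1) *:
     (duocore z1 x1 d1 b2 * M * x3 @ b3)) * y2 @ c2)).
  rewrite -uno_core_hcsum // hcsum_mull hcsum_scale; apply: hcsum_ext => x1 x3 b2 b3 eV.
  by rewrite -scalerAl !ksignZ /M !mulrA; congr (_ *: _); sgn.
rewrite hcsum_mull !hcsum_scale; apply: hcsum_ext => x1 x3 b2 b3 eV.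
rewrite (duocore_anti z1 x1).
have hC := duocore_homog x2 y1 b1 c1.
have hD := duocore_homog x1 z1 b2 d1.
rewrite scaleN1r !(mulNr, scalerN); congr (- _).
rewrite -!scalerAl !ksignZ /M !mulrA.
rewrite -[duocore x1 _ _ _ * _ * duocore x2 _ _ _]mulrA (rep_comm (rgen_homog z2 d2) hC).
rewrite -scalerAr -!scalerAl mulrA (rep_comm hD hC) -!scalerAl !ksignZ -!mulrA.
rewrite [z2 @ d2 * _]mulrA (rep_comm (rgen_homog z2 d2) (rgen_homog x3 b3)).
rewrite -scalerAl -mulrA (rep_comm (rgen_homog z2 d2) (rgen_homog y2 c2)).
by rewrite -!scalerAr !ksignZ; congr (_ *: _); sgn.
Qed.

Lemma hcsum_rot (W : lmodType K) x b y c z d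
    (F : helt A -> helt A -> B -> B -> helt A -> helt A -> B -> B ->
         helt A -> helt A -> B -> B -> W) :
  hcsum y c (fun y1 y2 c1 c2 => hcsum z d (fun z1 z2 d1 d2 => hcsum x b (fun x1 x2 b1 b2 =>
    F x1 x2 b1 b2 y1 y2 c1 c2 z1 z2 d1 d2))) =
  hcsum x b (fun x1 x2 b1 b2 => hcsum y c (fun y1 y2 c1 c2 => hcsum z d (fun z1 z2 d1 d2 =>
    F x1 x2 b1 b2 y1 y2 c1 c2 z1 z2 d1 d2))).
Proof. by rewrite [RHS]hcsum_exch; apply: hcsum_ext => y1 y2 c1 c2 _; rewrite hcsum_exch. Qed.

Lemma part1_hcsum x y z b c d : part1 x y z b c d =
  hcsum x b (fun x1 x2 b1 b2 => hcsum y c (fun y1 y2 c1 c2 => hcsum z d (fun z1 z2 d1 d2 =>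
    ksign K (deg x2 * (deg y1 + n) + (deg x2 + deg y2) * (deg z1 + n)) *:
     (tricore x1 y1 z1 b1 c1 d1 * (x2 @ b2 * (y2 @ c2 * z2 @ d2)))))).
Proof.
rewrite part1E; apply: hsum_ext => x1 x2 _.
transitivity (hsum y (fun y1 y2 => csum b (fun b1 b2 => hsum z (fun z1 z2 =>
  csum c (fun c1 c2 => csum d (fun d1 d2 =>
    ksign K (deg x2 * (deg y1 + n) + (deg x2 + deg y2) * (deg z1 + n)) *:
     (tricore x1 y1 z1 b1 c1 d1 * (x2 @ b2 * (y2 @ c2 * z2 @ d2))))))))).
  apply: hsum_ext => y1 y2 _; rewrite -hsum_csum_exch; apply: hsum_ext => z1 z2 _.
  by rewrite csum_scale; apply: csum_ext => b1 b2; rewrite csum_scale;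
    apply: csum_ext => c1 c2; rewrite csum_scale.
rewrite hsum_csum_exch; apply: csum_ext => b1 b2; apply: hsum_ext => y1 y2 _.
by rewrite hsum_csum_exch.
Qed.

Lemma core_ext (Q : lmodType K) (F G : helt A -> helt A -> Q) x y z :
  (forall u v, F u v = G u v) -> core rho_homog F x y z = core rho_homog G x y z.
Proof.
by move=> h; rewrite /core; do 3!(apply: hsum_ext => ? ? _); rewrite h.
Qed.

Hypothesis gerst : gerstenhaber_fox n rho.

(** core_cyclic for the form tri; tri_cycle puts the empty slot first in each term. *)
Lemma tricore_cycle x y z b c d : tricore x y z b c d
  + ksign K ((deg x + n) * ((deg y + n) + (deg z + n))) *: tricore y z x c d b
  + ksign K ((deg z + n) * ((deg x + n) + (deg y + n))) *: tricore z x y d b c = 0.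
Proof.
have [l1 l2 l3] : lin3 (fun a1 a2 a3 => tri a1 a2 a3 b c d).
  by split=> ? ?; lint.
rewrite -(core_cyclic rho2 rho_homog A_cocomm l1 l2 l3
  (tri_inv b c d) gerst x y z).
have e1 u v : tri 1 (el u) (el v) c d b = ksign K (deg u * deg v) *: tri (el v) 1 (el u) b c d.
  rewrite (tri_cycle hone u v) /=; congr (_ *: _).
  by rewrite add0r mulrC.
congr (_ + _ *: _ + _ *: _); apply: core_ext => // u v.
rewrite (tri_cycle hone u v).
by rewrite (tri_cycle v hone u) /= ksignZ addr0 add0r mulrC -[LHS](ksignK (deg u *
  deg v)) !ksignZ (@ksign_parity _ _ 0) ?ksign0 ?scale1r //; parity_tauto.
Qed.

Lemma jacobi_rgen (x y z : helt A) (b c d : B) :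
  ksign K ((deg x + n) * (deg z + n)) *: br (br (x @ b) (y @ c)) (z @ d)
  + ksign K ((deg x + n) * (deg y + n)) *: br (br (y @ c) (z @ d)) (x @ b)
  + ksign K ((deg y + n) * (deg z + n)) *: br (br (z @ d) (x @ b)) (y @ c) = 0.
Proof.
have cross x' y' z' b' c' d' :
    ksign K ((deg x' + n) * (deg z' + n)) *: part2 x' y' z' b' c' d' =
    - (ksign K ((deg y' + n) * (deg z' + n)) *: part3 z' x' y' d' b' c').
  by rewrite part2E part3E scalerN opprK ksignZ; congr (_ *: _); sgn.
have cancel (V : zmodType) (a1 a2 a3 p q r : V) :
    a1 - p + q + (a2 - q + r) + (a3 - r + p) = a1 + a2 + a3.
  have e a u v : a - u + v = a + (v - u) :> V by rewrite -addrA [- u + v]addrC.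
  rewrite !e [a1 + _ + (a2 + _)]addrACA [LHS]addrACA -[RHS]addr0; congr (_ + _).
  by rewrite [q - p + _]addrC -[RHS](subrr r) !addrA !subrK.
rewrite !br_br_rgen !scalerDr cross.
have := cross y z x c d b; rewrite ![(_ + n) * (deg x + n)]mulrC => ->.
have := cross z x y d b c; rewrite [(deg z + n) * _]mulrC => ->.
rewrite cancel !part1_hcsum (hcsum_rot x b) -(hcsum_rot z d).
apply: hcsum_cancel => x1 x2 b1 b2 ex; apply: hcsum_cancel => y1 y2 c1 c2 ey.
apply: hcsum_cancel => z1 z2 d1 d2 ez.
have := congr1 (fun u => u * (x2 @ b2 * (y2 @ c2 * z2 @ d2))) (tricore_cycle x1 y1 z1 b1 c1 d1).
rewrite mul0r !mulrDl -!scalerAl => h.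
rewrite -[RHS](scaler0 _ (ksign K ((deg x + n) * (deg z + n) +
  deg x2 * (deg y1 + n) + (deg x2 + deg y2) * (deg z1 + n)))) -h.
rewrite [y2 @ c2 * (z2 @ d2 * _)]mulrA.
have hyz := homogM _ _ _ _ (rgen_homog y2 c2) (rgen_homog z2 d2).
have hxy := homogM _ _ _ _ (rgen_homog x2 b2) (rgen_homog y2 c2).
rewrite (rep_comm hyz (rgen_homog x2 b2)).
rewrite (rep_comm (rgen_homog z2 d2) hxy) -!mulrA -!scalerAr !scalerDr !ksignZ.
by congr (_ *: _ + _ *: _ + _ *: _); sgn.
Qed.
End Slots.

(** * From generators to the representation algebra *)

Section Leibniz.
Variables (K : comNzRingType) (R : gradedAlgType K) (n : int) (br : R -> R -> R).
Hypothesis brG : graded_bracket n br.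

Let br2 : is_bilinear br. Proof. by case: brG. Qed.
Let br_homog p q x y : homog p x -> homog q y -> homog (p + q + n) (br x y).
Proof. by case: brG => _ h _ _; apply: h. Qed.
Let brMr p q r x y z : homog p x -> homog q y -> homog r z ->
  br x (y * z) = br x y * z + ksign K ((p + n) * q) *: (y * br x z).
Proof. by case: brG => _ _ h _; apply: h. Qed.
Let brMl p q r x y z : homog p x -> homog q y -> homog r z ->
  br (x * y) z = x * br y z + ksign K (q * (r + n)) *: (br x z * y).
Proof. by case: brG => _ _ _ h; apply: h. Qed.
Let brl y : lin (@elin K R) (br^~ y). Proof. by move=> k u v _ ->; apply: br2.1. Qed.
Let brr x : lin (@elin K R) (br x). Proof. by move=> k u v _ ->; apply: br2.2. Qed.

Lemma br1l r y : homog r y -> br 1 y = 0.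
Proof.
move=> hy; have := brMl (@homog1 _ R) (@homog1 _ R) hy.
by rewrite !mul1r mulr1 mul0r ksign0 scale1r => h; apply: (addIr (br 1 y)); rewrite add0r -h.
Qed.

Lemma br1r r y : homog r y -> br y 1 = 0.
Proof.
move=> hy; have := brMr hy (@homog1 _ R) (@homog1 _ R).
by rewrite !mul1r mulr1 mulr0 ksign0 scale1r => h; apply: (addIr (br y 1)); rewrite add0r -h.
Qed.

Definition anti_at p q x y := br x y = - (ksign K ((p + n) * (q + n)) *: br y x).

Lemma anti_atC p q x y : anti_at p q x y -> anti_at q p y x.
Proof. by rewrite /anti_at => ->; rewrite scalerN opprK mulrC ksignK. Qed.

Lemma anti_at0 p q y : anti_at p q 0 y.
Proof. by rewrite /anti_at (lin0 (brl y)) (lin0 (brr y)) scaler0 oppr0. Qed.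

Lemma anti_at1 q y : homog q y -> anti_at 0 q 1 y.
Proof. by move=> hy; rewrite /anti_at (br1l hy) (br1r hy) scaler0 oppr0. Qed.

Lemma anti_atP p q k u v y : anti_at p q u y -> anti_at p q v y -> anti_at p q (k *: u + v) y.
Proof.
rewrite /anti_at => hu hv; rewrite br2.1 br2.2 hu hv !scalerDr opprD scalerN.
by rewrite scaleC.
Qed.

Lemma anti_atM p q r u v y : homog p u -> homog q v -> homog r y ->
  anti_at p r u y -> anti_at q r v y -> anti_at (p + q) r (u * v) y.
Proof.
rewrite /anti_at => hu hv hy au av.
rewrite (brMl hu hv hy) (brMr hy hu hv) au av addrC !scalerDr opprD.
rewrite mulrN mulNr scalerN -!scalerAl -!scalerAr !ksignZ.
by congr (- (_ *: _) + - (_ *: _)); sgn.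
Qed.

(** The Jacobi identity with the inner bracket on the left: an expression invariant
    under cyclic permutations, so that it suffices to treat products in the first
    argument. *)
Definition jac_at p q r u v w :=
  ksign K ((p + n) * (r + n)) *: br (br u v) w
  + ksign K ((p + n) * (q + n)) *: br (br v w) u
  + ksign K ((q + n) * (r + n)) *: br (br w u) v = 0.

Lemma jac_at_cycle p q r u v w : jac_at p q r u v w -> jac_at q r p v w u.
Proof.
rewrite /jac_at => h; rewrite -[RHS]h addrC addrA ![(q + n) * (p + n)]mulrC.
by rewrite ![(r + n) * (p + n)]mulrC.
Qed.

Lemma jac_at0 p q r v w : jac_at p q r 0 v w.
Proof.
by rewrite /jac_at (lin0 (brl v)) (lin0 (brr w)) (lin0 (brl w)) (lin0 (brl v))
  (lin0 (brr _)) !scaler0 !addr0.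
Qed.

Lemma jac_at1 q r v w : homog q v -> homog r w -> jac_at 0 q r 1 v w.
Proof.
move=> hv hw; rewrite /jac_at (br1l hv) (br1r hw) (lin0 (brl w)) (lin0 (brl v)).
by rewrite (br1r (br_homog hv hw)) !scaler0 !addr0.
Qed.

Lemma jac_atP p q r k u u' v w : jac_at p q r u v w -> jac_at p q r u' v w ->
  jac_at p q r (k *: u + u') v w.
Proof.
rewrite /jac_at => h h'; rewrite br2.1 [br w (_ + _)]br2.2 br2.2 !br2.1 !scalerDr.
rewrite ![ksign _ _ *: (k *: _)]scaleC (AC (2*2*2) ((1*3*5)*(2*4*6))) /= -!scalerDr h h'.
by rewrite scaler0 add0r.
Qed.

Hypothesis br_anti : antisymmetric_bracket n br.

(** The Leibniz rule also gives products of two brackets, each of them twice; they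
    cancel by antisymmetry. *)
Lemma jac_atM p1 p2 q r u1 u2 v w :
  homog p1 u1 -> homog p2 u2 -> homog q v -> homog r w ->
  jac_at p1 q r u1 v w -> jac_at p2 q r u2 v w -> jac_at (p1 + p2) q r (u1 * u2) v w.
Proof.
rewrite /jac_at => hu1 hu2 hv hw h1 h2.
have h1' := congr1 (fun z => ksign K (p2 * (q + n)) *: (z * u2)) h1.
have h2' := congr1 (fun z => ksign K (p1 * (r + n)) *: (u1 * z)) h2.
have ew z p u : homog p u -> br w u * z = - (ksign K ((r + n) * (p + n)) *: (br u w * z)).
  by move=> hu; rewrite (br_anti hw hu) mulNr scalerAl.
have ew' : br u1 v * br w u2 = - (ksign K ((r + n) * (p2 + n)) *: (br u1 v * br u2 w)).
  by rewrite (br_anti hw hu2) mulrN scalerAr.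
rewrite (brMl hu1 hu2 hv) (brMr hw hu1 hu2) (brMr (br_homog hv hw) hu1 hu2).
rewrite [br (u1 * _ + _) w](linD (brl w)) (linZ _ _ (brl w)).
rewrite [br (_ + _ *: (u1 * _)) v](linD (brl v)) (linZ _ _ (brl v)).
rewrite (brMl hu1 (br_homog hu2 hv) hw) (brMl (br_homog hu1 hv) hu2 hw).
rewrite (brMl (br_homog hw hu1) hu2 hv) (brMl hu1 (br_homog hw hu2) hv).
rewrite ew' (ew _ _ _ hu1) !scalerDr !scalerN !ksignZ.
rewrite [LHS](AC (2*2*2*(2*2)) ((4*5*8)*(1*6*9)*(2*7)*(3*10))) /=.
rewrite [X in _ + (X - _) + _](_ : _ = ksign K ((q + n) * (r + n) + (r + n) * (p1 + n)) *:
  (br u1 w * br u2 v)) ?subrr; last by congr (_ *: _); sgn.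
rewrite [X in _ + (X - _)](_ : _ = ksign K ((q + n) * (r + n) + (r + n) * p1 +
  (r + p2 + n) * (q + n) + (r + n) * (p2 + n)) *: (br u1 v * br u2 w)) ?subrr;
    last by congr (_ *: _); sgn.
rewrite !addr0 -[RHS]addr0; congr (_ + _).
  move: h1'; rewrite mul0r scaler0 !mulrDl -!scalerAl !scalerDr !ksignZ => <-.
  by congr (_ *: _ + _ *: _ + _ *: _); sgn.
move: h2'; rewrite mulr0 scaler0 !mulrDr -!scalerAr !scalerDr !ksignZ => <-.
by congr (_ *: _ + _ *: _ + _ *: _); sgn.
Qed.
End Leibniz.

Section Generators.
Variables (K : comNzRingType) (A B : gradedHopfType K).
Hypothesis B_ungraded : ungraded B.
Notation R := (rep_alg A B).
Notation "x @ b" := (rgen (el x) b) (at level 30).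

(** As B is ungraded, a generator x_b of nonzero degree in b is zero. *)
Lemma rep_homog_ind (P : int -> R -> Prop) :
  (forall (x : helt A) (b : B), P (deg x) (x @ b)) ->
  (forall p, P p 0) -> P 0 1 ->
  (forall p k u v, P p u -> P p v -> P p (k *: u + v)) ->
  (forall p q u v, homog p u -> homog q v -> P p u -> P q v -> P (p + q) (u * v)) ->
  forall p u, homog p u -> P p u.
Proof.
move=> Pg P0 P1 PP PM p u; elim=> {p u} //.
- move=> p q x b hx hb; have [/= ->|/= ->] := ungraded_deg B_ungraded (HElt hb).
    by rewrite addr0; apply: (Pg (HElt hx)).
  by rewrite -[0](scale0r 0) rgenZr scale0r.
- by move=> p k u v _ hu _ hv; apply: PP.
- by move=> p q u v hu Pu hv Pv; apply: PM.
Qed.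
End Generators.

Theorem theorem9p1 (K : comNzRingType) (A B : gradedHopfType K) (n : int)
    (rho : A -> A -> A) (t : B) (br : rep_alg A B -> rep_alg A B -> rep_alg A B)
    (A_cocomm : cocommutative A)
    (rho_fox : fox_pairing n rho)
    (rho_antisym : antisymmetric_fox n rho)
    (B_ungraded : ungraded B)
    (B_comm : graded_commutative B)
    (t_tracelike : trace_like t)
    (br_graded : graded_bracket n br)
    (br_formula : rep_bracket_formula n rho (trace_pairing t) br) :
  gerstenhaber_fox n rho -> gerstenhaber_bracket n br.
Proof.
move=> gerst; have [rho2 rho_homog rhoMr rhoMl] := rho_fox.
have [br2 br_homog brMr brMl] := br_graded.
have hgen (x : helt A) (b : B) := rgen_homog B_ungraded x b.
have anti : antisymmetric_bracket n br.
  have ext q y : homog q y ->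
      (forall (x : helt A) b, anti_at n br (deg x) q (rgen (el x) b) y) ->
      forall p u, homog p u -> anti_at n br p q u y.
    move=> hy hg; apply: (rep_homog_ind B_ungraded) => //.
    - by move=> p; apply: anti_at0.
    - exact: anti_at1.
    - by move=> p k u v; apply: anti_atP.
    - by move=> p r u v hu hv; apply: anti_atM.
  move=> p q u v hu hv; apply: (ext _ _ hv _ p u hu) => x b; apply: anti_atC.
  apply: (ext _ _ (hgen x b) _ q v hv) => y c.

  exact: (br_rgen_anti A_cocomm B_ungraded B_comm t_tracelike rho2 rho_homog).
have ext q r v w : homog q v -> homog r w ->
    (forall (x : helt A) b, jac_at n br (deg x) q r (rgen (el x) b) v w) ->
    forall p u, homog p u -> jac_at n br p q r u v w.
  move=> hv hw hg; apply: (rep_homog_ind B_ungraded) => //.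
  - by move=> p; apply: jac_at0.
  - exact: jac_at1.
  - by move=> p k u u'; apply: jac_atP.
  - by move=> p p' u u' hu hu'; apply: jac_atM.
have jac p q r u v w : homog p u -> homog q v -> homog r w -> jac_at n br p q r u v w.
  move=> hu hv hw; apply: (ext _ _ _ _ hv hw _ p u hu) => x b; do 2!apply: jac_at_cycle.
  apply: (ext _ _ _ _ hw (hgen x b) _ q v hv) => y c; do 2!apply: jac_at_cycle.
  apply: (ext _ _ _ _ (hgen x b) (hgen y c) _ r w hw) => z d.
  apply: jac_at_cycle.
  exact: (jacobi_rgen A_cocomm B_ungraded B_comm t_tracelike rho2 rho_homog).
split=> // p q r u v w hu hv hw.
have := jac p q r u v w hu hv hw; rewrite /jac_at.
rewrite (anti _ _ _ _ (br_homog _ _ _ _ hu hv) hw).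
rewrite (anti _ _ _ _ (br_homog _ _ _ _ hv hw) hu).
rewrite (anti _ _ _ _ (br_homog _ _ _ _ hw hu) hv).
rewrite !scalerN !ksignZ -!opprD => /eqP; rewrite oppr_eq0 => /eqP h.
rewrite -[RHS]h [LHS]addrC addrA.
by congr (_ *: _ + _ *: _ + _ *: _); sgn.
Qed.
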